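(* Let $n\geq 2$ and $\lambda,\nu\in\mathbb{C}^2$. The following identities of operators $C^\infty(\mathbb{R}\mathrm{P}^n)\to C^\infty(\mathbb{R}\mathrm{P}^{n-1})$ hold, for $j,N\in\mathbb{Z}_{\ge0}$: $$A_{\lambda,\nu}=(-1)^j\frac{j!}{(2j)!\,\Gamma(\frac{\lambda_1+\rho_1-\nu_1-\rho_1'}{2})}A^{(1)}_{\lambda,\nu}\qquad\text{for }\nu_1=-\rho_1'-2j,$$ $$A_{\lambda,\nu}=(-1)^N\frac{N!}{(2N)!\,\Gamma(\frac{\nu_1+\rho_1'}{2})}A^{(2)}_{\lambda,\nu}\qquad\text{for }\lambda_1+\rho_1-\nu_1-\rho_1'=-2N.$$ If $n=2$, then moreover $$A_{\lambda,\nu}=\tfrac{1}{\sqrt\pi}\,C_{\lambda,\nu}\quad\text{for }\nu_1+\rho_1'=-2\rho_2,\qquad B_{\lambda,\nu}=\sqrt\pi\,C_{\lambda,\nu}\quad\text{for }\nu_1+\rho_1'=0.$$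
   Context: Let $n\ge2$, $\rho_1=\frac{n+1}{2}$, $\rho_1'=\frac n2$, $\rho_2=-\frac12$, and $\lambda=(\lambda_1,\lambda_2),\nu=(\nu_1,\nu_2)\in\mathbb{C}^2$. Operators $C^\infty(\mathbb{R}\mathrm{P}^n)\to C^\infty(\mathbb{R}\mathrm{P}^{n-1})$ (the integrals are defined where they converge and extended holomorphically in the parameters; the families so normalized are holomorphic in $(\lambda,\nu)$; $1/\Gamma$ is the entire reciprocal Gamma function): $$A_{\lambda,\nu}\varphi([y])=\int_{S^1}\frac{|\omega_1|^{\nu_1+\rho_1'-1}|\omega_2|^{\lambda_1+\rho_1-\nu_1-\rho_1'-1}}{2\Gamma(\frac{\nu_1+\rho_1'}2)\Gamma(\frac{\lambda_1+\rho_1-\nu_1-\rho_1'}2)}\varphi\big([\omega_1\tfrac{y}{|y|}:\omega_2]\big)\,d(\omega_1,\omega_2),$$ $$B_{\lambda,\nu}\varphi([y])=\frac1{2\Gamma(\frac{\lambda_1-\rho_1+1}2)}\int_{S^n}|\omega_{n+1}|^{\lambda_1-\rho_1}\varphi([\omega])\,d\omega,$$ for $n=2$: $$C_{\lambda,\nu}\varphi([y])=\int_{S^2}\frac{\big|\frac{\omega_2y_1-\omega_1y_2}{|y|}\big|^{-\nu_1-\rho_1'}|\omega_3|^{\lambda_1+\rho_1+\nu_1-\rho_1'-1}}{2\Gamma(\frac{-\nu_1-\rho_1'+1}2)\Gamma(\frac{\lambda_1+\rho_1+\nu_1-\rho_1'}2)}\varphi([\omega])\,d\omega,$$ for $\nu_1=-\rho_1'-2j$,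 $j\in\mathbb{Z}_{\ge0}$: $$A^{(1)}_{\lambda,\nu}\varphi([y])=|y|^{\nu_1+\rho_1'}\frac{d^{2j}}{dt^{2j}}\Big|_{t=0}|(ty,1)|^{-\lambda_1-\rho_1}\varphi([ty:1]),$$ and for $\lambda_1+\rho_1-\nu_1-\rho_1'=-2N$, $N\in\mathbb{Z}_{\ge0}$: $$A^{(2)}_{\lambda,\nu}\varphi([y])=|y|^{\nu_1+\rho_1'}\frac{d^{2N}}{dt^{2N}}\Big|_{t=0}|(y,t)|^{-\lambda_1-\rho_1}\varphi([y:t]).$$ Here $d\omega$ is the Euclidean surface measure on the sphere. *)

(* Defs.v *)
From HB Require Import structures.
From mathcomp Require Import all_boot all_order all_algebra.
From mathcomp Require Import all_classical all_reals all_analysis.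
From mathcomp Require Import complex.

Set Implicit Arguments.
Unset Strict Implicit.
Unset Printing Implicit Defensive.

Import Order.TTheory GRing.Theory Num.Theory.
Import numFieldNormedType.Exports.

Local Notation Re := complex.Re.
Local Notation Im := complex.Im.

Local Open Scope classical_set_scope.
Local Open Scope complex_scope.
Local Open Scope ring_scope.

Set Warnings "-redundant-canonical-projection".

(* R[i] as a normed module over itself, which gives complex differentiability
   on C^2 x C^2 below. *)
HB.instance Definition _ (R : realType) := NormedModule.copy R[i] (R[i])^o.

Section ComplexCalculus.
Variable R : realType.

(* x ^ s for x > 0.  The value at x = 0 is a convention; 0 is only ever met as
   the base on null sets of integration variables. *)
Definition cpow (x : R) (s : R[i]) : R[i] :=
  (x `^ Re s)%:C * (cos (Im s * ln x) +i* sin (Im s * ln x)).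

Definition cintegral (D : set R) (f : R -> R[i]) : R[i] :=
  (\int[lebesgue_measure]_(x in D) Re (f x))
  +i* (\int[lebesgue_measure]_(x in D) Im (f x)).

Definition cderive1n (k : nat) (f : R -> R[i]) (t : R) : R[i] :=
  derive1n k (fun u => Re (f u)) t +i* derive1n k (fun u => Im (f u)) t.

(* Euler's integral, used for 0 < Re z. *)
Definition Gamma_integral (z : R[i]) : R[i] :=
  cintegral `]0, +oo[ (fun t => cpow t (z - 1) * (expR (- t))%:C).

(* The entire function 1/Gamma, from
   Gamma (z + m) = z (z + 1) ... (z + m - 1) Gamma z with 0 < Re (z + m). *)
Definition rGamma (z : R[i]) : R[i] :=
  let m := (Num.truncn `|Re z|).+1 in
  (\prod_(k < m) (z + k%:R)) / Gamma_integral (z + m%:R).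

End ComplexCalculus.

Section Projective.
Variable R : realType.

Definition enorm m (x : 'rV[R]_m) : R := Num.sqrt (\sum_i x 0 i ^+ 2).

(* The vector of R^m with i-th coordinate t and the coordinates of u, in order,
   at the other places. *)
Definition insert m (i : 'I_m) (t : R) (u : 'rV[R]_m.-1) : 'rV[R]_m :=
  \row_k (if unlift i k is Some l then u 0 l else t).

Definition snoc m (u : 'rV[R]_m) (t : R) : 'rV[R]_m.+1 :=
  @insert m.+1 ord_max t u.

(* The lines of R^m: the index is the dimension of the ambient space, so that
   RP^n is P n.+1 and RP^(n-1) is P n. *)
Definition P m : Type := {U : {vspace 'rV[R]_m} | \dim U == 1%N}.

(* f([x]), where [x] is the line through x; the value at x = 0 is a dummy. *)
Definition at_line m (f : P m -> R[i]) (x : 'rV[R]_m) : R[i] :=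
  if insub <[x]>%VS is Some p then f p else 0.

Definition smooth m (f : 'rV[R]_m -> R) : Prop :=
  forall (s : seq 'rV[R]_m) (x : 'rV[R]_m),
    differentiable (foldr (fun v g => 'D_v g) f s) x.

(* Smoothness in the affine charts u |-> [u_1 : .. : 1 : .. : u_(m-1)]. *)
Definition smoothP m (f : P m -> R[i]) : Prop :=
  forall i : 'I_m,
    smooth (fun u => Re (at_line f (insert i 1 u))) /\
    smooth (fun u => Im (at_line f (insert i 1 u))).

Record Cinfty m := MkCinfty {
  Cinfty_fun :> P m -> R[i];
  Cinfty_smooth : smoothP Cinfty_fun }.

(* Integral over S^m in R^(m+1) for the surface measure, in spherical
   coordinates about the last axis:
   w = (sin t . eta, cos t), eta in S^(m-1), dw = sin^(m-1) t dt d(eta),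
   and the counting measure on S^0 = {-1, 1}. *)
Fixpoint sphere_integral (m : nat) : ('rV[R]_m.+1 -> R[i]) -> R[i] :=
  match m with
  | 0 => fun f => f (const_mx 1) + f (const_mx (- 1))
  | k.+1 => fun f =>
      cintegral `[0, pi] (fun t =>
        (sin t ^+ k)%:C *
        sphere_integral (fun eta : 'rV[R]_k.+1 => f (snoc (sin t *: eta) (cos t))))
  end.

End Projective.

Section Operators.
Variable R : realType.

Definition C2 : Type := (R[i] * R[i])%type.

Definition rho1 (n : nat) : R[i] := n.+1%:R / 2.
Definition rho1' (n : nat) : R[i] := n%:R / 2.
Definition rho2 : R[i] := - (1 / 2).

Definition opfamily (n : nat) : Type :=
  C2 -> C2 -> Cinfty R n.+1 -> Cinfty R n.

(* The operators are given at [y] by formulas in a representative y <> 0. *)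

Definition A_integral n (lam nu : C2) (phi : Cinfty R n.+1) (y : 'rV[R]_n) : R[i] :=
  @sphere_integral R 1 (fun w =>
    let w1 := w 0 ord0 in
    let w2 := w 0 ord_max in
    cpow `|w1| (nu.1 + rho1' n - 1)
    * cpow `|w2| (lam.1 + rho1 n - nu.1 - rho1' n - 1)
    * (rGamma ((nu.1 + rho1' n) / 2)
       * rGamma ((lam.1 + rho1 n - nu.1 - rho1' n) / 2) / 2)
    * at_line phi (snoc (w1 *: ((enorm y)^-1 *: y)) w2)).

Definition B_integral n (lam nu : C2) (phi : Cinfty R n.+1) (y : 'rV[R]_n) : R[i] :=
  rGamma ((lam.1 - rho1 n + 1) / 2) / 2
  * @sphere_integral R n (fun w =>
      cpow `|w 0 ord_max| (lam.1 - rho1 n) * at_line phi w).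

Definition C_integral (lam nu : C2) (phi : Cinfty R 3) (y : 'rV[R]_2) : R[i] :=
  @sphere_integral R 2 (fun w =>
    let w1 := w 0 (@Ordinal 3 0 isT) in
    let w2 := w 0 (@Ordinal 3 1 isT) in
    let w3 := w 0 (@Ordinal 3 2 isT) in
    let y1 := y 0 (@Ordinal 2 0 isT) in
    let y2 := y 0 (@Ordinal 2 1 isT) in
    cpow `|(w2 * y1 - w1 * y2) / enorm y| (- nu.1 - rho1' 2)
    * cpow `|w3| (lam.1 + rho1 2 + nu.1 - rho1' 2 - 1)
    * (rGamma ((- nu.1 - rho1' 2 + 1) / 2)
       * rGamma ((lam.1 + rho1 2 + nu.1 - rho1' 2) / 2) / 2)
    * at_line phi w).

Definition A1_op n (j : nat) (lam nu : C2) (phi : Cinfty R n.+1) (y : 'rV[R]_n) : R[i] :=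
  cpow (enorm y) (nu.1 + rho1' n)
  * cderive1n (2 * j)%N
      (fun t => cpow (enorm (snoc (t *: y) 1)) (- lam.1 - rho1 n)
                * at_line phi (snoc (t *: y) 1)) 0.

Definition A2_op n (N : nat) (lam nu : C2) (phi : Cinfty R n.+1) (y : 'rV[R]_n) : R[i] :=
  cpow (enorm y) (nu.1 + rho1' n)
  * cderive1n (2 * N)%N
      (fun t => cpow (enorm (snoc y t)) (- lam.1 - rho1 n)
                * at_line phi (snoc y t)) 0.

(* A family of operators is the holomorphic extension of an integral formula:
   for all phi and y <> 0, T lam nu phi ([y]) is an entire function of
   (lam, nu) in C^2 x C^2 and is given by the integral on the nonempty open set
   D of parameters for which the integral converges absolutely for every phi.
   D being open in a connected space, at most one family T qualifies. *)
Definition holomorphic_extension n (D : set (C2 * C2))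
    (I : C2 -> C2 -> Cinfty R n.+1 -> 'rV[R]_n -> R[i]) (T : opfamily n) : Prop :=
  forall (phi : Cinfty R n.+1) (y : 'rV[R]_n), y != 0 ->
    (forall p : (R[i] * R[i]) * (R[i] * R[i]),
       differentiable (fun q : (R[i] * R[i]) * (R[i] * R[i]) =>
                         at_line (T q.1 q.2 phi) y) p) /\
    (forall lam nu : C2, D (lam, nu) ->
       at_line (T lam nu phi) y = I lam nu phi y).

Definition A_domain n : set (C2 * C2) :=
  [set p | let lam := p.1 in let nu := p.2 in
     0 < Re (nu.1 + rho1' n) /\ 0 < Re (lam.1 + rho1 n - nu.1 - rho1' n)].

Definition B_domain n : set (C2 * C2) :=
  [set p | 0 < Re (p.1.1 - rho1 n + 1)].

Definition C_domain : set (C2 * C2) :=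
  [set p | let lam := p.1 in let nu := p.2 in
     0 < Re (- nu.1 - rho1' 2 + 1) /\ 0 < Re (lam.1 + rho1 2 + nu.1 - rho1' 2)].

Definition is_A n (A : opfamily n) : Prop :=
  holomorphic_extension (@A_domain n) (@A_integral n) A.

Definition is_B n (B : opfamily n) : Prop :=
  holomorphic_extension (@B_domain n) (@B_integral n) B.

Definition is_C (C : opfamily 2) : Prop :=
  holomorphic_extension C_domain C_integral C.

End Operators.

(* Main.v *)
Require Import Defs.
From mathcomp Require Import all_boot all_order all_algebra.
From mathcomp Require Import all_classical all_reals all_analysis.
From mathcomp Require Import measurable_realfun.
From mathcomp Require Import complex.
From mathcomp Require Import ring lra.

Import Order.TTheory GRing.Theory Num.Theory.
Import numFieldNormedType.Exports.
Local Set Implicit Arguments.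
Local Unset Strict Implicit.
Local Notation Re := complex.Re.
Local Notation Im := complex.Im.
Local Open Scope classical_set_scope.
Local Open Scope complex_scope.
Local Open Scope ring_scope.

(* Both sides of each identity are entire functions of one complex parameter, so
   by an identity theorem for half-planes it is enough to compare them where the
   integrals converge.

   With a = nu_1 + rho_1', b = lambda_1 + rho_1 - nu_1 - rho_1' and t = |tan|
   resp. |cot| on the circle, A = (M_f(a) + M_g(b)) / (Gamma(a/2) Gamma(b/2)),
   where M_f, M_g are Mellin transforms over [0, 1] of the even parts of phi in
   the two affine charts of a projective line, weighted by (1 + t^2)^(-(a+b)/2).
   Integrations by parts continue M_f, and its residue at a = - 2j, against the
   zero of 1/Gamma(a/2), gives A^(1); exchanging the charts gives A^(2).

   For n = 2, put nu_1 = - e with e > 0.  In spherical coordinates the kernel of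
   C is |sin(al - u)|^(e-1) / Gamma(e/2), which as e -> 0 concentrates on the
   great circle over which A integrates; this gives C = sqrt(pi) A at nu_1 = 0.
   At nu_1 = - 1 the kernels of B and C agree up to Gamma(1/2). *)

(** * Complex-valued functions of a real variable *)

(** The families are known only by their values on a domain of convergence and their
    differentiability in the parameters. Each comparison is therefore made along complex lines in
    parameter space, where one-variable holomorphy is enough. The identity theorem comes from
    Cauchy's theorem on rectangles and a Gaussian factor, without power series.

    Mellin integrals are used for real part above 1, where the integrand is continuous at 0. This is
    the source of bounds like [4 < Re (lam.1 + rho1 R n)], which a second continuation in lambda_1
    removes.

    [rGamma] is a formula whose shift depends on the argument, so its holomorphy has to be proved.
    At nu_1 = 0 the integral of C is on the boundary of its domain, hence the limit e -> 0: the
    factor e in 1/Gamma(e/2) = (e/2)/Gamma(e/2 + 1) balances the mass of the kernel, which is 2/e up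
    to a bounded error. Both factors sqrt(pi) come from Gamma(1/2), in the normalization of A at a =
    1 and in that of C at nu_1 = -1. *)

Section Modulus.
Variable R : realType.
Implicit Types (z w : R[i]) (x y : R).

(** The norm of [R[i]] takes its values in [R[i]]; a real-valued modulus lets the estimates live in
    the ordered field [R]. *)
Definition cmod (z : R[i]) : R := Normc.normc z.

Lemma ReD z w : Re (z + w) = Re z + Re w. Proof. by case: z; case: w. Qed.
Lemma ImD z w : Im (z + w) = Im z + Im w. Proof. by case: z; case: w. Qed.
Lemma ReN z : Re (- z) = - Re z. Proof. by case: z. Qed.
Lemma ImN z : Im (- z) = - Im z. Proof. by case: z. Qed.
Lemma ReB z w : Re (z - w) = Re z - Re w. Proof. by rewrite ReD ReN. Qed.
Lemma ImB z w : Im (z - w) = Im z - Im w. Proof. by rewrite ImD ImN. Qed.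
Lemma ReM z w : Re (z * w) = Re z * Re w - Im z * Im w.
Proof. by case: z; case: w. Qed.
Lemma ImM z w : Im (z * w) = Re z * Im w + Im z * Re w.
Proof. by case: z => a b; case: w => c d /=; rewrite (mulrC b c). Qed.
Lemma ReC x : Re x%:C = x. Proof. by []. Qed.
Lemma ImC x : Im x%:C = 0. Proof. by []. Qed.
Lemma Re_nat n : Re (n%:R : R[i]) = n%:R.
Proof. by rewrite -(rmorph_nat (real_complex R)). Qed.
Lemma Im_nat n : Im (n%:R : R[i]) = 0.
Proof. by rewrite -(rmorph_nat (real_complex R)). Qed.
Definition ReImE := (ReD, ImD, ReN, ImN, ReM, ImM, ReC, ImC, Re_nat, Im_nat).

Lemma complex_eq z w : Re z = Re w -> Im z = Im w -> z = w.
Proof. by case: z => a b; case: w => c d /= -> ->. Qed.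

Lemma complexRI z : z = (Re z)%:C + 'i * (Im z)%:C.
Proof. exact: complexE. Qed.

Lemma Re_half z : Re (z / 2) = Re z / 2.
Proof.
have -> : (2 : R[i])^-1 = (2^-1 : R)%:C by rewrite fmorphV rmorph_nat.
by rewrite ReM ReC ImC mulr0 subr0.
Qed.

Lemma cmodE z : cmod z = Num.sqrt (Re z ^+ 2 + Im z ^+ 2).
Proof. by case: z. Qed.
Lemma normr_cmod z : `|z| = (cmod z)%:C.
Proof. by rewrite cmodE normc_def. Qed.
Lemma cmod_ge0 z : 0 <= cmod z. Proof. by rewrite cmodE sqrtr_ge0. Qed.
Lemma cmod0 : cmod 0 = 0. Proof. exact: Normc.normc0. Qed.
Lemma cmod1 : cmod 1 = 1. Proof. exact: Normc.normc1. Qed.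
Lemma cmod_eq0 z : (cmod z == 0) = (z == 0).
Proof.
apply/eqP/eqP => [/Normc.eq0_normc //|->]; exact: cmod0.
Qed.
Lemma cmod_gt0 z : (0 < cmod z) = (z != 0).
Proof. by rewrite lt_neqAle cmod_ge0 andbT eq_sym cmod_eq0. Qed.
Lemma cmodM z w : cmod (z * w) = cmod z * cmod w.
Proof. exact: Normc.normcM. Qed.
Lemma cmodV z : cmod z^-1 = (cmod z)^-1.
Proof. exact: Normc.normcV. Qed.
Lemma ler_cmodD z w : cmod (z + w) <= cmod z + cmod w.
Proof. by rewrite -lecR rmorphD /= -!normr_cmod ler_normD. Qed.
Lemma cmodN z : cmod (- z) = cmod z.
Proof. by rewrite !cmodE !ReImE !sqrrN. Qed.
Lemma cmodB z w : cmod (z - w) = cmod (w - z).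
Proof. by rewrite -cmodN opprB. Qed.
Lemma ler_cmodB z w : cmod (z - w) <= cmod z + cmod w.
Proof. by rewrite -(cmodN w) ler_cmodD. Qed.
Lemma cmodC x : cmod x%:C = `|x|.
Proof. by rewrite cmodE /= expr0n/= addr0 sqrtr_sqr. Qed.
Lemma cmod_i : cmod 'i = 1.
Proof. by rewrite cmodE /= expr0n/= add0r expr1n sqrtr1. Qed.
Lemma ler_Re_cmod z : `|Re z| <= cmod z.
Proof.
by rewrite -sqrtr_sqr cmodE ler_wsqrtr// lerDl sqr_ge0.
Qed.
Lemma ler_Im_cmod z : `|Im z| <= cmod z.
Proof.
by rewrite -sqrtr_sqr cmodE ler_wsqrtr// lerDr sqr_ge0.
Qed.
Lemma ler_cmod_ReIm z : cmod z <= `|Re z| + `|Im z|.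
Proof.
rewrite [in leLHS](complexRI z) (le_trans (ler_cmodD _ _))//.
by rewrite cmodM cmod_i mul1r !cmodC.
Qed.
Lemma Re_le_cmod z : Re z <= cmod z.
Proof. exact: le_trans (ler_norm _) (ler_Re_cmod _). Qed.

Lemma ler_cmod_dist z w : `|cmod z - cmod w| <= cmod (z - w).
Proof.
rewrite ler_norml; apply/andP; split.
  rewrite lerNl opprB lerBlDr cmodB.
  by apply: le_trans (ler_cmodD _ _); rewrite subrK.
rewrite lerBlDr.
by apply: le_trans (ler_cmodD _ _); rewrite subrK.
Qed.

(** Multiplying by a unit turns a modulus into a real part, so that bounds for real integrals apply
    to complex ones. *)
Lemma cmod_rot z : exists2 u, cmod u = 1 & u * z = (cmod z)%:C.
Proof.
have [->|z0] := eqVneq z 0.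
  by exists 1; rewrite ?cmod1// mulr0 cmod0.
exists ((cmod z)%:C / z).
  by rewrite cmodM cmodV cmodC ger0_norm ?cmod_ge0// divff// cmod_eq0.
by rewrite divfK.
Qed.

End Modulus.
Arguments cmod : simpl never.

Section ComplexValued.
Variable R : realType.
Implicit Types (f g : R -> R[i]) (x t : R) (c : R[i]).

(** Continuity and derivatives are taken on real and imaginary parts, in keeping with [cintegral]
    and [cderive1n], so that theorems on real functions apply to each part. *)
Definition ccont f x :=
  {for x, continuous (fun t => Re (f t))} /\
  {for x, continuous (fun t => Im (f t))}.

Definition cderiv f x (l : R[i]) :=
  is_derive x 1 (fun t => Re (f t)) (Re l) /\
  is_derive x 1 (fun t => Im (f t)) (Im l).

Lemma ccontP f x : ccont f x <->
  forall e : R, 0 < e -> exists2 d : R, 0 < d &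
    forall t, `|t - x| < d -> cmod (f t - f x) < e.
Proof.
split=> [[cr ci] e e0|H].
- have e2 : 0 < e / 2 by rewrite divr_gt0.
  move/cvgrPdist_lt/(_ _ e2) : cr => /nbhs_ballP[d1 /= d10 H1].
  move/cvgrPdist_lt/(_ _ e2) : ci => /nbhs_ballP[d2 /= d20 H2].
  exists (Num.min d1 d2); first by rewrite lt_min d10.
  move=> t; rewrite lt_min => /andP[t1 t2].
  rewrite (le_lt_trans (ler_cmod_ReIm _))// !ReImE.
  have h1 := H1 t; have h2 := H2 t.
  rewrite /ball /= distrC in h1; rewrite /ball /= distrC in h2.
  rewrite [ltRHS]splitr ltrD// distrC; [exact: h1|exact: h2].
- by split; apply/cvgrPdist_lt => e e0; have [d d0 h] := H _ e0;
  apply/nbhs_ballP; exists d => //= t; rewrite /ball /= distrC => /h;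
  apply: le_lt_trans; rewrite distrC -?ReB -?ImB ?ler_Re_cmod ?ler_Im_cmod.
Qed.

Lemma ccont_cst c x : ccont (fun _ => c) x.
Proof. by split; exact: cst_continuous. Qed.

Lemma ccontD f g x : ccont f x -> ccont g x -> ccont (fun t => f t + g t) x.
Proof.
move=> [f1 f2] [g1 g2]; split.
- rewrite (_ : (fun _ => _) = (fun t => Re (f t)) \+ (fun t => Re (g t))).
    exact: continuousD.
  by apply/funext => t; rewrite ReD.
- rewrite (_ : (fun _ => _) = (fun t => Im (f t)) \+ (fun t => Im (g t))).
    exact: continuousD.
  by apply/funext => t; rewrite ImD.
Qed.

Lemma ccontN f x : ccont f x -> ccont (fun t => - f t) x.
Proof.
move=> [f1 f2]; split.
- rewrite (_ : (fun _ => _) = (fun t => - Re (f t))); first exact: continuousN.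
  by apply/funext => t; rewrite ReN.
- rewrite (_ : (fun _ => _) = (fun t => - Im (f t))); first exact: continuousN.
  by apply/funext => t; rewrite ImN.
Qed.

Lemma ccontB f g x : ccont f x -> ccont g x -> ccont (fun t => f t - g t) x.
Proof. by move=> cf cg; exact: (ccontD cf (ccontN cg)). Qed.

Lemma ccontM f g x : ccont f x -> ccont g x -> ccont (fun t => f t * g t) x.
Proof.
move=> [f1 f2] [g1 g2]; split.
- rewrite (_ : (fun _ => _) =
    (fun t => Re (f t) * Re (g t) - Im (f t) * Im (g t))).
    by apply: continuousB; apply: continuousM.
  by apply/funext => t; rewrite ReM.
- rewrite (_ : (fun _ => _) =
    (fun t => Re (f t) * Im (g t) + Im (f t) * Re (g t))).
    by apply: continuousD; apply: continuousM.
  by apply/funext => t; rewrite ImM.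
Qed.

Lemma ccont_real (u : R -> R) x :
  {for x, continuous u} -> ccont (fun t => (u t)%:C) x.
Proof. by move=> cu; split => //; exact: cst_continuous. Qed.

Lemma ccont_comp f (u : R -> R) x :
  {for x, continuous u} -> ccont f (u x) -> ccont (fun t => f (u t)) x.
Proof.
move=> cu [f1 f2]; split.
- exact: (@continuous_comp _ _ _ u (fun t => Re (f t))).
- exact: (@continuous_comp _ _ _ u (fun t => Im (f t))).
Qed.

Lemma cderiv_cst c x : cderiv (fun _ => c) x 0.
Proof. by split; exact: is_derive_cst. Qed.

Lemma cderivD f g x l m : cderiv f x l -> cderiv g x m ->
  cderiv (fun t => f t + g t) x (l + m).
Proof.
move=> [f1 f2] [g1 g2]; split.
- rewrite (_ : (fun _ => _) = (fun t => Re (f t)) \+ (fun t => Re (g t))).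
    rewrite ReD; exact: is_deriveD.
  by apply/funext => t; rewrite ReD.
- rewrite (_ : (fun _ => _) = (fun t => Im (f t)) \+ (fun t => Im (g t))).
    rewrite ImD; exact: is_deriveD.
  by apply/funext => t; rewrite ImD.
Qed.

Lemma cderivM f g x l m : cderiv f x l -> cderiv g x m ->
  cderiv (fun t => f t * g t) x (l * g x + f x * m).
Proof.
move=> [f1 f2] [g1 g2]; split.
- rewrite (_ : (fun _ => _) =
    ((fun t => Re (f t)) * (fun t => Re (g t)) -
     (fun t => Im (f t)) * (fun t => Im (g t)))); last first.
    by apply/funext => t; rewrite ReM.
  have D := is_deriveB (is_deriveM f1 g1) (is_deriveM f2 g2).
  apply: is_derive_eq D _; rewrite !ReImE /GRing.scale /=; ring.
- rewrite (_ : (fun _ => _) =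
    ((fun t => Re (f t)) * (fun t => Im (g t)) +
     (fun t => Im (f t)) * (fun t => Re (g t)))); last first.
    by apply/funext => t; rewrite ImM.
  have D := is_deriveD (is_deriveM f1 g2) (is_deriveM f2 g1).
  apply: is_derive_eq D _; rewrite !ReImE /GRing.scale /=; ring.
Qed.

Lemma cderivZ c f x l : cderiv f x l -> cderiv (fun t => c * f t) x (c * l).
Proof.
move=> fl; have := cderivM (cderiv_cst c x) fl.
by rewrite mul0r add0r.
Qed.

Lemma cderiv_real (u : R -> R) x l :
  is_derive x 1 u l -> cderiv (fun t => (u t)%:C) x l%:C.
Proof. by move=> ul; split => //; exact: is_derive_cst. Qed.

Lemma cderiv_comp f (u : R -> R) x l m :
  is_derive x 1 u m -> cderiv f (u x) l ->
  cderiv (fun t => f (u t)) x (m%:C * l).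
Proof.
move=> um [f1 f2]; split; rewrite !ReImE mul0r ?subr0 ?addr0 mulrC.
- exact: (@is_derive1_comp _ (fun t => Re (f t)) u).
- exact: (@is_derive1_comp _ (fun t => Im (f t)) u).
Qed.

Lemma cderiv_cont f x l : cderiv f x l -> ccont f x.
Proof.
by move=> [f1 f2]; split; apply/differentiable_continuous/derivable1_diffP.
Qed.

End ComplexValued.

(** * Integrals of complex-valued functions of a real variable *)

Section ComplexIntegral.
Variable R : realType.
Notation mu := (@lebesgue_measure R).
Implicit Types (f g : R -> R[i]) (D : set (measurableTypeR R)) (a b c : R) (z : R[i]).

Definition cintble D f :=
  mu.-integrable D (EFin \o (fun t => Re (f t))) /\
  mu.-integrable D (EFin \o (fun t => Im (f t))).

Lemma eq_cintegral D f g : (forall t, D t -> f t = g t) ->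
  cintegral D f = cintegral D g.
Proof.
move=> fg; rewrite /cintegral; congr (_ +i* _); apply: eq_Rintegral => t /set_mem Dt;
  by rewrite fg.
Qed.

Lemma eq_intble D (u v : R -> R) : measurable D ->
  (forall t, D t -> u t = v t) ->
  mu.-integrable D (EFin \o u) -> mu.-integrable D (EFin \o v).
Proof.
move=> mD uv ui; apply: (@eq_integrable _ _ _ mu D mD _ _ _ ui) => t /set_mem Dt /=.
by rewrite uv.
Qed.

Lemma intbleD D (u v : R -> R) : measurable D ->
  mu.-integrable D (EFin \o u) -> mu.-integrable D (EFin \o v) ->
  mu.-integrable D (EFin \o (fun t => u t + v t)).
Proof. by move=> mD ui vi; have := integrableD mD ui vi. Qed.

Lemma intbleB D (u v : R -> R) : measurable D ->
  mu.-integrable D (EFin \o u) -> mu.-integrable D (EFin \o v) ->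
  mu.-integrable D (EFin \o (fun t => u t - v t)).
Proof. by move=> mD ui vi; have := integrableB mD ui vi. Qed.

Lemma intbleZ D (u : R -> R) c : measurable D ->
  mu.-integrable D (EFin \o u) -> mu.-integrable D (EFin \o (fun t => c * u t)).
Proof. by move=> mD ui; have := integrableZl mD c ui. Qed.

Lemma eq_cintble D f g : measurable D -> (forall t, D t -> f t = g t) ->
  cintble D f -> cintble D g.
Proof.
move=> mD fg [f1 f2]; split.
- by apply: eq_intble f1 => // t Dt; rewrite fg.
- by apply: eq_intble f2 => // t Dt; rewrite fg.
Qed.

Lemma cintbleD D f g : measurable D -> cintble D f -> cintble D g ->
  cintble D (fun t => f t + g t).
Proof.
move=> mD [f1 f2] [g1 g2]; split.
- by apply: eq_intble (intbleD mD f1 g1) => // t _; rewrite ReD.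
- by apply: eq_intble (intbleD mD f2 g2) => // t _; rewrite ImD.
Qed.

Lemma cintbleZ D f z : measurable D -> cintble D f ->
  cintble D (fun t => z * f t).
Proof.
move=> mD [f1 f2]; split.
- apply: eq_intble (intbleB mD (intbleZ (Re z) mD f1) (intbleZ (Im z) mD f2)) => //.
  by move=> t _; rewrite ReM.
- apply: eq_intble (intbleD mD (intbleZ (Re z) mD f2) (intbleZ (Im z) mD f1)) => //.
  by move=> t _; rewrite ImM.
Qed.

Lemma cintegralD D f g : measurable D -> cintble D f -> cintble D g ->
  cintegral D (fun t => f t + g t) = cintegral D f + cintegral D g.
Proof.
move=> mD [f1 f2] [g1 g2]; apply: complex_eq => /=.
- under eq_Rintegral do rewrite ReD; exact: RintegralD.
- under eq_Rintegral do rewrite ImD; exact: RintegralD.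
Qed.

Lemma cintegralZ D f z : measurable D -> cintble D f ->
  cintegral D (fun t => z * f t) = z * cintegral D f.
Proof.
move=> mD [f1 f2]; apply: complex_eq; rewrite ?ReM ?ImM /=.
- under eq_Rintegral do rewrite ReM.
  rewrite RintegralB ?RintegralZl//; exact: intbleZ.
- under eq_Rintegral do rewrite ImM.
  rewrite RintegralD ?RintegralZl//; exact: intbleZ.
Qed.

Lemma cintegralN D f : measurable D -> cintble D f ->
  cintegral D (fun t => - f t) = - cintegral D f.
Proof.
move=> mD fi; rewrite -mulN1r -cintegralZ//.
by apply: eq_cintegral => t _; rewrite mulN1r.
Qed.

Lemma cintbleN D f : measurable D -> cintble D f -> cintble D (fun t => - f t).
Proof.
move=> mD fi; apply: eq_cintble (cintbleZ (-1) mD fi) => // t _.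
by rewrite mulN1r.
Qed.

Lemma cintegralB D f g : measurable D -> cintble D f -> cintble D g ->
  cintegral D (fun t => f t - g t) = cintegral D f - cintegral D g.
Proof.
by move=> mD fi gi; rewrite cintegralD ?cintegralN//; exact: cintbleN.
Qed.

(** Rotating the value of the integral onto the positive axis replaces its modulus by the integral
    of a real part. Bounding the two components separately would lose a constant. *)
Lemma le_cmod_cintegral D f (u : R -> R) : measurable D -> cintble D f ->
  mu.-integrable D (EFin \o u) -> (forall t, D t -> cmod (f t) <= u t) ->
  cmod (cintegral D f) <= \int[mu]_(t in D) u t.
Proof.
move=> mD fi ui fu; have [w w1 wE] := cmod_rot (cintegral D f).
have /(congr1 (@complex.Re R)) : (cmod (cintegral D f))%:C = cintegral D (fun t => w * f t).
  by rewrite cintegralZ.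
rewrite ReC => ->; rewrite /cintegral /=.
have [wf1 _] := cintbleZ w mD fi.
apply: le_Rintegral => // t Dt; apply: le_trans (fu _ Dt).
by rewrite -[leRHS]mul1r -w1 -cmodM Re_le_cmod.
Qed.

Lemma cont_integrable (u : R -> R) a b :
  (forall x, a <= x <= b -> {for x, continuous u}) ->
  mu.-integrable `[a, b] (EFin \o u).
Proof.
move=> cu; apply: continuous_compact_integrable; first exact: segment_compact.
apply: continuous_in_subspaceT => x; rewrite inE/= in_itv/= => xab.
exact: cu.
Qed.

Lemma ccont_within f a b : (forall x, a <= x <= b -> ccont f x) ->
  {within `[a, b], continuous (fun t => Re (f t))} /\
  {within `[a, b], continuous (fun t => Im (f t))}.
Proof.
move=> cf; split; apply: continuous_in_subspaceT => x;
  rewrite inE/= in_itv/= => /cf[]//.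
Qed.

Lemma ccont_cintble f a b : (forall x, a <= x <= b -> ccont f x) ->
  cintble `[a, b] f.
Proof. by move=> cf; split; apply: cont_integrable => x /cf[]. Qed.

Definition cint a b f := cintegral `[a, b] f.

Lemma eq_cint a b f g : (forall t, a <= t <= b -> f t = g t) ->
  cint a b f = cint a b g.
Proof.
by move=> fg; apply: eq_cintegral => t /=; rewrite in_itv/=; exact: fg.
Qed.

Lemma le_cmod_cint a b f (M : R) : a <= b ->
  (forall x, a <= x <= b -> ccont f x) ->
  (forall x, a <= x <= b -> cmod (f x) <= M) ->
  cmod (cint a b f) <= M * (b - a).
Proof.
move=> ab cf fM.
apply: (@le_trans _ _ (\int[mu]_(t in `[a, b]) M)).
  apply: le_cmod_cintegral => //; first exact: ccont_cintble.
  by apply: cont_integrable => x _; exact: cst_continuous.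
rewrite Rintegral_cst//= lebesgue_measure_itv /= lte_fin.
by case: ltP => //= ba; rewrite mulr0 mulr_ge0// ?subr_ge0//;
  apply: le_trans (fM a _); rewrite ?cmod_ge0 ?lexx.
Qed.

Lemma cint_split a b c f : a <= c <= b ->
  (forall x, a <= x <= b -> ccont f x) ->
  cint a b f = cint a c f + cint c b f.
Proof.
move=> /andP[ac cb] /ccont_cintble[f1 f2].
have H (u : R -> R) : mu.-integrable `[a, b] (EFin \o u) ->
   \int[mu]_(t in `[a, b]) u t =
   \int[mu]_(t in `[a, c]) u t + \int[mu]_(t in `[c, b]) u t.
  move=> ui; rewrite -(@Rintegral_itv_obnd_cbnd _ c (BRight b)); last first.
    apply: integrableS ui => //.
    by apply: subset_itv; rewrite bnd_simp.
  rewrite -(@Rintegral_itvB _ _ (BLeft a) (BRight b) c)//.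
  by rewrite addrC subrK.
by apply: complex_eq; rewrite ?ReD ?ImD; exact: H.
Qed.

Lemma cint_pt a f : cint a a f = 0.
Proof.
by rewrite /cint set_itv1 /cintegral !Rintegral_set1.
Qed.

Lemma FTC (F f : R -> R[i]) a b : a <= b ->
  (forall x, a <= x <= b -> cderiv F x (f x)) ->
  (forall x, a <= x <= b -> ccont f x) ->
  cint a b f = F b - F a.
Proof.
rewrite le_eqVlt => /predU1P[->|ab] dF cf; first by rewrite cint_pt subrr.
have [c1 c2] := ccont_within cf.
have H (U u : R -> R) : (forall x, a <= x <= b -> is_derive x 1 U (u x)) ->
    {within `[a, b], continuous u} ->
    \int[mu]_(x in `[a, b]) u x = U b - U a.
  move=> dU cu; rewrite /Rintegral.
  rewrite (@continuous_FTC2 _ u U)//.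
  - have cU x : a <= x <= b -> {for x, continuous U}.
      move=> /dU dUx; apply/differentiable_continuous/derivable1_diffP.
      exact: (@ex_derive _ _ _ _ _ _ _ dUx).
    split.
    + move=> x; rewrite in_itv/= => /andP[/ltW ax /ltW xb].
      have dx := dU x; have {}dx := dx (introT andP (conj ax xb)).
      exact: (@ex_derive _ _ _ _ _ _ _ dx).
    + by apply: cvg_at_right_filter; apply: cU; rewrite lexx ltW.
    + by apply: cvg_at_left_filter; apply: cU; rewrite lexx ltW.
  - move=> x; rewrite in_itv/= => /andP[/ltW ax /ltW xb].
    have dx := dU x; have {}dx := dx (introT andP (conj ax xb)).
    by rewrite derive1E; exact: (@derive_val _ _ _ _ _ _ _ dx).
apply: complex_eq; rewrite ?ReB ?ImB.
- by apply: (H (fun t => Re (F t)) (fun t => Re (f t))) => // x /dF[].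
- by apply: (H (fun t => Im (F t)) (fun t => Im (f t))) => // x /dF[].
Qed.

Lemma cint_subst_incr (F dF : R -> R) (G : R -> R[i]) a b : a <= b ->
  (forall x y, a <= x -> x < y -> y <= b -> F x < F y) ->
  (forall x : R, is_derive x 1 F (dF x)) -> continuous dF ->
  (forall x, F a <= x <= F b -> ccont G x) ->
  cint (F a) (F b) G = cint a b (fun x => (dF x)%:C * G (F x)).
Proof.
move=> ab Fi dFx cdF cG.
have F'E : F^`()%classic = dF.
  by apply/funext => x; rewrite derive1E (@derive_val _ _ _ _ _ _ _ (dFx x)).
have cF x : {for x, continuous F}.
  apply/differentiable_continuous/derivable1_diffP.
  exact: (@ex_derive _ _ _ _ _ _ _ (dFx x)).
have H (u : R -> R) : {within `[F a, F b], continuous u} ->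
   \int[mu]_(x in `[F a, F b]) u x = \int[mu]_(x in `[a, b]) (u (F x) * dF x).
  move=> cu; rewrite /Rintegral (@integration_by_substitution_increasing _ F u a b)//.
  - by rewrite F'E.
  - by move=> x y; rewrite !in_itv/= => /andP[ax _] /andP[_ yb] xy; exact: Fi.
  - by rewrite F'E => x _; exact: cdF.
  - by rewrite F'E; apply/cvg_ex; exists (dF a); apply: cvg_at_right_filter; exact: cdF.
  - by rewrite F'E; apply/cvg_ex; exists (dF b); apply: cvg_at_left_filter; exact: cdF.
  - split.
    + by move=> x _; exact: (@ex_derive _ _ _ _ _ _ _ (dFx x)).
    + by apply: cvg_at_right_filter; exact: cF.
    + by apply: cvg_at_left_filter; exact: cF.
have [cG1 cG2] := ccont_within cG.
apply: complex_eq; rewrite /cint /cintegral /=.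
- rewrite H//.
  by apply: eq_Rintegral => x _; rewrite ReM ReC ImC mul0r subr0 mulrC.
- rewrite H//.
  by apply: eq_Rintegral => x _; rewrite ImM ReC ImC mul0r addr0 mulrC.
Qed.

Lemma cint_shift (G : R -> R[i]) a b c : a <= b -> (forall x, ccont G x) ->
  cint (a + c) (b + c) G = cint a b (fun x => G (x + c)).
Proof.
move=> ab cG.
apply: etrans (@cint_subst_incr (fun x => x + c) (fun=> 1) G a b ab _ _ _ _) _.
- by move=> x y _ xy _; rewrite ltrD2r.
- move=> x; have D := is_deriveD (is_derive_id x (1:R)) (is_derive_cst c x 1).
  exact: (is_derive_eq D (addr0 _)).
- by move=> x; exact: cst_continuous.
- by move=> x _; exact: cG.
- by apply: eq_cint => t _; rewrite rmorph1 mul1r.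
Qed.

Lemma cint_opp (G : R -> R[i]) a b : a <= b -> (forall x, ccont G x) ->
  cint (- b) (- a) G = cint a b (fun x => G (- x)).
Proof.
move=> ab cG; apply: complex_eq; rewrite /cint /cintegral /= /Rintegral.
- rewrite integration_by_substitution_oppr//.
  by apply: continuous_subspaceT => x; have [] := cG x.
- rewrite integration_by_substitution_oppr//.
  by apply: continuous_subspaceT => x; have [] := cG x.
Qed.

Lemma cint_reflect (G : R -> R[i]) a b c : a <= b -> (forall x, ccont G x) ->
  cint (c - b) (c - a) G = cint a b (fun x => G (c - x)).
Proof.
move=> ab cG; rewrite ![c - _]addrC cint_shift ?lerN2//.
rewrite cint_opp//.
- by apply: eq_cint => t _; rewrite addrC.
- move=> x; apply: ccont_comp => //.
  apply: (@continuousD _ _ _ (fun t => t) (fun=> c)); [exact: cvg_id|exact: cst_continuous].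
Qed.

End ComplexIntegral.
Arguments cint : simpl never.

(** * The complex exponential and complex powers of positive reals *)

Section ComplexExponential.
Variable R : realType.
Implicit Types (x y t : R) (z w s : R[i]).

Definition expC z : R[i] := (expR (Re z))%:C * (cos (Im z) +i* sin (Im z)).

Lemma Re_expC z : Re (expC z) = expR (Re z) * cos (Im z).
Proof. by rewrite /expC ReM ReC ImC mul0r subr0. Qed.
Lemma Im_expC z : Im (expC z) = expR (Re z) * sin (Im z).
Proof. by rewrite /expC ImM ReC ImC mul0r addr0. Qed.

Lemma expCD z w : expC (z + w) = expC z * expC w.
Proof.
apply: complex_eq.
- by rewrite Re_expC [RHS]ReM !Re_expC !Im_expC ReD ImD expRD cosD; ring.
- by rewrite Im_expC [RHS]ImM !Re_expC !Im_expC ReD ImD expRD sinD; ring.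
Qed.

Lemma expC0 : expC 0 = 1.
Proof. by apply: complex_eq; rewrite ?Re_expC ?Im_expC /= expR0 ?cos0 ?sin0; ring. Qed.

Lemma cmod_expC z : cmod (expC z) = expR (Re z).
Proof.
rewrite /expC cmodM cmodC ger0_norm ?expR_ge0// [X in _ * X]cmodE /=.
by rewrite cos2Dsin2 sqrtr1 mulr1.
Qed.

Lemma cderiv_expC (g : R -> R[i]) x l : cderiv g x l ->
  cderiv (fun t => expC (g t)) x (l * expC (g x)).
Proof.
move=> [g1 g2].
have e1 := @is_derive1_comp _ (@expR R) (fun t => Re (g t)) _ _ _ (is_derive_expR _) g1.
have c1 := @is_derive1_comp _ (@cos R) (fun t => Im (g t)) _ _ _ (is_derive_cos _) g2.
have s1 := @is_derive1_comp _ (@sin R) (fun t => Im (g t)) _ _ _ (is_derive_sin _) g2.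
split.
- rewrite (_ : (fun _ => _) = (expR \o (fun t => Re (g t))) * (cos \o (fun t => Im (g t)))).
    apply: (is_derive_eq (is_deriveM e1 c1)).
    by rewrite ReM Re_expC Im_expC /GRing.scale /=; ring.
  by apply/funext => t; rewrite Re_expC.
- rewrite (_ : (fun _ => _) = (expR \o (fun t => Re (g t))) * (sin \o (fun t => Im (g t)))).
    apply: (is_derive_eq (is_deriveM e1 s1)).
    by rewrite ImM Re_expC Im_expC /GRing.scale /=; ring.
  by apply/funext => t; rewrite Im_expC.
Qed.

Lemma expR_sub1_ge x : expR x - 1 <= x * expR x.
Proof.
have h := expR_ge1Dx (- x).
have : (1 + - x) * expR x <= expR (- x) * expR x by rewrite ler_wpM2r// expR_ge0.
rewrite -expRD addNr expR0; lra.
Qed.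

Lemma expR_taylor1 x : `|expR x - 1 - x| <= x ^+ 2 * expR `|x|.
Proof.
have h1 := expR_ge1Dx x; have h2 := expR_sub1_ge x.
rewrite ger0_norm; last lra.
apply: (@le_trans _ _ (x * (expR x - 1))); first lra.
have [x0|x0] := leP 0 x.
- rewrite ger0_norm// expr2 -mulrA ler_wpM2l//; lra.
- rewrite ltr0_norm//.
  have : 1 <= expR (- x) by rewrite -expR0 ler_expR; lra.
  have := sqr_ge0 x; rewrite expr2 => xx h.
  have : x * (expR x - 1) <= x * x by nra.
  move=> /le_trans; apply; nra.
Qed.

Lemma derive_bound (f df : R -> R) (M y : R) :
  (forall t : R, is_derive t 1 f (df t)) ->
  (forall t, `|t| <= `|y| -> `|df t| <= M) ->
  `|f y - f 0| <= M * `|y|.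
Proof.
move=> fd dM.
have cf t : {for t, continuous f}.
  apply/differentiable_continuous/derivable1_diffP.
  exact: (@ex_derive _ _ _ _ _ _ _ (fd t)).
have [y0|y0] := leP 0 y.
- have [|c cI ->] := @MVT_segment _ f df 0 y y0 (fun t _ => fd t).
    exact: continuous_subspaceT.
  rewrite subr0 normrM ler_wpM2r// dM//.
  by move: cI; rewrite in_itv/= => /andP[c0 cy]; rewrite !ger0_norm.
- have [|c cI] := @MVT_segment _ f df y 0 (ltW y0) (fun t _ => fd t).
    exact: continuous_subspaceT.
  rewrite distrC => ->.
  rewrite sub0r normrM normrN ler_wpM2r// dM//.
  move: cI; rewrite in_itv/= => /andP[c0 cy].
  by rewrite !ler0_norm ?lerN2// ltW.
Qed.

Lemma ler_sin_norm y : `|sin y| <= `|y|.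
Proof.
have := @derive_bound sin cos 1 y (fun t => is_derive_sin t).
by rewrite sin0 subr0 mul1r; apply => t _; exact: cos_max.
Qed.

Lemma ler_cos1_norm y : `|cos y - 1| <= `|y|.
Proof.
have := @derive_bound cos (fun t => - sin t) 1 y (fun t => is_derive_cos t).
by rewrite cos0 mul1r; apply => t _; rewrite normrN sin_max.
Qed.

Lemma sin_taylor1 y : `|sin y - y| <= y ^+ 2.
Proof.
rewrite -[y ^+ 2]real_normK ?num_real// expr2.
have D (t : R) : is_derive t 1 (@sin R - id) (cos t - 1).
  exact: is_deriveB (is_derive_sin t) (is_derive_id t 1).
have := @derive_bound _ _ `|y| y D.
rewrite !fctE sin0 !subr0; apply.
by move=> t ty; apply: le_trans ty; exact: ler_cos1_norm.
Qed.

Lemma cos_taylor1 y : `|cos y - 1| <= y ^+ 2.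
Proof.
rewrite -[y ^+ 2]real_normK ?num_real// expr2.
have := @derive_bound cos (fun t => - sin t) `|y| y (fun t => is_derive_cos t).
rewrite cos0; apply => t ty; rewrite normrN.
by apply: le_trans ty; exact: ler_sin_norm.
Qed.

(** A global second-order remainder. It yields the derivative of [expC] and, with z = h ln t,
    differentiation of t^a in the exponent under the integral sign. *)
Lemma expC_taylor1 z :
  cmod (expC z - 1 - z) <= 5 * cmod z ^+ 2 * expR (cmod z).
Proof.
set x := Re z; set y := Im z; set m := cmod z.
have xm : `|x| <= m := ler_Re_cmod z.
have ym : `|y| <= m := ler_Im_cmod z.
have m0 : 0 <= m := cmod_ge0 z.
have E1 : 1 <= expR m by rewrite -expR0 ler_expR.
have x2 : x ^+ 2 <= m ^+ 2 by rewrite -[leLHS]real_normK ?num_real// lerXn2r// nnegrE.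
have y2 : y ^+ 2 <= m ^+ 2 by rewrite -[leLHS]real_normK ?num_real// lerXn2r// nnegrE.
have ex : `|expR x - 1 - x| <= m ^+ 2 * expR m.
  apply: le_trans (expR_taylor1 x) _.
  by rewrite ler_pM ?sqr_ge0 ?expR_ge0// ler_expR.
have ly := ler_cos1_norm y; have lsy := ler_sin_norm y.
have cx := cos_taylor1 y; have sx := sin_taylor1 y.
have xy1 : `|x * (cos y - 1)| <= m ^+ 2.
  by rewrite normrM expr2 ler_pM// (le_trans ly).
have xy2 : `|x * sin y| <= m ^+ 2.
  by rewrite normrM expr2 ler_pM// (le_trans lsy).
have mE : m ^+ 2 <= m ^+ 2 * expR m by rewrite ler_peMr// sqr_ge0.
have A1 : `|(expR x - 1 - x) * cos y| <= m ^+ 2 * expR m.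
  rewrite normrM -[leRHS]mulr1 ler_pM// cos_max//.
have A2 : `|(expR x - 1 - x) * sin y| <= m ^+ 2 * expR m.
  rewrite normrM -[leRHS]mulr1 ler_pM// sin_max//.
(* With z = x + iy the remainder is (e^x - 1 - x) e^{iy} + (e^{iy} - 1 - iy) + x (e^{iy} - 1). The
   pieces cost 1, 2 and 2 times |z|^2 e^{|z|}, whence the 5. *)
pose u : R[i] := (expR x - 1 - x)%:C * expC (y *i).
pose v : R[i] := (cos y - 1) +i* (sin y - y).
pose w : R[i] := (x * (cos y - 1)) +i* (x * sin y).
have -> : expC z - 1 - z = u + v + w.
  have Ru : Re u = (expR x - 1 - x) * cos y.
    by rewrite /u ReM ReC ImC Re_expC /= expR0; ring.
  have Iu : Im u = (expR x - 1 - x) * sin y.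
    by rewrite /u ImM ReC ImC Im_expC /= expR0; ring.
  apply: complex_eq.
  - rewrite [RHS]ReD [X in _ = X + _]ReD Ru 2!ReB Re_expC /= -/x -/y; ring.
  - rewrite [RHS]ImD [X in _ = X + _]ImD Iu 2!ImB Im_expC /= -/x -/y; ring.
have hu : cmod u <= m ^+ 2 * expR m.
  by rewrite cmodM cmodC cmod_expC /= expR0 mulr1.
have hv : cmod v <= m ^+ 2 * expR m *+ 2.
  apply: le_trans (ler_cmod_ReIm _) _ => /=; rewrite mulr2n.
  by apply: lerD; apply: le_trans mE; [apply: le_trans cx _|apply: le_trans sx _].
have hw : cmod w <= m ^+ 2 * expR m *+ 2.
  apply: le_trans (ler_cmod_ReIm _) _ => /=; rewrite mulr2n.
  by apply: lerD; apply: le_trans mE.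
have -> : 5 * m ^+ 2 * expR m = m ^+ 2 * expR m + m ^+ 2 * expR m *+ 2 + m ^+ 2 * expR m *+ 2.
  by rewrite !mulr2n; ring.
apply: le_trans (ler_cmodD _ _) _; apply: lerD => //.
by apply: le_trans (ler_cmodD _ _) _; apply: lerD.
Qed.

Lemma cpowE x s : 0 < x -> cpow x s = expC (s * (ln x)%:C).
Proof.
move=> x0; rewrite /cpow /expC /powR gt_eqF// !ReM !ImM !ReC !ImC.
by rewrite !mulr0 subr0 add0r.
Qed.

Lemma cmod_cpow x s : cmod (cpow x s) = x `^ Re s.
Proof.
rewrite /cpow cmodM cmodC ger0_norm ?powR_ge0// [X in _ * X]cmodE /=.
by rewrite cos2Dsin2 sqrtr1 mulr1.
Qed.

Lemma cpow0r s : Re s != 0 -> cpow 0 s = 0.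
Proof. by move=> s0; rewrite /cpow powR0// mul0r. Qed.

Lemma cpowr0 x : cpow x 0 = 1.
Proof. by rewrite /cpow powRr0 /= mul0r cos0 sin0 mul1r. Qed.

Lemma cpow1l s : cpow 1 s = 1.
Proof. by rewrite cpowE// ln1 mulr0 expC0. Qed.

Lemma cpowD x s w : 0 < x -> cpow x (s + w) = cpow x s * cpow x w.
Proof. by move=> x0; rewrite !cpowE// mulrDl expCD. Qed.

Lemma cpow_neq0 x s : 0 < x -> cpow x s != 0.
Proof. by move=> x0; rewrite -cmod_gt0 cmod_cpow powR_gt0. Qed.

Lemma cpowN x s : 0 < x -> cpow x (- s) = (cpow x s)^-1.
Proof.
move=> x0; apply: (mulfI (cpow_neq0 s x0)).
by rewrite -cpowD// subrr cpowr0 divff// cpow_neq0.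
Qed.

Lemma cpowMl x y s : 0 < x -> 0 < y -> cpow (x * y) s = cpow x s * cpow y s.
Proof.
move=> x0 y0; rewrite !cpowE ?mulr_gt0// lnM ?posrE// rmorphD mulrDr.
exact: expCD.
Qed.

Lemma cpowVl x s : 0 < x -> cpow x^-1 s = cpow x (- s).
Proof.
by move=> x0; rewrite !cpowE ?invr_gt0// lnV ?posrE// rmorphN/= mulrN mulNr.
Qed.

Lemma cpow_real x (r : R) : cpow x r%:C = (x `^ r)%:C.
Proof.
by rewrite /cpow ReC ImC mul0r cos0 sin0 mulr1.
Qed.

Lemma cpow_nat x n : 0 <= x -> cpow x n%:R = (x ^+ n)%:C.
Proof.
by move=> x0; rewrite -(rmorph_nat (real_complex R)) cpow_real powR_mulrn.
Qed.

Lemma cpowr1 x : 0 <= x -> cpow x 1 = x%:C.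
Proof. by move=> x0; rewrite -(rmorph1 (real_complex R)) cpow_real powRr1. Qed.

Lemma cpow_sqrt x s : 0 < x -> cpow (Num.sqrt x) s = cpow x (s / 2).
Proof.
move=> x0; rewrite -powR12_sqrt ?(ltW x0)// !cpowE ?powR_gt0// ln_powR.
congr expC; rewrite rmorphM /= mulrA; congr (_ * _ * _).
by rewrite fmorphV rmorph_nat.
Qed.

Lemma cderiv_cpow x s : 0 < x -> cderiv (fun t : R => cpow t s) x (s * cpow x (s - 1)).
Proof.
move=> x0.
have H : cderiv (fun t => expC (s * (ln t)%:C)) x (s * cpow x (s - 1)).
  rewrite cpowD// cpowN// cpowr1 ?ltW// cpowE//.
  have := cderiv_expC (cderivZ s (cderiv_real (@is_derive1_ln R x x0))).
  by rewrite fmorphV /= -mulrA [_ * expC _]mulrC.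
have N : \forall t \near x, 0 < t by exact: lt_nbhsr.
case: H => [h1 h2]; split.
- apply: near_eq_is_derive h1.
  by near=> t; rewrite cpowE//; near: t.
- apply: near_eq_is_derive h2.
  by near=> t; rewrite cpowE//; near: t.
Unshelve. all: by end_near.
Qed.

Lemma ccont_cpow x s : 0 < x -> ccont (fun t : R => cpow t s) x.
Proof. by move=> x0; apply: cderiv_cont; exact: cderiv_cpow. Qed.

Lemma powR_small (r e : R) : 0 < r -> 0 < e -> exists2 d : R, 0 < d &
  forall x, 0 <= x < d -> x `^ r < e.
Proof.
move=> r0 e0; exists (e `^ r^-1); first exact: powR_gt0.
move=> x /andP[x0 xd].
have := gt0_ltr_powR r0 _ _ xd; rewrite !nnegrE x0 powR_ge0 => /(_ isT isT).
by rewrite -powRrM mulVf ?gt_eqF// powRr1// ltW.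
Qed.

(** The conventional value 0 at t = 0 is also the limit, as Re s > 0. With the absolute value the
    power is continuous on the whole line, so integrands need no one-sided arguments. *)
Lemma ccont_cpow_norm x s : 0 < Re s -> ccont (fun t => cpow `|t| s) x.
Proof.
move=> s0; have [->|x0] := eqVneq x 0; last first.
  apply: (@ccont_comp _ (fun t => cpow t s) (fun t => `|t|)).
    exact: (@norm_continuous R R).
  by apply: ccont_cpow; rewrite normr_gt0.
apply/ccontP => e e0; have [d d0 h] := powR_small s0 e0.
exists d => // t; rewrite subr0 => td.
rewrite normr0 cpow0r ?gt_eqF// subr0 cmod_cpow; apply: h.
by rewrite normr_ge0.
Qed.

End ComplexExponential.
Arguments expC : simpl never.

(** * Holomorphic functions *)

Section Holomorphic.
Variable R : realType.
Implicit Types (f g : R[i] -> R[i]) (z w d : R[i]) (x y : R).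

(** Complex differentiability with real radii and [cmod], since the balls of [R[i]] have radii in
    [R[i]]. *)
Definition holo f z d := forall e : R, 0 < e -> exists2 r : R, 0 < r &
  forall w, cmod (w - z) < r ->
    cmod (f w - f z - d * (w - z)) <= e * cmod (w - z).

Definition holoat f z := exists d, holo f z d.

Lemma holo_lip f z d : holo f z d -> exists2 r : R, 0 < r &
  forall w, cmod (w - z) < r -> cmod (f w - f z) <= (1 + cmod d) * cmod (w - z).
Proof.
move=> /(_ 1 ltr01)[r r0 h]; exists r => // w /h hw.
rewrite (_ : f w - f z = (f w - f z - d * (w - z)) + d * (w - z)); last by ring.
by apply: le_trans (ler_cmodD _ _) _; rewrite mulrDl cmodM lerD.
Qed.

Lemma holo_cont f z : holoat f z -> forall e : R, 0 < e ->
  exists2 r : R, 0 < r & forall w, cmod (w - z) < r -> cmod (f w - f z) < e.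
Proof.
move=> [d /holo_lip[r r0 h]] e e0.
have K0 : 0 < 1 + cmod d by rewrite ltr_wpDr// cmod_ge0.
exists (Num.min r (e / (1 + cmod d))); first by rewrite lt_min r0 divr_gt0.
move=> w; rewrite lt_min => /andP[/h h1 h2].
by apply: le_lt_trans h1 _; rewrite mulrC -ltr_pdivlMr.
Qed.

Lemma holo_near f g z (r : R) : 0 < r ->
  (forall w, cmod (w - z) < r -> f w = g w) -> holoat f z -> holoat g z.
Proof.
move=> r0 fg [d fd]; exists d => e /fd[r' r'0 h].
exists (Num.min r r'); first by rewrite lt_min r0.
move=> w; rewrite lt_min => /andP[w1 w2].
by rewrite -!fg ?h// subrr cmod0.
Qed.

Lemma eq_holo f g z : f =1 g -> holoat f z -> holoat g z.
Proof. by move=> fg; apply: (@holo_near _ _ _ 1). Qed.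

Lemma holo_cst c z : holoat (fun=> c) z.
Proof.
exists 0 => e e0; exists 1 => // w _.
by rewrite subrr mul0r subr0 cmod0 mulr_ge0 ?cmod_ge0// ltW.
Qed.

Lemma holo_id z : holoat id z.
Proof.
exists 1 => e e0; exists 1 => // w _.
by rewrite mul1r subrr cmod0 mulr_ge0 ?cmod_ge0// ltW.
Qed.

Lemma holoD f g z : holoat f z -> holoat g z -> holoat (fun w => f w + g w) z.
Proof.
move=> [d1 h1] [d2 h2]; exists (d1 + d2) => e e0.
have e2 : 0 < e / 2 by rewrite divr_gt0.
have [r1 r10 {}h1] := h1 _ e2; have [r2 r20 {}h2] := h2 _ e2.
exists (Num.min r1 r2); first by rewrite lt_min r10.
move=> w; rewrite lt_min => /andP[/h1 w1 /h2 w2].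
rewrite (_ : _ - _ = (f w - f z - d1 * (w - z)) + (g w - g z - d2 * (w - z))); last by ring.
by apply: le_trans (ler_cmodD _ _) _; rewrite (splitr e) mulrDl lerD.
Qed.

Lemma holoM f g z : holoat f z -> holoat g z -> holoat (fun w => f w * g w) z.
Proof.
move=> [d1 h1] [d2 h2]; exists (d1 * g z + f z * d2) => e e0.
(* One constant above |f(z)|, |d1| and, near z, |g(w)|; each of the three error terms below then
   costs at most e/4. *)
pose K := 1 + cmod (g z) + cmod (f z) + cmod d1.
have K0 : 0 < K by rewrite /K; have := cmod_ge0 (g z); have := cmod_ge0 (f z);
  have := cmod_ge0 d1; lra.
have eK : 0 < e / (4 * K) by rewrite divr_gt0// mulr_gt0.
have [r1 r10 {}h1] := h1 _ eK.
have [r3 r30 h3] := holo_cont (ex_intro _ d2 h2) eK.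
have [r4 r40 h4] := holo_cont (ex_intro _ d2 h2) (ltr01).
have [r2 r20 {}h2] := h2 _ eK.
exists (Num.min (Num.min r1 r2) (Num.min r3 r4)).
  by rewrite !lt_min r10 r20 r30 r40.
move=> w; rewrite !lt_min => /andP[/andP[/h1 w1 /h2 w2] /andP[/h3 w3 /h4 w4]].
rewrite (_ : _ - _ = (f w - f z - d1 * (w - z)) * g w
   + d1 * (w - z) * (g w - g z) + f z * (g w - g z - d2 * (w - z))); last by ring.
set q := cmod (w - z) in w1 w2 *.
have q0 : 0 <= q := cmod_ge0 _.
have gw : cmod (g w) <= K.
  rewrite -[g w](subrK (g z)); apply: le_trans (ler_cmodD _ _) _.
  rewrite /K; have := cmod_ge0 (f z); have := cmod_ge0 d1.
  have := w4; lra.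
have A1 : cmod ((f w - f z - d1 * (w - z)) * g w) <= e / 4 * q.
  rewrite cmodM; apply: le_trans (ler_pM (cmod_ge0 _) (cmod_ge0 _) w1 gw) _.
  rewrite le_eqVlt; apply/orP; left; apply/eqP; field; exact: lt0r_neq0.
have A2 : cmod (d1 * (w - z) * (g w - g z)) <= e / 4 * q.
  rewrite 2!cmodM -/q mulrAC; apply: ler_wpM2r => //.
  apply: (@le_trans _ _ (K * (e / (4 * K)))).
    apply: ler_pM (cmod_ge0 _) (cmod_ge0 _) _ (ltW w3).
    rewrite /K; have := cmod_ge0 (f z); have := cmod_ge0 (g z); lra.
  rewrite le_eqVlt; apply/orP; left; apply/eqP; field; exact: lt0r_neq0.
have A3 : cmod (f z * (g w - g z - d2 * (w - z))) <= e / 4 * q.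
  rewrite cmodM; apply: (@le_trans _ _ (K * (e / (4 * K) * q))).
    apply: ler_pM (cmod_ge0 _) (cmod_ge0 _) _ w2.
    rewrite /K; have := cmod_ge0 d1; have := cmod_ge0 (g z); lra.
  rewrite le_eqVlt; apply/orP; left; apply/eqP; field; exact: lt0r_neq0.
have := ler_cmodD ((f w - f z - d1 * (w - z)) * g w + d1 * (w - z) * (g w - g z))
   (f z * (g w - g z - d2 * (w - z))).
have := ler_cmodD ((f w - f z - d1 * (w - z)) * g w) (d1 * (w - z) * (g w - g z)).
have eq0 : 0 <= e / 4 * q by rewrite mulr_ge0// divr_ge0// ltW.
rewrite (_ : e * q = e / 4 * q * 4); last by field.
lra.
Qed.

Lemma holoZ c f z : holoat f z -> holoat (fun w => c * f w) z.
Proof. by apply: holoM; exact: holo_cst. Qed.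

Lemma holoN f z : holoat f z -> holoat (fun w => - f w) z.
Proof.
by move=> /(@holoZ (-1)); apply: eq_holo => w; rewrite mulN1r.
Qed.

Lemma holoB f g z : holoat f z -> holoat g z -> holoat (fun w => f w - g w) z.
Proof. by move=> hf hg; apply: holoD => //; exact: holoN. Qed.

Lemma holo_prod (I : Type) (s : seq I) (F : I -> R[i] -> R[i]) z :
  (forall i, holoat (F i) z) -> holoat (fun w => \prod_(i <- s) F i w) z.
Proof.
move=> h; elim: s => [|i s IH].
  by apply: eq_holo (holo_cst 1 z) => w; rewrite big_nil.
by apply: eq_holo (holoM (h i) IH) => w; rewrite big_cons.
Qed.

Lemma holo_affine f a b z : holoat f (a * z + b) ->
  holoat (fun w => f (a * w + b)) z.
Proof.
have [->|a0] := eqVneq a 0.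
  move=> _; apply: eq_holo (holo_cst (f b) z) => w.
  by rewrite mul0r add0r.
move=> [d h]; exists (d * a) => e e0.
have ca : 0 < cmod a by rewrite cmod_gt0.
have [r r0 {}h] := h _ (divr_gt0 e0 ca).
exists (r / cmod a); first exact: divr_gt0.
move=> w wr; have E : a * w + b - (a * z + b) = a * (w - z) by ring.
have := h (a * w + b); rewrite E cmodM => /(_ _).
rewrite [cmod a * _]mulrC -ltr_pdivlMr// => /(_ wr).
by rewrite mulrA; congr (_ <= _); field; exact: lt0r_neq0.
Qed.

Lemma holo_shift f b z : holoat f (z + b) -> holoat (fun w => f (w + b)) z.
Proof.
have := @holo_affine f 1 b z; rewrite mul1r => h /h.
by apply: eq_holo => w; rewrite mul1r.
Qed.

Lemma holo_exp z : holoat (@expC R) z.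
Proof.
exists (expC z) => e e0.
pose K := 5 * expR 1 * expR (Re z).
have K0 : 0 < K by rewrite !mulr_gt0 ?expR_gt0.
exists (Num.min 1 (e / K)); first by rewrite lt_min ltr01 divr_gt0.
move=> w; rewrite lt_min => /andP[w1 we].
set h := w - z in w1 we *.
have -> : expC w - expC z - expC z * h = expC z * (expC h - 1 - h).
  by rewrite (_ : w = z + h) ?expCD; [ring | rewrite /h; ring].
rewrite cmodM cmod_expC.
apply: (@le_trans _ _ (K * cmod h * cmod h)).
  have -> : K * cmod h * cmod h = expR (Re z) * (5 * cmod h ^+ 2 * expR 1).
    by rewrite /K; ring.
  rewrite ler_wpM2l ?expR_ge0//; apply: le_trans (expC_taylor1 h) _.
  by apply: ler_wpM2l; [rewrite mulr_ge0// sqr_ge0|rewrite ler_expR ltW].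
rewrite ler_wpM2r ?cmod_ge0// mulrC -ler_pdivlMr//; exact: ltW.
Qed.

Lemma holo_comp f g z : holoat g (f z) -> holoat f z -> holoat (fun w => g (f w)) z.
Proof.
move=> [d2 h2] [d1 h1]; exists (d2 * d1) => e e0.
have [r1 r10 hl] := holo_lip h1.
pose K := 1 + cmod d1; have K0 : 0 < K by rewrite ltr_wpDr// cmod_ge0.
pose K2 := 1 + cmod d2; have K20 : 0 < K2 by rewrite ltr_wpDr// cmod_ge0.
have [r2 r20 {}h2] := h2 _ (divr_gt0 (divr_gt0 e0 (ltr0n R 2)) K0).
have [r3 r30 {}h1] := h1 _ (divr_gt0 (divr_gt0 e0 (ltr0n R 2)) K20).
exists (Num.min (Num.min r1 r3) (r2 / K)).
  by rewrite !lt_min r10 r30 divr_gt0.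
move=> w; rewrite !lt_min => /andP[/andP[/hl w1 /h1 w3]]; rewrite ltr_pdivlMr// => w2.
set q := cmod (w - z) in w1 w2 w3 *.
have fw : cmod (f w - f z) < r2 by apply: le_lt_trans w1 _; rewrite mulrC.
have {}h2 := h2 _ fw.
rewrite (_ : _ - _ = (g (f w) - g (f z) - d2 * (f w - f z)) + d2 * (f w - f z - d1 * (w - z))); last by ring.
apply: le_trans (ler_cmodD _ _) _.
have A : cmod (g (f w) - g (f z) - d2 * (f w - f z)) <= e / 2 * q.
  apply: le_trans h2 _; rewrite -[leRHS](_ : e / 2 / K * (K * q) = _).
    by rewrite ler_wpM2l// ltW// !divr_gt0.
  by field; exact: lt0r_neq0.
have B : cmod (d2 * (f w - f z - d1 * (w - z))) <= e / 2 * q.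
  rewrite cmodM; apply: (@le_trans _ _ (K2 * (e / 2 / K2 * q))).
    by apply: ler_pM; rewrite ?cmod_ge0// /K2 lerDr.
  by rewrite le_eqVlt; apply/orP; left; apply/eqP; field; exact: lt0r_neq0.
have : e * q = e / 2 * q + e / 2 * q by field.
lra.
Qed.

Lemma ccont_hline f x y : holoat f (x +i* y) -> ccont (fun t => f (t +i* y)) x.
Proof.
move=> /holo_cont hc; apply/ccontP => e /hc[r r0 h]; exists r => // t tx.
apply: h; rewrite (_ : _ - _ = (t - x)%:C) ?cmodC//.
by apply: complex_eq; rewrite !ReImE //= subrr.
Qed.

Lemma ccont_vline f x y : holoat f (x +i* y) -> ccont (fun t => f (x +i* t)) y.
Proof.
move=> /holo_cont hc; apply/ccontP => e /hc[r r0 h]; exists r => // t tx.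
apply: h; rewrite (_ : _ - _ = 'i * (t - y)%:C) ?cmodM ?cmod_i ?mul1r ?cmodC//.
by apply: complex_eq; [rewrite ReB ReM|rewrite ImB ImM] => /=; ring.
Qed.

End Holomorphic.

(** * Cauchy's theorem for rectangles *)

Section Goursat.
Variable R : realType.
Implicit Types (f g : R[i] -> R[i]) (z w d : R[i]) (x y : R).

(** The integral of f(z) dz around the boundary, counterclockwise; dz = i dt on the vertical
    sides. *)
Definition rect f x1 x2 y1 y2 : R[i] :=
  cint x1 x2 (fun t => f (t +i* y1)) - cint x1 x2 (fun t => f (t +i* y2))
  + 'i * cint y1 y2 (fun t => f (x2 +i* t))
  - 'i * cint y1 y2 (fun t => f (x1 +i* t)).

Arguments rect : simpl never.

Definition holo_on f x1 x2 y1 y2 :=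
  forall x y, x1 <= x <= x2 -> y1 <= y <= y2 -> holoat f (x +i* y).

Lemma rect_split f x1 x2 y1 y2 x y : x1 <= x <= x2 -> y1 <= y <= y2 ->
  holo_on f x1 x2 y1 y2 ->
  rect f x1 x2 y1 y2 = rect f x1 x y1 y + rect f x x2 y1 y +
                       rect f x1 x y y2 + rect f x x2 y y2.
Proof.
move=> hx hy hf; have [/andP[a1 a2] /andP[b1 b2]] := (hx, hy).
have y12 := le_trans b1 b2; have x12 := le_trans a1 a2.
rewrite /rect.
rewrite (@cint_split R x1 x2 x (fun t => f (t +i* y1)))//; last first.
  by move=> t tx; apply: ccont_hline; apply: hf; rewrite // lexx.
rewrite (@cint_split R x1 x2 x (fun t => f (t +i* y2)))//; last first.
  by move=> t tx; apply: ccont_hline; apply: hf; rewrite // lexx andbT.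
rewrite (@cint_split R y1 y2 y (fun t => f (x2 +i* t)))//; last first.
  by move=> t tx; apply: ccont_vline; apply: hf; rewrite // lexx andbT.
rewrite (@cint_split R y1 y2 y (fun t => f (x1 +i* t)))//; last first.
  by move=> t tx; apply: ccont_vline; apply: hf; rewrite // lexx.
ring.
Qed.

Lemma rectB f g x1 x2 y1 y2 : x1 <= x2 -> y1 <= y2 ->
  holo_on f x1 x2 y1 y2 -> holo_on g x1 x2 y1 y2 ->
  rect (fun z => f z - g z) x1 x2 y1 y2 = rect f x1 x2 y1 y2 - rect g x1 x2 y1 y2.
Proof.
move=> x12 y12 hf hg; rewrite /rect /cint.
have H k y : holo_on k x1 x2 y1 y2 -> y1 <= y <= y2 ->
    cintble `[x1, x2] (fun t => k (t +i* y)).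
  by move=> hk hy; apply: ccont_cintble => t tx; apply: ccont_hline; apply: hk.
have V k x : holo_on k x1 x2 y1 y2 -> x1 <= x <= x2 ->
    cintble `[y1, y2] (fun t => k (x +i* t)).
  by move=> hk hy; apply: ccont_cintble => t tx; apply: ccont_vline; apply: hk.
have X1 : x1 <= x1 <= x2 by rewrite lexx.
have X2 : x1 <= x2 <= x2 by rewrite lexx andbT.
have Y1 : y1 <= y1 <= y2 by rewrite lexx.
have Y2 : y1 <= y2 <= y2 by rewrite lexx andbT.
rewrite (cintegralB _ (H f y1 hf Y1) (H g y1 hg Y1))//.
rewrite (cintegralB _ (H f y2 hf Y2) (H g y2 hg Y2))//.
rewrite (cintegralB _ (V f x1 hf X1) (V g x1 hg X1))//.
rewrite (cintegralB _ (V f x2 hf X2) (V g x2 hg X2))//.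
ring.
Qed.

(** The primitive [F] gives each side by [FTC], with a factor -i on vertical sides because dz = i dt
    there. This is the part that the bisection argument subtracts. *)
Lemma rect_affine a b x1 x2 y1 y2 : x1 <= x2 -> y1 <= y2 ->
  rect (fun z => a + b * z) x1 x2 y1 y2 = 0.
Proof.
move=> x12 y12; rewrite /rect.
pose F z := a * z + b / 2 * (z * z).
have dH (y x : R) : cderiv (fun t => t +i* y) x 1.
  by split; [exact: is_derive_id|exact: is_derive_cst].
have dV (y x : R) : cderiv (fun t => x +i* t) y 'i.
  by split; [exact: is_derive_cst|exact: is_derive_id].
have aff z : holoat (fun z => a + b * z) z.
  by apply: holoD; [exact: holo_cst|apply: holoZ; exact: holo_id].
have cH y : cint x1 x2 (fun t => a + b * (t +i* y)) = F (x2 +i* y) - F (x1 +i* y).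
  apply: (@FTC _ (fun t => F (t +i* y))) => // x _; last exact: (ccont_hline (aff _)).
  have := cderivD (cderivZ a (dH y x)) (cderivZ (b / 2) (cderivM (dH y x) (dH y x))).
  by congr (cderiv _ _ _); field.
have cV x : cint y1 y2 (fun t => a + b * (x +i* t)) =
    - 'i * (F (x +i* y2) - F (x +i* y1)).
  have -> : - 'i * (F (x +i* y2) - F (x +i* y1)) = - 'i * F (x +i* y2) - - 'i * F (x +i* y1).
    by ring.
  apply: (@FTC _ (fun t => - 'i * F (x +i* t))) => // y _; last exact: (ccont_vline (aff _)).
  have := cderivZ (- 'i) (cderivD (cderivZ a (dV y x)) (cderivZ (b / 2) (cderivM (dV y x) (dV y x)))).
  congr (cderiv _ _ _); have := @sqr_i R; rewrite expr2 => ii.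
  rewrite (_ : _ * _ = - ('i * 'i) * (a + b * (x +i* y))); last by field.
  by rewrite ii opprK mul1r.
rewrite !cH !cV; have := @sqr_i R; rewrite expr2 => ii.
rewrite !mulrA mulrN ii opprK !mul1r; ring.
Qed.

Lemma le_cmod_rect f x1 x2 y1 y2 (M : R) : x1 <= x2 -> y1 <= y2 ->
  holo_on f x1 x2 y1 y2 ->
  (forall x y, x1 <= x <= x2 -> y1 <= y <= y2 -> cmod (f (x +i* y)) <= M) ->
  cmod (rect f x1 x2 y1 y2) <= M * (2 * ((x2 - x1) + (y2 - y1))).
Proof.
move=> x12 y12 hf fM.
have X1 : x1 <= x1 <= x2 by rewrite lexx.
have X2 : x1 <= x2 <= x2 by rewrite lexx andbT.
have Y1 : y1 <= y1 <= y2 by rewrite lexx.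
have Y2 : y1 <= y2 <= y2 by rewrite lexx andbT.
have H y : y1 <= y <= y2 -> cmod (cint x1 x2 (fun t => f (t +i* y))) <= M * (x2 - x1).
  move=> hy; apply: le_cmod_cint => // t ht; last exact: fM.
  by apply: ccont_hline; exact: hf.
have V x : x1 <= x <= x2 -> cmod ('i * cint y1 y2 (fun t => f (x +i* t))) <= M * (y2 - y1).
  move=> hx; rewrite cmodM cmod_i mul1r; apply: le_cmod_cint => // t ht; last exact: fM.
  by apply: ccont_vline; exact: hf.
have key (a b c e : R[i]) (p q : R) : cmod a <= p -> cmod b <= p ->
    cmod c <= q -> cmod e <= q -> cmod (a - b + c - e) <= p + p + (q + q).
  have := ler_cmodB (a - b + c) e; have := ler_cmodD (a - b) c; have := ler_cmodB a b.
  lra.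
apply: le_trans (key _ _ _ _ _ _ (H _ Y1) (H _ Y2) (V _ X2) (V _ X1)) _.
by rewrite le_eqVlt; apply/orP; left; apply/eqP; ring.
Qed.

(** The four quarters add up to the whole by [rect_split], so they cannot all stay below c/4. *)
Lemma rect_quarter f (x y w h c : R) : 0 <= w -> 0 <= h ->
  holo_on f x (x + w) y (y + h) -> c <= cmod (rect f x (x + w) y (y + h)) ->
  exists2 p : R * R, x <= p.1 /\ p.1 + w / 2 <= x + w /\ y <= p.2 /\ p.2 + h / 2 <= y + h &
    c / 4 <= cmod (rect f p.1 (p.1 + w / 2) p.2 (p.2 + h / 2)).
Proof.
move=> w0 h0 hf hc.
have hx : x <= x + w / 2 <= x + w by lra.
have hy : y <= y + h / 2 <= y + h by lra.
move: hc; rewrite (rect_split hx hy hf) => hc.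
apply: contrapT => no.
have N a b : a \in [:: x; x + w / 2] -> b \in [:: y; y + h / 2] ->
    cmod (rect f a (a + w / 2) b (b + h / 2)) < c / 4.
  move=> ha hb; rewrite ltNge; apply/negP => hh; apply: no; exists (a, b) => //=.
  move: ha hb; rewrite !inE => /orP[]/eqP-> /orP[]/eqP->; lra.
have E (u v : R) : u + v / 2 + v / 2 = u + v by field.
have := N x y; have := N (x + w / 2) y; have := N x (y + h / 2); have := N (x + w / 2) (y + h / 2).
rewrite !E !inE !eqxx ?orbT /= => /(_ isT isT) h1 /(_ isT isT) h2 /(_ isT isT) h3 /(_ isT isT) h4.
have key (r1 r2 r3 r4 : R[i]) (k : R) : cmod r1 < k / 4 -> cmod r2 < k / 4 ->
    cmod r3 < k / 4 -> cmod r4 < k / 4 -> cmod (r1 + r2 + r3 + r4) < k.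
  have := ler_cmodD (r1 + r2 + r3) r4; have := ler_cmodD (r1 + r2) r3; have := ler_cmodD r1 r2.
  lra.
by have := key _ _ _ _ _ h4 h3 h2 h1; rewrite ltNge hc.
Qed.

(** Each left end is at most each right end, so the supremum of the left ends is a common point. *)
Lemma nested_point (x l : nat -> R) :
  (forall n, x n <= x n.+1) -> (forall n, x n.+1 + l n.+1 <= x n + l n) ->
  (forall n, 0 <= l n) ->
  exists p, forall n, x n <= p <= x n + l n.
Proof.
move=> xi xd l0.
have mono n k : x n <= x (n + k)%N /\ x (n + k)%N + l (n + k)%N <= x n + l n.
  elim: k => [|k [IH1 IH2]]; rewrite ?addn0// addnS; split.
  - exact: le_trans (xi _).
  - exact: le_trans (xd _) IH2.
have ub n m : x m <= x n + l n.
  have [nm|mn] := leP n m.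
  - have [_] := mono n (m - n)%N; rewrite subnKC//; apply: le_trans.
    by rewrite lerDl.
  - have [h _] := mono m (n - m)%N; rewrite subnKC ?(ltnW mn)// in h.
    by apply: le_trans h _; rewrite lerDl.
pose A := range x.
have supA : has_sup A by split; [exists (x 0%N), 0%N | exists (x 0%N + l 0%N) => _ [m _ <-]].
exists (sup A) => n; apply/andP; split.
- by apply: ub_le_sup => //; [exact: supA.2 | exists n].
- by apply: ge_sup; [exact: supA.1|move=> _ [m _ <-]].
Qed.

Lemma Goursat f x1 x2 y1 y2 : x1 <= x2 -> y1 <= y2 ->
  holo_on f x1 x2 y1 y2 -> rect f x1 x2 y1 y2 = 0.
Proof.
move=> x12 y12 hf; apply/eqP; rewrite -cmod_eq0; apply/eqP; apply: contrapT => /eqP.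
set c := cmod _ => c_neq0.
have c0 : 0 < c by rewrite lt_neqAle eq_sym c_neq0 cmod_ge0.
pose w n : R := (x2 - x1) / 2 ^+ n; pose h n : R := (y2 - y1) / 2 ^+ n.
have w0 n : 0 <= w n by rewrite divr_ge0 ?subr_ge0// exprn_ge0.
have h0 n : 0 <= h n by rewrite divr_ge0 ?subr_ge0// exprn_ge0.
have wS n : w n.+1 = w n / 2 by rewrite /w exprS; field; rewrite expf_neq0.
have hS n : h n.+1 = h n / 2 by rewrite /h exprS; field; rewrite expf_neq0.
pose Q n (p : R * R) := [/\ x1 <= p.1, p.1 + w n <= x2, y1 <= p.2, p.2 + h n <= y2 &
  c / 4 ^+ n <= cmod (rect f p.1 (p.1 + w n) p.2 (p.2 + h n))].
have step n p : Q n p -> {p' | Q n.+1 p' /\ (p.1 <= p'.1 /\ p'.1 + w n.+1 <= p.1 + w n)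
    /\ (p.2 <= p'.2 /\ p'.2 + h n.+1 <= p.2 + h n)}.
  move=> [q1 q2 q3 q4 q5]; apply: cid.
  have [|[a b] /= [p1 [p2 [p3 p4]]] p5] := rect_quarter (w0 n) (h0 n) _ q5.
    by move=> x y /andP[a1 a2] /andP[b1 b2]; apply: hf; lra.
  exists (a, b); rewrite /Q wS hS /=; split; last by [].
  split; [lra|lra|lra|lra|].
  rewrite (_ : c / 4 ^+ n.+1 = c / 4 ^+ n / 4)//.
  by rewrite exprS; field; rewrite expf_neq0.
have Q0 : Q 0%N (x1, y1).
  rewrite /Q /w /h !expr0 !divr1 /= ![_ + (_ - _)]addrC !subrK.
  by split; rewrite ?lexx.
(* Each bisection is a choice; [step] returns an informative witness, so the rectangles are built
   together with their invariant [Q n]. *)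
pose ps := fix ps n : {p | Q n p} := match n with
  | 0%N => exist _ (x1, y1) Q0
  | m.+1 => let: exist p' P := step m (sval (ps m)) (svalP (ps m)) in exist _ p' P.1
  end.
have psS n : ((sval (ps n)).1 <= (sval (ps n.+1)).1 /\
   (sval (ps n.+1)).1 + w n.+1 <= (sval (ps n)).1 + w n)
    /\ ((sval (ps n)).2 <= (sval (ps n.+1)).2 /\
   (sval (ps n.+1)).2 + h n.+1 <= (sval (ps n)).2 + h n).
  by rewrite /=; case: (step _ _ _) => p' [P1 P2].
have [p pP] : exists p, forall n, (sval (ps n)).1 <= p <= (sval (ps n)).1 + w n.
  by apply: nested_point => // n; have [[]] := psS n.
have [q qP] : exists p, forall n, (sval (ps n)).2 <= p <= (sval (ps n)).2 + h n.
  by apply: nested_point => // n; have [_ []] := psS n.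
have [d hd] : holoat f (p +i* q).
  have := pP 0%N; have := qP 0%N; rewrite /= /w /h !expr0 !divr1.
  by move=> qq pp; apply: hf; lra.
pose W := (x2 - x1) + (y2 - y1).
have W0 : 0 <= W by rewrite /W; lra.
(* This tolerance makes the final bound c/4^n times W^2 / (2 (W + 1)^2), a factor below 1. Dividing
   by W + 1 rather than W covers degenerate rectangles. *)
have E0 : 0 < c / (4 * (W + 1) ^+ 2) by rewrite divr_gt0// mulr_gt0// exprn_gt0//; lra.
have [r r0 hr] := hd _ E0.
have [n Wn] : exists n, W / 2 ^+ n < r.
  have [n hn] : exists n : nat, W / r < n%:R.
    have := archi_boundP (divr_ge0 W0 (ltW r0)); set m := Num.bound _ => hm.
    by exists m.
  exists n; rewrite ltr_pdivrMr ?exprn_gt0// mulrC -ltr_pdivrMr//.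
  apply: lt_trans hn _; rewrite -natrX ltr_nat; exact: ltn_expl.
have := svalP (ps n); set pn := sval (ps n); move=> [q1 q2 q3 q4].
have [pp qq] := (pP n, qP n); rewrite -/pn in pp qq.
have hfn : holo_on f pn.1 (pn.1 + w n) pn.2 (pn.2 + h n).
  by move=> x y hx hy; apply: hf; lra.
(* [g] is the affine approximation of f at the limit point: it contributes nothing to the contour
   integral, and f - g is small on the n-th rectangle. *)
pose g z := f (p +i* q) - d * (p +i* q) + d * z.
have hg a1 a2 b1 b2 : holo_on g a1 a2 b1 b2.
  by move=> x y _ _; apply: holoD; [exact: holo_cst|apply: holoZ; exact: holo_id].
have wn := w0 n; have hn := h0 n.
have px : pn.1 <= pn.1 + w n by rewrite lerDl.
have py : pn.2 <= pn.2 + h n by rewrite lerDl.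
have -> : rect f pn.1 (pn.1 + w n) pn.2 (pn.2 + h n) =
    rect (fun z => f z - g z) pn.1 (pn.1 + w n) pn.2 (pn.2 + h n).
  by rewrite rectB// (rect_affine (f (p +i* q) - d * (p +i* q)) d px py) subr0.
have Wwh : w n + h n = W / 2 ^+ n by rewrite /w /h -mulrDl.
have bnd x y : pn.1 <= x <= pn.1 + w n -> pn.2 <= y <= pn.2 + h n ->
    cmod (f (x +i* y) - g (x +i* y)) <= c / (4 * (W + 1) ^+ 2) * (W / 2 ^+ n).
  move=> hx hy.
  have dist : cmod (x +i* y - p +i* q) <= W / 2 ^+ n.
    rewrite -Wwh; apply: le_trans (ler_cmod_ReIm _) _; rewrite ReB ImB /=.
    by apply: lerD; rewrite ler_norml; lra.
  have := hr (x +i* y) (le_lt_trans dist Wn).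
  rewrite (_ : f (x +i* y) - f (p +i* q) - d * (x +i* y - p +i* q) =
     f (x +i* y) - g (x +i* y)); last by rewrite /g; ring.
  by move=> /le_trans; apply; rewrite ler_wpM2l// ltW.
have hfg : holo_on (fun z => f z - g z) pn.1 (pn.1 + w n) pn.2 (pn.2 + h n).
  move=> x y hx hy; apply: holoB; first exact: hfn.
  by apply: (hg x x y y); rewrite lexx.
have := @le_cmod_rect (fun z => f z - g z) _ _ _ _ _ px py hfg bnd.
rewrite (_ : _ - _ + _ = w n + h n); last by ring.
rewrite Wwh => hh /le_trans /(_ hh).
have -> : c / (4 * (W + 1) ^+ 2) * (W / 2 ^+ n) * (2 * (W / 2 ^+ n)) =
    c / 4 ^+ n * (W ^+ 2 / (2 * (W + 1) ^+ 2)).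
  rewrite (_ : (4 : R) ^+ n = 2 ^+ n * 2 ^+ n); last by rewrite -exprMn; congr (_ ^+ _); ring.
  by field; rewrite expf_neq0// andbT; apply: lt0r_neq0; lra.
rewrite leNgt => /negP; apply.
rewrite gtr_pMr; last by rewrite divr_gt0// exprn_gt0.
rewrite ltr_pdivrMr; last by rewrite mulr_gt0// exprn_gt0//; lra.
nra.
Qed.

End Goursat.
Arguments rect : simpl never.

(** * Identity theorem: vanishing on a vertical strip spreads to the left *)

Section IdentityTheorem.
Variable R : realType.
Notation mu := (@lebesgue_measure R).
Implicit Types (f : R[i] -> R[i]) (z : R[i]).

Lemma ccont_cmod (f : R -> R[i]) (x : R) :
  ccont f x -> {for x, continuous (fun t => cmod (f t))}.
Proof.
move=> /ccontP cf; apply/cvgrPdist_lt => e /cf[d d0 h].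
apply/nbhs_ballP; exists d => //= t; rewrite /ball /= distrC => /h; rewrite distrC.
exact: le_lt_trans (ler_cmod_dist _ _).
Qed.

Lemma ccont_bounded (f : R -> R[i]) (a b : R) : a <= b ->
  (forall x, a <= x <= b -> ccont f x) ->
  exists M : R, forall x, a <= x <= b -> cmod (f x) <= M.
Proof.
move=> ab cf; have [|c _ hc] := @EVT_max R (fun t => cmod (f t)) a b ab.
  apply: continuous_in_subspaceT => x; rewrite inE/= in_itv/= => /cf.
  exact: ccont_cmod.
exists (cmod (f c)) => x xab; apply: hc; exact: xab.
Qed.

Lemma Rint_lb (u : R -> R) (a b m : R) : a <= b ->
  (forall x, a <= x <= b -> {for x, continuous u}) ->
  (forall x, a <= x <= b -> m <= u x) ->
  m * (b - a) <= \int[mu]_(t in `[a, b]) u t.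
Proof.
move=> ab cu mu_.
have -> : m * (b - a) = \int[mu]_(t in `[a, b]) m.
  rewrite Rintegral_cst//= lebesgue_measure_itv /= lte_fin.
  case: ltP => //= ba.
  have -> : b = a by apply/eqP; rewrite eq_le ab ba.
  by rewrite subrr.
apply: le_Rintegral => //.
- by apply: cont_integrable => x _; exact: cst_continuous.
- exact: cont_integrable.
Qed.

Lemma Rint_split (u : R -> R) (a b c : R) : a <= c <= b ->
  (forall x, a <= x <= b -> {for x, continuous u}) ->
  \int[mu]_(t in `[a, b]) u t =
  \int[mu]_(t in `[a, c]) u t + \int[mu]_(t in `[c, b]) u t.
Proof.
move=> acb cu.
have := @cint_split R a b c (fun t => (u t)%:C) acb.
move=> /(_ (fun x hx => ccont_real (cu x hx))).
by move=> /(congr1 (@complex.Re R)); rewrite ReD.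
Qed.

(** The window |t - y0| <= d/2 alone yields the first term, the parts from there to distance d are
    nonnegative, and farther out u is only known to be at least -M. As (d/2)^2 < d^2, the first term
    wins for large k. *)
Lemma gaussian_lb (u : R -> R) (c M d Y y0 k : R) : 0 < d -> d <= Y -> 0 < c ->
  (forall t, y0 - Y <= t <= y0 + Y -> {for t, continuous u}) ->
  (forall t, y0 - Y <= t <= y0 + Y -> - M <= u t) -> 0 <= M ->
  (forall t, y0 - d <= t <= y0 + d -> c <= u t) -> 0 <= k ->
  c * d * expR (- k * (d / 2) ^+ 2) - 2 * M * Y * expR (- k * d ^+ 2) <=
  \int[mu]_(t in `[y0 - Y, y0 + Y]) (u t * expR (- k * (t - y0) ^+ 2)).
Proof.
move=> d0 dY c0 cu uM M0 uc k0.
pose G t : R := u t * expR (- k * (t - y0) ^+ 2).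
have cG t : y0 - Y <= t <= y0 + Y -> {for t, continuous G}.
  move=> /cu ct; apply: continuousM => //.
  apply: (@continuous_comp _ _ _ (fun t => - k * (t - y0) ^+ 2) (@expR R)); last exact: continuous_expR.
  apply: (@continuousM _ _ (fun=> - k) (fun t => (t - y0) ^+ 2)); first exact: cst_continuous.
  apply: (@continuous_comp _ _ _ (fun t => t - y0) (fun x => x ^+ 2)); last exact: exprn_continuous.
  apply: continuousB; [exact: cvg_id|exact: cst_continuous].
have E t a : 0 <= a -> a ^+ 2 <= (t - y0) ^+ 2 -> expR (- k * (t - y0) ^+ 2) <= expR (- k * a ^+ 2).
  by move=> a0 h; rewrite ler_expR; nra.
have far t : y0 - Y <= t <= y0 + Y -> d ^+ 2 <= (t - y0) ^+ 2 -> - (M * expR (- k * d ^+ 2)) <= G t.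
  move=> ht hd; have := E t d (ltW d0) hd; have := uM _ ht; rewrite /G.
  set e1 := expR _; set e2 := expR _ => h1 h2.
  have e10 : 0 <= e1 := expR_ge0 _.
  have : - M * e1 <= u t * e1 by exact: ler_wpM2r.
  have : M * e1 <= M * e2 by exact: ler_wpM2l.
  lra.
have near t : y0 - d <= t <= y0 + d -> 0 <= G t.
  by move=> /uc h; rewrite mulr_ge0 ?expR_ge0//; lra.
have mid t : y0 - d / 2 <= t <= y0 + d / 2 -> c * expR (- k * (d / 2) ^+ 2) <= G t.
  move=> ht; apply: ler_pM; rewrite ?expR_ge0 ?(ltW c0)//.
    by apply: uc; lra.
  rewrite ler_expR; have : (t - y0) ^+ 2 <= (d / 2) ^+ 2 by nra.
  nra.
rewrite -/(G _) (@Rint_split G _ _ (y0 - d))//; last lra.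
rewrite (@Rint_split G (y0 - d) _ (y0 - d / 2)); [|lra|by move=> x hx; apply: cG; lra].
rewrite (@Rint_split G (y0 - d / 2) _ (y0 + d / 2)); [|lra|by move=> x hx; apply: cG; lra].
rewrite (@Rint_split G (y0 + d / 2) _ (y0 + d)); [|lra|by move=> x hx; apply: cG; lra].
have h1 := @Rint_lb G (y0 - Y) (y0 - d) (- (M * expR (- k * d ^+ 2))) _ _ _.
have {}h1 : - (M * expR (- k * d ^+ 2)) * (y0 - d - (y0 - Y)) <=
    \int[mu]_(t in `[y0 - Y, y0 - d]) G t.
  apply: Rint_lb; first lra.
    by move=> x hx; apply: cG; lra.
  move=> x hx; apply: far; clear - hx dY d0; [lra|nra].
have h2 : 0 * (y0 - d / 2 - (y0 - d)) <= \int[mu]_(t in `[y0 - d, y0 - d / 2]) G t.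
  apply: Rint_lb; first lra.
    by move=> x hx; apply: cG; lra.
  by move=> x hx; apply: near; lra.
have h3 : c * expR (- k * (d / 2) ^+ 2) * (y0 + d / 2 - (y0 - d / 2)) <=
     \int[mu]_(t in `[y0 - d / 2, y0 + d / 2]) G t.
  apply: Rint_lb; first lra.
    by move=> x hx; apply: cG; lra.
  by move=> x hx; apply: mid; lra.
have h4 : 0 * (y0 + d - (y0 + d / 2)) <= \int[mu]_(t in `[y0 + d / 2, y0 + d]) G t.
  apply: Rint_lb; first lra.
    by move=> x hx; apply: cG; lra.
  by move=> x hx; apply: near; lra.
have h5 : - (M * expR (- k * d ^+ 2)) * (y0 + Y - (y0 + d)) <=
    \int[mu]_(t in `[y0 + d, y0 + Y]) G t.
  apply: Rint_lb; first lra.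
    by move=> x hx; apply: cG; lra.
  move=> x hx; apply: far; clear - hx dY d0; [lra|nra].
have e0 : 0 <= M * expR (- k * d ^+ 2) by rewrite mulr_ge0// expR_ge0.
have : 0 <= M * expR (- k * d ^+ 2) * d by rewrite mulr_ge0// ltW.
lra.
Qed.

Lemma small_expR (K q e : R) : 0 < q -> 0 < e -> exists2 k : R, 0 <= k & K * expR (- k * q) < e.
Proof.
move=> q0 e0; pose k := (`|K| / e) / q.
have k0 : 0 <= k by rewrite !divr_ge0// ltW.
exists k => //; rewrite mulNr expRN -ltr_pdivlMr ?invr_gt0 ?expR_gt0// invrK.
have kq : k * q = `|K| / e by rewrite /k divfK// gt_eqF.
have h1 : K <= `|K| := ler_norm K.
have : e * (1 + k * q) <= e * expR (k * q) by rewrite ler_pM2l// expR_ge1Dx.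
rewrite {1}kq mulrDr mulr1 mulrCA divff ?gt_eqF// mulr1; lra.
Qed.

(* If f did not vanish at z0, Cauchy's theorem for f(z) exp(k (z - z0)^2) on a
   rectangle with one vertical side through z0 and the other in the strip where
   f = 0 would fail for large k: the former side contributes a Gaussian mass
   around z0, the horizontal sides are exponentially smaller. *)
Lemma strip_identity f (L a b : R) :
  (forall z, L < Re z -> Re z < b -> holoat f z) -> a < b ->
  (forall z, a < Re z < b -> f z = 0) ->
  forall z, L < Re z -> Re z < b -> f z = 0.
Proof.
move=> hf ab f0 z0 Lz zb.
have [az|za] := ltP a (Re z0); first by apply: f0; rewrite az.
(* The half-height [Y] exceeds the width by 1, so that Re((z - z0)^2) <= -1 on both horizontal
   sides. *)
pose x0 := Re z0; pose y0 := Im z0; pose x1 := (a + b) / 2; pose Y := x1 - x0 + 1.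
have ax1 : a < x1 < b by rewrite /x1; lra.
have x01 : x0 <= x1 by rewrite /x0; lra.
have Y1 : 1 <= Y by rewrite /Y; lra.
apply/eqP; rewrite -cmod_eq0; apply/eqP; apply: contrapT => /eqP.
set c := cmod _ => c_neq0.
have c0 : 0 < c by rewrite lt_neqAle eq_sym c_neq0 cmod_ge0.
have fz : z0 = x0 +i* y0 by rewrite /x0 /y0; case: (z0).
have hon x y : x0 <= x <= x1 -> holoat f (x +i* y).
  by move=> /andP[h1 h2]; apply: hf => /=; [apply: lt_le_trans Lz h1|lra].
have x0in : x0 <= x0 <= x1 by rewrite lexx.
have [w w1 wf] := cmod_rot (f z0).
have [M1 hM1] : exists M, forall t, x0 <= t <= x1 -> cmod (f (t +i* (y0 - Y))) <= M.
  by apply: (@ccont_bounded (fun t => f (t +i* (y0 - Y)))) => // t ht; exact/ccont_hline/hon.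
have [M2 hM2] : exists M, forall t, x0 <= t <= x1 -> cmod (f (t +i* (y0 + Y))) <= M.
  by apply: (@ccont_bounded (fun t => f (t +i* (y0 + Y)))) => // t ht; exact/ccont_hline/hon.
have [M3 hM3] : exists M, forall t, y0 - Y <= t <= y0 + Y -> cmod (f (x0 +i* t)) <= M.
  apply: (@ccont_bounded (fun t => f (x0 +i* t))); first lra.
  by move=> t _; exact/ccont_vline/hon.
have [d0' d0'0 hd] := holo_cont (hf _ Lz zb) (divr_gt0 c0 (ltr0n R 2)).
(* Within distance d of z0 the function stays c/2-close to f(z0); d <= 1 makes the factor e^{-k} of
   the horizontal sides at most e^{-k d^2}. *)
pose d := Num.min d0' 1 / 2.
have dp : 0 < d by rewrite divr_gt0// lt_min d0'0 ltr01.
have d1 : d < d0'.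
  rewrite /d; have : Num.min d0' 1 <= d0' by rewrite ge_min lexx.
  by move: d0'0; lra.
have d2 : d <= 1.
  rewrite /d; have : Num.min d0' 1 <= 1 by rewrite ge_min lexx orbT.
  by lra.
have M30 : 0 <= M3 by apply: le_trans (cmod_ge0 _) (hM3 y0 _); lra.
have M10 : 0 <= M1 by apply: le_trans (cmod_ge0 _) (hM1 x0 _); lra.
have M20 : 0 <= M2 by apply: le_trans (cmod_ge0 _) (hM2 x0 _); lra.
(* Everything to be beaten carries the factor e^{-k d^2}; [K] adds up the tails of the left side and
   the two horizontal sides. *)
pose K := 2 * M3 * Y + (M1 + M2) * (x1 - x0).
have q0 : 0 < d ^+ 2 - (d / 2) ^+ 2 by nra.
have [k k0 hk] := small_expR K q0 (mulr_gt0 (divr_gt0 c0 (ltr0n R 2)) dp).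
pose g z := f z * expC (k%:C * ((z - z0) * (z - z0))).
have hg x y : x0 <= x <= x1 -> holoat g (x +i* y).
  move=> hx; apply: holoM; first exact: hon.
  set z := x +i* y.
  pose h u := (k%:C * ((u - z0) * (u - z0)) : R[i]).
  have hh : holoat h z.
    apply: holoZ; have hs : holoat (fun u => u - z0) z by apply: holoB; [exact: holo_id|exact: holo_cst].
    exact: holoM.
  exact: (holo_comp (holo_exp (h z)) hh).
have cg z : cmod (g z) = cmod (f z) * expR (k * ((Re z - x0) ^+ 2 - (Im z - y0) ^+ 2)).
  rewrite /g cmodM cmod_expC; congr (_ * expR _).
  by rewrite ReM ReC ImC mul0r subr0 ReM !ReB !ImB /x0 /y0; ring.
have y0Y : y0 - Y <= y0 + Y by lra.
have := @Goursat R g x0 x1 (y0 - Y) (y0 + Y) x01 y0Y (fun x y hx _ => hg x y hx).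
rewrite /rect.
have -> : cint (y0 - Y) (y0 + Y) (fun t => g (x1 +i* t)) = 0.
  rewrite (@eq_cint _ _ _ _ (fun=> 0)); last by move=> t _; rewrite /g f0 ?mul0r.
  by rewrite /cint /cintegral /= !Rintegral_cst// !mul0r.
rewrite mulr0 addr0.
set B := cint x0 x1 _; set T := cint x0 x1 _; set Lf := cint _ _ _ => /eqP.
rewrite subr_eq0 => /eqP BT.
have hq t : x0 <= t <= x1 -> k * ((t - x0) ^+ 2 - (x1 - x0 + 1) ^+ 2) <= - k.
  move=> ht; have : (t - x0) ^+ 2 - (x1 - x0 + 1) ^+ 2 <= -1 by nra.
  by move=> h; rewrite -[leRHS]mulrN1 ler_wpM2l.
have hB : cmod B <= M1 * expR (- k) * (x1 - x0).
  apply: (le_cmod_cint x01) => t ht; first by apply: ccont_hline; exact: hg.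
  rewrite cg /= ler_pM ?cmod_ge0 ?expR_ge0 ?hM1// ler_expR /Y.
  by rewrite (_ : y0 - _ - y0 = - (x1 - x0 + 1)); [rewrite sqrrN; exact: hq|ring].
have hT : cmod T <= M2 * expR (- k) * (x1 - x0).
  apply: (le_cmod_cint x01) => t ht; first by apply: ccont_hline; exact: hg.
  rewrite cg /= ler_pM ?cmod_ge0 ?expR_ge0 ?hM2// ler_expR /Y.
  by rewrite (_ : y0 + _ - y0 = (x1 - x0 + 1)); [exact: hq|ring].
have hL : cmod Lf <= (M1 + M2) * expR (- k) * (x1 - x0).
  rewrite -[cmod Lf]mul1r -(cmod_i R) -cmodM -BT.
  by apply: le_trans (ler_cmodB _ _) _; rewrite !mulrDl lerD.
(* The unit w turns f(z0) into c, so u >= c/2 near y0; on the line Re z = x0 the Gaussian factor is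
   real. *)
pose u t : R := Re (w * f (x0 +i* t)).
have cgl t : y0 - Y <= t <= y0 + Y -> ccont (fun t => g (x0 +i* t)) t.
  by move=> _; exact/ccont_vline/hg.
have ReL : \int[mu]_(t in `[y0 - Y, y0 + Y]) (u t * expR (- k * (t - y0) ^+ 2)) = Re (w * Lf).
  rewrite /Lf /cint -cintegralZ//; last exact: ccont_cintble.
  rewrite /cintegral /=; apply: eq_Rintegral => t _.
  rewrite /g mulrA ReM Im_expC Re_expC.
  have -> : Im (k%:C * ((x0 +i* t - z0) * (x0 +i* t - z0))) = 0.
    by rewrite fz ImM /=; ring.
  have -> : Re (k%:C * ((x0 +i* t - z0) * (x0 +i* t - z0))) = - k * (t - y0) ^+ 2.
    by rewrite fz ReM /=; ring.
  by rewrite cos0 sin0 !mulr0 subr0 mulr1.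
have := @gaussian_lb u (c / 2) M3 d Y y0 k dp (le_trans d2 Y1) (divr_gt0 c0 (ltr0n R 2)).
rewrite ReL => /(_ _ _ M30 _ k0) lb.
have {}lb : c / 2 * d * expR (- k * (d / 2) ^+ 2) - 2 * M3 * Y * expR (- k * d ^+ 2) <= Re (w * Lf).
  apply: lb.
  - move=> t ht; have [] // : ccont (fun t => w * f (x0 +i* t)) t.
    by apply: ccontM; [exact: ccont_cst|exact/ccont_vline/hon].
  - move=> t ht; have := ler_Re_cmod (w * f (x0 +i* t)).
    rewrite cmodM w1 mul1r ler_norml => /andP[h _]; apply: le_trans h.
    by rewrite lerN2 hM3.
  - move=> t ht.
    have : cmod (f (x0 +i* t) - f z0) < c / 2.
      apply: hd; apply: le_lt_trans d1; rewrite fz.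
      apply: le_trans (ler_cmod_ReIm _) _; rewrite ReB ImB /= subrr normr0 add0r ler_norml.
      by move: ht; clear; lra.
    move=> h; have := le_lt_trans (ler_Re_cmod (w * (f (x0 +i* t) - f z0))).
    rewrite cmodM w1 mul1r => /(_ _ h).
    rewrite mulrBr ReB wf ReC -/c -/(u t) ltr_norml; clear; lra.
have := le_trans lb (le_trans (Re_le_cmod _) _); rewrite cmodM w1 mul1r => /(_ _ hL).
set e1 := expR (- k * (d / 2) ^+ 2).
have ek : expR (- k * d ^+ 2) = expR (- k * (d ^+ 2 - (d / 2) ^+ 2)) * e1.
  by rewrite /e1 -expRD; congr expR; ring.
have e10 : 0 < e1 := expR_gt0 _.
have ek1 : expR (- k) <= expR (- k * d ^+ 2).
  by rewrite ler_expR mulNr lerN2 ler_piMr// expr_le1// ltW.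
move=> fin; have : c / 2 * d * e1 <= K * expR (- k * d ^+ 2).
  have : (M1 + M2) * expR (- k) * (x1 - x0) <= (M1 + M2) * expR (- k * d ^+ 2) * (x1 - x0).
    by rewrite ler_wpM2r ?subr_ge0// ler_wpM2l// addr_ge0.
  by move: fin; rewrite /K; clear; lra.
rewrite ek [X in _ <= X]mulrA (ler_pM2r e10) leNgt => /negP; apply.
exact: hk.
Qed.

(** For a point left of the half-plane, [strip_identity] is applied to f - g with the strip c < Re z
    < c + 1, the region being cut off just left of that point. *)
Lemma entire_identity f g (c : R) : (forall z, holoat f z) -> (forall z, holoat g z) ->
  (forall z, c < Re z -> f z = g z) -> forall z, f z = g z.
Proof.
move=> hf hg fg z; have [cz|zc] := ltP c (Re z); first exact: fg.
apply/eqP; rewrite -subr_eq0; apply/eqP.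
apply: (@strip_identity (fun z => f z - g z) (Re z - 1) c (c + 1)).
- by move=> w _ _; exact: holoB.
- by rewrite ltrDl.
- by move=> w /andP[/fg -> _]; rewrite subrr.
- by rewrite gtrBl.
- by apply: le_lt_trans zc _; rewrite ltrDl.
Qed.

End IdentityTheorem.

(** * Improper integrals over (0, +oo) by exhaustion *)

Section Exhaustion.
Variable R : realType.
Notation mu := (@lebesgue_measure R).
(** The intervals stay abstract because two exhaustions occur: [1/(n+1), n+1], and its image under
    the square root in [Gamma_half]. *)
Variables (a b : nat -> R).
Hypothesis a_gt0 : forall n, 0 < a n.
Hypothesis a_dec : forall n m, (n <= m)%N -> a m <= a n.
Hypothesis b_inc : forall n m, (n <= m)%N -> b n <= b m.
Hypothesis ab_exhaust : forall x, 0 < x -> exists n, a n <= x <= b n.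

Lemma bigcup_exhaust : \bigcup_n `[a n, b n]%classic = `]0, +oo[%classic :> set R.
Proof.
apply/seteqP; split=> x /=.
- by move=> [n _ /=]; rewrite !in_itv/= andbT => /andP[h _]; exact: lt_le_trans h.
- rewrite in_itv/= andbT => /ab_exhaust[n h]; exists n => //=; rewrite in_itv/=.
Qed.

Lemma exhaust_cvg (g : R -> R) : (forall x, 0 < x -> {for x, continuous g}) ->
  (forall x, 0 < x -> 0 <= g x) ->
  (\int[mu]_(t in `[a n, b n]) (g t)%:E @[n --> \oo] -->
  \int[mu]_(t in `]0%R, +oo[) (g t)%:E)%E.
Proof.
move=> cg g0; rewrite -bigcup_exhaust.
apply: ge0_nondecreasing_set_cvg_integral => //.
- move=> n m nm; rewrite subsetEset => x /=; rewrite !in_itv/= => /andP[h1 h2].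
  by rewrite (le_trans (a_dec nm) h1) (le_trans h2 (b_inc nm)).
- move=> n; apply/measurable_EFinP.
  have /integrableP[/measurable_EFinP//] : mu.-integrable `[a n, b n] (EFin \o g).
  apply: cont_integrable => x /andP[h _]; apply: cg; exact: lt_le_trans h.
- move=> n x /=; rewrite in_itv/= lee_fin => /andP[h _]; apply: g0; exact: lt_le_trans h.
Qed.

Lemma measurable_0y (g : R -> R) : (forall x, 0 < x -> {for x, continuous g}) ->
  measurable_fun (`]0%R, +oo[%classic : set (measurableTypeR R)) (EFin \o g).
Proof.
move=> cg; rewrite -bigcup_exhaust; apply/measurable_fun_bigcup => // n.
have /integrableP[//] : mu.-integrable `[a n, b n] (EFin \o g).
by apply: cont_integrable => x /andP[h _]; apply: cg; exact: lt_le_trans h.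
Qed.

Lemma exhaust_integrable (g : R -> R) (M : R) :
  (forall x, 0 < x -> {for x, continuous g}) ->
  (forall x, 0 < x -> 0 <= g x) ->
  (forall n, \int[mu]_(t in `[a n, b n]) g t <= M) ->
  mu.-integrable `](0 : R), +oo[ (EFin \o g).
Proof.
move=> cg g0 gM; apply/integrableP; split.
  exact: measurable_0y.
have gi n : mu.-integrable `[a n, b n] (EFin \o g).
  apply: cont_integrable => x /andP[h _]; apply: cg; exact: lt_le_trans h.
have -> : (\int[mu]_(x in `]0%R, +oo[) `|(EFin \o g) x| =
    \int[mu]_(x in `]0%R, +oo[) (g x)%:E)%E.
  apply: eq_integral => x; rewrite inE/= in_itv/= andbT => x0.
  by rewrite ger0_norm// g0.
apply: (@le_lt_trans _ _ M%:E); last exact: ltry.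
have /(@cvg_lim _) <- // := exhaust_cvg cg g0.
apply: lime_le; first by apply/cvg_ex; eexists; exact: exhaust_cvg.
apply: nearW => n; have := gM n; rewrite -lee_fin /Rintegral fineK//.
exact: integrable_fin_num.
Qed.

Lemma cintble_dominated (f : R -> R[i]) (u : R -> R) :
  (forall x, 0 < x -> ccont f x) -> mu.-integrable `](0 : R), +oo[ (EFin \o u) ->
  (forall x, 0 < x -> cmod (f x) <= u x) -> cintble `]0, +oo[ f.
Proof.
move=> cf ui fu.
have H (g : R -> R) : (forall x, 0 < x -> {for x, continuous g}) ->
    (forall x, 0 < x -> `|g x| <= u x) -> mu.-integrable `](0 : R), +oo[ (EFin \o g).
  move=> cg gu; apply: (le_integrable _ _ _ ui) => //.
    exact: measurable_0y.
  move=> x /=; rewrite in_itv/= andbT => x0; rewrite lee_fin.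
  by apply: le_trans (gu _ x0) _; exact: ler_norm.
split; apply: H => x x0.
- by have [] := cf _ x0.
- exact: le_trans (ler_Re_cmod _) (fu _ x0).
- by have [] := cf _ x0.
- exact: le_trans (ler_Im_cmod _) (fu _ x0).
Qed.

Lemma exhaust_Rcvg (g : R -> R) : (forall x, 0 < x -> {for x, continuous g}) ->
  (forall x, 0 < x -> 0 <= g x) -> mu.-integrable `](0 : R), +oo[ (EFin \o g) ->
  \int[mu]_(t in `[a n, b n]) g t @[n --> \oo] --> \int[mu]_(t in `]0, +oo[) g t.
Proof.
move=> cg g0 gi; apply: fine_cvg; rewrite /Rintegral fineK; first exact: exhaust_cvg.
exact: integrable_fin_num.
Qed.

(** Monotone convergence covers nonnegative functions; g is written as the difference of g + |g| and
    |g|. *)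
Lemma exhaust_Rcvg_signed (g : R -> R) : (forall x, 0 < x -> {for x, continuous g}) ->
  mu.-integrable `](0 : R), +oo[ (EFin \o g) ->
  \int[mu]_(t in `[a n, b n]) g t @[n --> \oo] --> \int[mu]_(t in `]0, +oo[) g t.
Proof.
move=> cg gi.
have cn x : 0 < x -> {for x, continuous (fun t => `|g t|)}.
  move=> /cg h; apply: (@continuous_comp _ _ _ g (@Num.norm _ R)) => //.
  exact: (@norm_continuous R R).
have cgn x : 0 < x -> {for x, continuous (fun t => g t + `|g t|)}.
  by move=> x0; apply: continuousD; [exact: cg|exact: cn].
have ni : mu.-integrable `](0 : R), +oo[ (EFin \o (fun t => `|g t|)).
  exact: (integrable_abse gi).
have gni : mu.-integrable `](0 : R), +oo[ (EFin \o (fun t => g t + `|g t|)).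
  by apply: intbleD.
have c1 := exhaust_Rcvg cn (fun x _ => normr_ge0 (g x)) ni.
have gn0 x : 0 < x -> 0 <= g x + `|g x|.
  by move=> _; rewrite addrC -lerBlDr sub0r -normrN ler_norm.
have c2 := exhaust_Rcvg cgn gn0 gni.
have Dn n : mu.-integrable `[a n, b n] (EFin \o g).
  apply: cont_integrable => x /andP[h _]; apply: cg; exact: lt_le_trans h.
have Dnn n : mu.-integrable `[a n, b n] (EFin \o (fun t => `|g t|)).
  apply: cont_integrable => x /andP[h _]; apply: cn; exact: lt_le_trans h.
have -> : \int[mu]_(t in `]0, +oo[) g t =
    \int[mu]_(t in `]0, +oo[) (g t + `|g t|) - \int[mu]_(t in `]0, +oo[) `|g t|.
  by rewrite RintegralD// addrK.
have -> : (fun n => \int[mu]_(t in `[a n, b n]) g t) = (fun n =>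
    \int[mu]_(t in `[a n, b n]) (g t + `|g t|) - \int[mu]_(t in `[a n, b n]) `|g t|).
  by apply/funext => n; rewrite RintegralD// addrK.
apply: cvgB; last exact: c1.
exact: c2.
Qed.

Lemma exhaust_ccvg (f : R -> R[i]) (l : R[i]) : (forall x, 0 < x -> ccont f x) ->
  cintble `]0, +oo[ f ->
  (forall e : R, 0 < e -> \forall n \near \oo, cmod (cint (a n) (b n) f - l) < e) ->
  cintegral `]0, +oo[ f = l.
Proof.
move=> cf [f1 f2] h.
have H1 := exhaust_Rcvg_signed (fun x x0 => (cf x x0).1) f1.
have H2 := exhaust_Rcvg_signed (fun x x0 => (cf x x0).2) f2.
apply: complex_eq => /=.
- apply: (cvg_unique _ H1) => //; apply/cvgrPdist_lt => e /h.
  apply: filterS => n; apply: le_lt_trans; rewrite distrC.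
  by have := ler_Re_cmod (cint (a n) (b n) f - l); rewrite ReB.
- apply: (cvg_unique _ H2) => //; apply/cvgrPdist_lt => e /h.
  apply: filterS => n; apply: le_lt_trans; rewrite distrC.
  by have := ler_Im_cmod (cint (a n) (b n) f - l); rewrite ImB.
Qed.

End Exhaustion.

(** * The Gamma function *)

Section Gamma.
Variable R : realType.
Notation mu := (@lebesgue_measure R).
Implicit Types (z : R[i]) (x t : R).

Definition gammaf z t : R[i] := cpow t (z - 1) * (expR (- t))%:C.

Let an (n : nat) : R := n.+1%:R^-1.
Let bn (n : nat) : R := n.+1%:R.

Let an_gt0 n : 0 < an n. Proof. by rewrite invr_gt0 ltr0n. Qed.
Let an_dec n m : (n <= m)%N -> an m <= an n.
Proof. by move=> nm; rewrite lef_pV2 ?posrE ?ltr0n// ler_nat. Qed.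
Let bn_inc n m : (n <= m)%N -> bn n <= bn m.
Proof. by move=> nm; rewrite ler_nat. Qed.
Let ab_exh x : 0 < x -> exists n, an n <= x <= bn n.
Proof.
move=> x0; exists (Num.bound x + Num.bound x^-1)%N; apply/andP; split.
- rewrite /an -[leRHS]invrK lef_pV2 ?posrE ?ltr0n ?invr_gt0//.
  apply: ltW; apply: lt_le_trans (archi_boundP _) _; first by rewrite invr_ge0 ltW.
  by rewrite ler_nat leqW// leq_addl.
- apply: ltW; apply: lt_le_trans (archi_boundP (ltW x0)) _.
  by rewrite ler_nat leqW// leq_addr.
Qed.
Let abn n : an n <= 1 <= bn n.
Proof. by rewrite /an /bn invf_le1 ?ltr0n// ler1n. Qed.

Lemma Rint_FTC (U u : R -> R) (a b : R) : a <= b ->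
  (forall x : R, a <= x <= b -> is_derive x 1 U (u x)) ->
  (forall x, a <= x <= b -> {for x, continuous u}) ->
  \int[mu]_(t in `[a, b]) u t = U b - U a.
Proof.
move=> ab dU cu.
have := @FTC R (fun t => (U t)%:C) (fun t => (u t)%:C) a b ab.
move=> /(_ (fun x hx => cderiv_real (dU x hx)) (fun x hx => ccont_real (cu x hx))).
by move=> /(congr1 (@complex.Re R)); rewrite ReB.
Qed.

Lemma cont_powR (r x : R) : 0 < x -> {for x, continuous (fun t => t `^ r)}.
Proof.
move=> x0; apply/differentiable_continuous/derivable1_diffP.
exact: (@ex_derive _ _ _ _ _ _ _ (is_derive1_powR r x0)).
Qed.

Lemma is_derive_expRZ (c x : R) : is_derive x 1 (fun t : R => expR (c * t)) (c * expR (c * x)).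
Proof.
have D := @is_derive1_comp _ (@expR R) (fun t => c * t) x _ _ (is_derive_expR _)
  (is_deriveZ c (is_derive_id x 1)).
by apply: (is_derive_eq D); rewrite /GRing.scale /= mulr1 mulrC.
Qed.

(** A single term of the exponential series at t/2 dominates the power; the half leaves e^{-t/2}
    after multiplication by e^{-t}. *)
Lemma powR_le_expR (r : R) : exists2 M : R, 0 <= M &
  forall t, 1 <= t -> t `^ r <= M * expR (2^-1 * t).
Proof.
pose m := Num.bound `|r|.
exists (2 ^+ m.+1 * (m.+1)`!%:R); first by rewrite mulr_ge0// exprn_ge0.
move=> t t1; have t0 : 0 <= t by apply: le_trans t1.
apply: (@le_trans _ _ (t `^ m.+1%:R)).
  apply: ler_powR => //; apply: le_trans (ler_norm _) _.
  by apply: ltW; apply: lt_le_trans (archi_boundP (normr_ge0 r)) _; rewrite ler_nat.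
rewrite powR_mulrn//.
have h : 0 <= 2^-1 * t by rewrite mulr_ge0// invr_ge0.
have := expR_ge1Dxn m h; rewrite exprMn => hh.
have F0 : 0 < (m.+1)`!%:R :> R by rewrite ltr0n fact_gt0.
have : 2^-1 ^+ m.+1 * t ^+ m.+1 / (m.+1)`!%:R <= expR (2^-1 * t) by lra.
rewrite ler_pdivrMr// exprVn mulrC ler_pdivrMr ?exprn_gt0//.
by move=> /le_trans; apply; rewrite le_eqVlt; apply/orP; left; apply/eqP; ring.
Qed.

Lemma ccont_gammaf z x : 0 < x -> ccont (gammaf z) x.
Proof.
move=> x0; apply: ccontM; first exact: ccont_cpow.
apply: ccont_real; apply: (@continuous_comp _ _ _ (fun t => - t) (@expR R)).
  exact: opp_continuous.
exact: continuous_expR.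
Qed.

Lemma cmod_gammaf z x : cmod (gammaf z x) = x `^ (Re z - 1) * expR (- x).
Proof.
by rewrite /gammaf cmodM cmod_cpow cmodC ger0_norm ?expR_ge0// ReB.
Qed.

Lemma gammaf_cintble z : 0 < Re z -> cintble `]0%R, +oo[ (gammaf z).
Proof.
move=> z0; pose u t : R := t `^ (Re z - 1) * expR (- t).
have cu x : 0 < x -> {for x, continuous u}.
  move=> x0; apply: continuousM; first exact: cont_powR.
  apply: (@continuous_comp _ _ _ (fun t => - t) (@expR R)); first exact: opp_continuous.
  exact: continuous_expR.
have [M M0 hM] := powR_le_expR (Re z - 1).
have ui : mu.-integrable `]0%R, +oo[ (EFin \o u).
  (* 1/Re z bounds the integral of t^{Re z - 1} over (0, 1], and 2 M that of M e^{-t/2} over [1,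
     +oo). *)
  apply: (exhaust_integrable an_gt0 an_dec bn_inc ab_exh (M := (Re z)^-1 + 2 * M)) => //.
    by move=> x x0; rewrite mulr_ge0 ?powR_ge0 ?expR_ge0.
  move=> n; have /andP[a1 b1] := abn n.
  rewrite (@Rint_split _ u _ _ 1) ?a1 ?b1//; last first.
    by move=> x /andP[h _]; apply: cu; exact: lt_le_trans h.
  apply: lerD.
  - apply: (@le_trans _ _ (\int[mu]_(t in `[an n, 1]) (t `^ (Re z - 1)))).
      apply: le_Rintegral => //.
      + by apply: cont_integrable => x /andP[h _]; apply: cu; exact: lt_le_trans h.
      + by apply: cont_integrable => x /andP[h _]; apply: cont_powR; exact: lt_le_trans h.
      + move=> x /=; rewrite in_itv/= => /andP[h _]; rewrite ler_piMr ?powR_ge0//.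
        by rewrite expR_le1 oppr_le0; apply/ltW/(lt_le_trans _ h).
    have -> : \int[mu]_(t in `[an n, 1]) (t `^ (Re z - 1)) =
        (Re z)^-1 * 1 `^ Re z - (Re z)^-1 * an n `^ Re z.
      apply: (@Rint_FTC (fun t => (Re z)^-1 * t `^ Re z)) => //.
      + move=> x /andP[h _]; have x0 : 0 < x by apply: lt_le_trans h.
        have D := is_deriveZ (Re z)^-1 (is_derive1_powR (Re z) x0).
        by apply: (is_derive_eq D); rewrite /GRing.scale /= mulrA mulVf ?mul1r// gt_eqF.
      + by move=> x /andP[h _]; apply: cont_powR; exact: lt_le_trans h.
    by rewrite powR1 mulr1 gerBl// mulr_ge0 ?powR_ge0// invr_ge0 ltW.
  - pose v t : R := M * expR (- 2^-1 * t).
    have cv x : {for x, continuous v}.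
      apply: continuousM; first exact: cst_continuous.
      apply: (@continuous_comp _ _ _ (fun t => - 2^-1 * t) (@expR R)); last exact: continuous_expR.
      exact: mulrl_continuous.
    apply: (@le_trans _ _ (\int[mu]_(t in `[1, bn n]) v t)).
      apply: le_Rintegral => //.
      + by apply: cont_integrable => x /andP[h _]; apply: cu; exact: lt_le_trans h.
      + exact: cont_integrable.
      + move=> x /=; rewrite in_itv/= => /andP[h _].
        apply: (@le_trans _ _ (M * expR (2^-1 * x) * expR (- x))).
          by rewrite ler_wpM2r ?expR_ge0// hM.
        by rewrite /v -mulrA -expRD (_ : 2^-1 * x - x = - 2^-1 * x)//; field.
    have -> : \int[mu]_(t in `[1, bn n]) v t =
       (- 2 * M) * expR (- 2^-1 * bn n) - (- 2 * M) * expR (- 2^-1 * 1).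
      apply: (@Rint_FTC (fun t => (- 2 * M) * expR (- 2^-1 * t))) => //.
      move=> x _; have D := is_deriveZ (- 2 * M) (is_derive_expRZ (- 2^-1) x).
      by apply: (is_derive_eq D); rewrite /GRing.scale /= /v; field.
    have := expR_gt0 (- 2^-1 * bn n).
    have : expR (- 2^-1 * 1) <= 1 :> R by rewrite expR_le1; lra.
    nra.
apply: (cintble_dominated an_gt0 ab_exh (u := u)) => //.
- by move=> x x0; exact: ccont_gammaf.
- by move=> x _; rewrite cmod_gammaf.
Qed.

Lemma near_inv (e : R) : 0 < e -> \forall n \near \oo, an n < e.
Proof. by move=> e0; exact: near_infty_natSinv_lt (PosNum e0). Qed.

Lemma near_big (M : R) : \forall n \near \oo, M < bn n.
Proof.
exists (Num.bound `|M|) => // n /= hn; apply: le_lt_trans (ler_norm M) _.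
by apply: lt_le_trans (archi_boundP (normr_ge0 M)) _; rewrite ler_nat leqW.
Qed.

(** Integration by parts: the boundary term [F], t^z e^{-t}, tends to 0 at both ends of (0, +oo). *)
Lemma Gamma_rec z : 0 < Re z -> Gamma_integral (z + 1) = z * Gamma_integral z.
Proof.
move=> z0; have z10 : 0 < Re (z + 1) by rewrite ReD /= ltr_wpDr.
pose F t := cpow t z * (expR (- t))%:C.
have dF x : 0 < x -> cderiv F x (z * gammaf z x - gammaf (z + 1) x).
  move=> x0; have dE : is_derive x 1 (fun t : R => expR (- t)) (- expR (- x)).
    have := is_derive_expRZ (-1) x; rewrite !mulN1r.
    by rewrite (_ : (fun t : R => expR (-1 * t)) = (fun t : R => expR (- t)))//;
      apply/funext => t; rewrite mulN1r.
  have := cderivM (cderiv_cpow z x0) (cderiv_real dE).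
  rewrite /gammaf addrK rmorphN /= mulrN.
  by rewrite !mulrA.
have : cintegral `]0%R, +oo[ (fun t => z * gammaf z t - gammaf (z + 1) t) = 0.
  have ci1 := cintbleZ z (measurable_itv _) (gammaf_cintble z0).
  have ci2 := cintbleN (measurable_itv _) (gammaf_cintble z10).
  have cc x : 0 < x -> ccont (fun t => z * gammaf z t - gammaf (z + 1) t) x.
    move=> x0; apply: ccontB; last exact: ccont_gammaf.
    by apply: ccontM; [exact: ccont_cst|exact: ccont_gammaf].
  apply: (exhaust_ccvg an_gt0 an_dec bn_inc ab_exh) => //.
    exact: (cintbleD (measurable_itv _) ci1 ci2).
  move=> e e0; have e2 : 0 < e / 2 by rewrite divr_gt0.
  have [d d0 hd] := powR_small z0 e2.
  have [M M0 hM] := powR_le_expR (Re z).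
  near=> n.
  have /andP[a1 b1] := abn n.
  have pos x : an n <= x <= bn n -> 0 < x by move=> /andP[h _]; exact: lt_le_trans h.
  rewrite subr0 (@FTC R F); last 3 first.
    exact: le_trans a1 b1.
    by move=> x /pos; exact: dF.
    by move=> x /pos; exact: cc.
  have cF t : cmod (F t) = t `^ Re z * expR (- t).
    by rewrite cmodM cmod_cpow cmodC ger0_norm ?expR_ge0.
  apply: le_lt_trans (ler_cmodB _ _) _; rewrite (splitr e) addrC !cF; apply: ltrD.
  - apply: (@le_lt_trans _ _ (an n `^ Re z)).
      rewrite ler_piMr ?powR_ge0// expR_le1 oppr_le0 ltW//.
    by apply: hd; rewrite (ltW (an_gt0 n)) /=; near: n; exact: near_inv.
  - apply: (@le_lt_trans _ _ (M * expR (2^-1 * bn n) * expR (- bn n))).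
      by rewrite ler_wpM2r ?expR_ge0// hM.
    rewrite -mulrA -expRD (_ : 2^-1 * bn n - bn n = - (2^-1 * bn n)); last by field.
    rewrite expRN ltr_pdivrMr ?expR_gt0//.
    have : 2 * (M + 1) / (e / 2) < bn n by near: n; exact: near_big.
    rewrite ltr_pdivrMr// => h.
    have := expR_ge1Dx (2^-1 * bn n) => h2.
    have : e / 2 * (1 + 2^-1 * bn n) <= e / 2 * expR (2^-1 * bn n) by rewrite ler_pM2l.
    by apply: lt_le_trans; lra.
rewrite cintegralB; [|exact: measurable_itv| |exact: gammaf_cintble]; last first.
  exact: cintbleZ (measurable_itv _) (gammaf_cintble z0).
rewrite cintegralZ; [|exact: measurable_itv|exact: gammaf_cintble].
by move=> /eqP; rewrite subr_eq0 => /eqP.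
Unshelve. all: by end_near.
Qed.

Lemma Gamma_shift z m : 0 < Re z ->
  Gamma_integral (z + m%:R) = \prod_(k < m) (z + k%:R) * Gamma_integral z.
Proof.
move=> z0; elim: m => [|m IH]; first by rewrite big_ord0 addr0 mul1r.
rewrite big_ord_recr /= -natr1 addrA Gamma_rec ?IH; last first.
  by rewrite ReD Re_nat ltr_wpDr.
by rewrite mulrA [in RHS]mulrAC [X in _ = X]mulrC mulrA.
Qed.

Lemma prod_shift_neq0 z m : 0 < Re z -> \prod_(k < m) (z + k%:R) != 0.
Proof.
move=> z0; apply/prodf_neq0 => k _; apply/eqP => /(congr1 (@complex.Re R)).
by rewrite ReD Re_nat /= => /eqP; rewrite gt_eqF// ltr_wpDr.
Qed.

(** The shift chosen in the definition cancels by [Gamma_shift], so in the right half-plane the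
    value does not depend on it. *)
Lemma rGammaE z : 0 < Re z -> rGamma z = (Gamma_integral z)^-1.
Proof.
move=> z0; rewrite /rGamma Gamma_shift// invfM mulrA divff ?mul1r//.
exact: prod_shift_neq0.
Qed.

(** Confined to the right half-plane; [rGamma_recT] extends it once holomorphy is available. *)
Lemma rGamma_rec z : 0 < Re z -> rGamma z = z * rGamma (z + 1).
Proof.
move=> z0; rewrite !rGammaE//; last by rewrite ReD /= ltr_wpDr.
rewrite Gamma_rec// invfM mulrA divff ?mul1r//.
by apply/eqP => z1; move: z0; rewrite z1 ltxx.
Qed.

Lemma rGamma_shift z : exists2 m, 0 < Re (z + m%:R) &
  rGamma z = \prod_(k < m) (z + k%:R) * rGamma (z + m%:R).
Proof.
pose m := (Num.truncn `|Re z|).+1.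
have zm : 0 < Re (z + m%:R).
  have : `|Re z| < m%:R by rewrite /m truncnS_gt.
  by rewrite ReD Re_nat ltr_norml; lra.
by exists m; rewrite // [in RHS]rGammaE.
Qed.

Lemma Gamma1 : Gamma_integral (1 : R[i]) = 1.
Proof.
apply: (exhaust_ccvg an_gt0 an_dec bn_inc ab_exh).
- by move=> x; exact: ccont_gammaf.
- by apply: gammaf_cintble; rewrite /= ltr01.
move=> e e0; have e2 : 0 < e / 2 by rewrite divr_gt0.
near=> n.
have /andP[a1 b1] := abn n.
have pos x : an n <= x <= bn n -> 0 < x by move=> /andP[h _]; exact: lt_le_trans h.
rewrite (@FTC R (fun t => (- expR (- 1 * t))%:C)); last 3 first.
- exact: le_trans a1 b1.
- move=> x /pos x0; have := cderiv_real (is_deriveN (is_derive_expRZ (-1) x)).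
  by rewrite subrr cpowr0 mul1r !mulN1r opprK.
- by move=> x /pos; exact: ccont_gammaf.
rewrite !mulN1r -rmorphB opprK -(rmorph1 (real_complex R)) -rmorphB cmodC.
have h1 : expR (- an n) <= 1 by rewrite expR_le1 oppr_le0 ltW.
have h2 := expR_ge1Dx (- an n).
have h3 : an n < e / 2 by near: n; exact: near_inv.
have h4 : expR (- bn n) < e / 2.
  rewrite expRN -[ltRHS]invrK ltf_pV2 ?posrE ?expR_gt0 ?invr_gt0//.
  have : (e / 2)^-1 < bn n by near: n; exact: near_big.
  by have := expR_ge1Dx (bn n); lra.
have h5 := expR_gt0 (- bn n).
rewrite ltr_norml; lra.
Unshelve. all: by end_near.
Qed.

Lemma cint_real (u : R -> R) a b :
  cint a b (fun t => (u t)%:C) = (\int[mu]_(t in `[a, b]) u t)%:C.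
Proof.
apply: complex_eq => //=.
by rewrite Rintegral_cst ?mul0r.
Qed.

(** The substitution t = u^2 gives twice the Gaussian integral. Since [[sa n], [sb n]] is the
    preimage of [[an n], [bn n]], the two exhaustions match term by term. *)
Lemma Gamma_half : Gamma_integral (2^-1 : R[i]) = (Num.sqrt (pi : R))%:C.
Proof.
have h0 : 0 < Re (2^-1 : R[i]) by rewrite -[2^-1]mul1r Re_half /= divr_gt0.
pose sa n := Num.sqrt (an n); pose sb n := Num.sqrt (bn n).
have sa0 n : 0 < sa n by rewrite sqrtr_gt0.
have sa_dec n m : (n <= m)%N -> sa m <= sa n by move=> nm; rewrite ler_wsqrtr// an_dec.
have sb_inc n m : (n <= m)%N -> sb n <= sb m by move=> nm; rewrite ler_wsqrtr// bn_inc.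
have exh x : 0 < x -> exists n, sa n <= x <= sb n.
  move=> x0; have [n /andP[h1 h2]] := ab_exh (exprn_gt0 2 x0).
  exists n; rewrite /sa /sb -[x]ger0_norm ?(ltW x0)// -sqrtr_sqr.
  by rewrite !ler_wsqrtr.
have cg x : 0 < x -> {for x, continuous (@gauss_fun R)} by move=> _; exact: continuous_gauss_fun.
have gi : mu.-integrable `]0%R, +oo[ (EFin \o @gauss_fun R).
  by apply: integrableS (@integrableT_gauss R).
have := exhaust_Rcvg sa0 sa_dec sb_inc exh cg (fun x _ => gauss_fun_ge0 x) gi.
have -> : \int[mu]_(t in `]0, +oo[) gauss_fun t = Num.sqrt pi / 2.
  rewrite Rintegral_itv_obnd_cbnd// /Rintegral integral0y_gauss//.
move=> /cvgrPdist_lt H.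
apply: (exhaust_ccvg an_gt0 an_dec bn_inc ab_exh).
- by move=> x; exact: ccont_gammaf.
- exact: gammaf_cintble.
move=> e e0; have e2 : 0 < e / 2 by rewrite divr_gt0.
have {H} := H _ e2; apply: filterS => n.
have sab : sa n <= sb n by have /andP[h1 h2] := abn n; rewrite ler_wsqrtr// (le_trans h1).
have -> : cint (an n) (bn n) (gammaf 2^-1) =
    (2 * \int[mu]_(t in `[sa n, sb n]) gauss_fun t)%:C.
  rewrite -RintegralZl//; last first.
    by apply: cont_integrable => x _; exact: continuous_gauss_fun.
  rewrite -cint_real.
  have -> : an n = sa n ^+ 2 by rewrite sqr_sqrtr// ltW.
  have -> : bn n = sb n ^+ 2 by rewrite sqr_sqrtr// ler0n.
  apply: etrans (@cint_subst_incr R (fun u => u ^+ 2) (fun u => 2 * u)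
    (gammaf 2^-1) (sa n) (sb n) sab _ _ _ _) _.
  - move=> x y ax xy _; have := sa0 n; nra.
  - move=> x; have D := is_deriveM (is_derive_id x 1) (is_derive_id x 1).
    by apply: (is_derive_eq D); rewrite /GRing.scale /= mulr1; ring.
  - move=> x; apply: mulrl_continuous.
  - by move=> x /andP[h _]; apply: ccont_gammaf; apply: lt_le_trans h; rewrite exprn_gt0.
  - apply: eq_cint => u /andP[hu _].
    have u0 : 0 < u by exact: lt_le_trans hu.
    rewrite /gammaf /gauss_fun !rmorphM /= mulrA; congr (_ * _).
    have -> : (2^-1 - 1 : R[i]) = - (2^-1) by field.
    rewrite expr2 cpowMl// -cpowD// (_ : - 2^-1 + - 2^-1 = - (1 : R[i])); last by field.
    rewrite cpowN// cpowr1 ?(ltW u0)// -mulrA divff ?mulr1//.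
    by rewrite -cmod_eq0 cmodC normr_eq0 gt_eqF.
rewrite -rmorphB cmodC => h.
rewrite (_ : _ - Num.sqrt pi = - (2 * (Num.sqrt pi / 2 - \int[mu]_(t in `[sa n, sb n]) gauss_fun t))); last by field.
rewrite normrN normrM ger0_norm//; lra.
Qed.

End Gamma.

(** * Restriction to complex lines in parameter space *)

Section ComplexLines.
Variable R : realType.

(** Over the field [R[i]], the derivative in direction [d] is a complex derivative along the
    line. *)
Lemma differentiable_holo (F : (R[i] * R[i]) * (R[i] * R[i]) -> R[i])
    (p d : (R[i] * R[i]) * (R[i] * R[i])) (w0 : R[i]) :
  (forall q, differentiable F q) -> holoat (fun w => F (p + w *: d)) w0.
Proof.
move=> /(_ (p + w0 *: d)) dF.
have := @diff_derivable _ _ _ F (p + w0 *: d) d dF; rewrite /derivable => /cvg_ex[/= l Hl].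
exists l => e e0.
move/cvgrPdist_lt : Hl => /(_ e%:C); rewrite ltcR => /(_ e0).
rewrite /dnbhs /= => /nbhs_ballP[r /= r0 H].
(* A positive element of [R[i]] is real, so the radius is the image of its modulus. *)
have rr : r = (cmod r)%:C by rewrite -normr_cmod gtr0_norm.
have cr0 : 0 < cmod r by move: r0; rewrite {1}rr ltcR.
exists (cmod r) => // w hw.
have [->|ww] := eqVneq w w0.
  by rewrite !subrr mulr0 subr0 cmod0 mulr0.
have := H (w - w0); rewrite /ball /= sub0r normrN normr_cmod rr ltcR => /(_ hw).
rewrite subr_eq0 => /(_ ww).
rewrite (_ : (w - w0) *: d + (p + w0 *: d) = p + w *: d); last first.
  by rewrite addrCA -scalerDl subrK.
rewrite normr_cmod ltcR => h.
rewrite (_ : F (p + w *: d) - F (p + w0 *: d) - l * (w - w0) =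
  - (w - w0) * (l - (w - w0)^-1 * (F (p + w *: d) - F (p + w0 *: d)))); last first.
  by field; rewrite subr_eq0.
by rewrite cmodM cmodN mulrC ler_wpM2r ?cmod_ge0// ltW.
Qed.

Lemma pair_lineE (x1 x2 x3 x4 d1 d2 d3 d4 w : R[i]) :
  ((x1, x2), (x3, x4)) + w *: ((d1, d2), (d3, d4)) =
  ((x1 + w * d1, x2 + w * d2), (x3 + w * d3, x4 + w * d4)).
Proof. by []. Qed.

End ComplexLines.

(** * Truncated Mellin transforms *)

Section Mellin.
Variable R : realType.
Implicit Types (k : R -> R[i]) (z h : R[i]) (t x : R).

(** The bound ln x <= x at x = t^{-d}: a logarithm costs an arbitrarily small power of t. *)
Lemma ln_le_powR (t d : R) : 0 < t -> t <= 1 -> 0 < d ->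
  `|ln t| <= d^-1 * t `^ (- d).
Proof.
move=> t0 t1 d0; rewrite ler0_norm ?ln_le0// ler_pdivlMl// mulrN -mulNr -ln_powR.
exact/ltW/ln_sublinear/powR_gt0.
Qed.

Lemma ccont_ln_cpow z x : 0 < Re z ->
  ccont (fun t => (ln `|t|)%:C * cpow `|t| z) x.
Proof.
move=> z0; have [->|x0] := eqVneq x 0; last first.
  apply: ccontM; last exact: ccont_cpow_norm.
  apply: ccont_real; apply: (@continuous_comp _ _ _ (fun t => `|t|) (@ln R)).
    exact: (@norm_continuous R R).
  by apply: continuous_ln; rewrite normr_gt0.
apply/ccontP => e e0.
have z2 : 0 < Re z / 2 by rewrite divr_gt0.
have [d d0 hd] := powR_small z2 (mulr_gt0 e0 z2).
exists (Num.min d 1); first by rewrite lt_min d0 ltr01.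
move=> t; rewrite subr0 lt_min => /andP[td t1].
rewrite normr0 cpow0r ?gt_eqF// mulr0 subr0 cmodM cmodC cmod_cpow.
have [->|t0] := eqVneq t 0.
  by rewrite normr0 ln0// normr0 mul0r.
have nt : 0 < `|t| by rewrite normr_gt0.
have h := ln_le_powR nt (ltW t1) z2.
apply: (@le_lt_trans _ _ ((Re z / 2)^-1 * `|t| `^ (Re z / 2))).
  rewrite (_ : _ * `|t| `^ (Re z / 2) = (Re z / 2)^-1 * `|t| `^ (- (Re z / 2)) * `|t| `^ Re z).
    by rewrite ler_wpM2r// powR_ge0.
  rewrite -mulrA -powRD; first by congr (_ * _ `^ _); field.
  by rewrite normr_eq0 t0 implybT.
by rewrite mulrC ltr_pdivrMr// hd// normr_ge0.
Qed.

(** Differentiation under the integral with an explicit remainder. With x = Re z, the remainder of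
    t^{z+h} is t^z times that of e^{h ln t}; here |ln t|^2 costs t^{-x/2} and e^{|h ln t|} costs
    t^{-x/4}, as |h| < x/4, and t^x absorbs both. *)
Lemma holo_mellin k z : (forall x, ccont k x) -> 0 < Re z ->
  holoat (fun a => cint 0 1 (fun t => cpow `|t| a * k t)) z.
Proof.
move=> ck z0.
have [M hM] := ccont_bounded ler01 (fun x _ => ck x).
have M0 : 0 <= M by apply: le_trans (cmod_ge0 _) (hM 0 _); rewrite lexx ler01.
set x := Re z in z0.
exists (cint 0 1 (fun t => (ln `|t|)%:C * cpow `|t| z * k t)) => e e0.
(* 80 is the 5 of [expC_taylor1] times the 16 of (4/x)^2, from [ln_le_powR] with d = x/4. The added
   1 keeps K positive when M = 0. *)
pose K := 80 / x ^+ 2 * M + 1.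
have K0 : 0 < K by rewrite ltr_wpDl// mulr_ge0// divr_ge0// sqr_ge0.
exists (Num.min (x / 4) (e / K)); first by rewrite lt_min !divr_gt0.
move=> w; rewrite lt_min => /andP[h1 h2]; set h := w - z in h1 h2 *.
have wE : w = z + h by rewrite /h; ring.
have w0 : 0 < Re w.
  rewrite wE ReD -/x; have := ler_Re_cmod h; rewrite ler_norml; lra.
have c1 a y : 0 < Re a -> ccont (fun t => cpow `|t| a * k t) y.
  by move=> a0; exact: (ccontM (ccont_cpow_norm y a0) (ck y)).
have c2 y : ccont (fun t => (ln `|t|)%:C * cpow `|t| z * k t) y.
  exact: (ccontM (ccont_ln_cpow y z0) (ck y)).
have I a : 0 < Re a -> cintble `[0, 1] (fun t => cpow `|t| a * k t).
  by move=> a0; apply: ccont_cintble => y _; exact: c1.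
have I2 : cintble `[0, 1] (fun t => (ln `|t|)%:C * cpow `|t| z * k t).
  by apply: ccont_cintble => y _; exact: c2.
pose D t := cpow `|t| w * k t - cpow `|t| z * k t - h * ((ln `|t|)%:C * cpow `|t| z * k t).
have -> : cint 0 1 (fun t => cpow `|t| w * k t) - cint 0 1 (fun t => cpow `|t| z * k t)
   - cint 0 1 (fun t => (ln `|t|)%:C * cpow `|t| z * k t) * h = cint 0 1 D.
  rewrite /D [_ * h]mulrC /cint -cintegralZ// -!cintegralB//; try exact: I.
    by apply: cintbleD => //; [exact: I|apply: cintbleN => //; exact: I].
  exact: cintbleZ.
apply: (@le_trans _ _ (K * cmod h ^+ 2 * (1 - 0))).
  apply: le_cmod_cint; [exact: ler01| |].
    move=> y _; apply: ccontB; first by apply: ccontB; exact: c1.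
    by apply: ccontM; [exact: ccont_cst|exact: c2].
  move=> t /andP[t0 t1]; 
  have hh2 : 0 <= cmod h ^+ 2 by exact: sqr_ge0.
  move: t0; rewrite le_eqVlt => /predU1P[<-|t0].
    rewrite /D normr0 !cpow0r ?gt_eqF// !(mulr0, mul0r) !subr0 cmod0.
    by rewrite mulr_ge0// ltW.
  have -> : D t = cpow t z * (expC (h * (ln t)%:C) - 1 - h * (ln t)%:C) * k t.
    by rewrite /D ger0_norm ?(ltW t0)// wE cpowD// [cpow t h]cpowE//; ring.
  have tz := expC_taylor1 (h * (ln t)%:C).
  rewrite 2!cmodM cmod_cpow -/x.
  apply: (@le_trans _ _ (80 / x ^+ 2 * cmod h ^+ 2 * M)).
    apply: ler_pM => //; rewrite ?mulr_ge0 ?powR_ge0 ?cmod_ge0//; last first.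
      by apply: hM; rewrite ltW.
    apply: le_trans (ler_wpM2l (powR_ge0 _ _) tz) _.
    rewrite !cmodM cmodC exprMn.
    have lt := ln_le_powR t0 t1 (divr_gt0 z0 (ltr0n R 4)).
    have ln2 : `|ln t| ^+ 2 <= 16 / x ^+ 2 * t `^ (- (x / 2)).
      apply: (@le_trans _ _ (((x / 4)^-1 * t `^ (- (x / 4))) ^+ 2)).
        by rewrite lerXn2r// nnegrE mulr_ge0 ?powR_ge0// invr_ge0 divr_ge0// ltW.
      have pE : (t `^ (- (x / 4))) ^+ 2 = t `^ (- (x / 2)).
        by rewrite -powR_mulrn ?powR_ge0// -powRrM; congr (_ `^ _); field.
      rewrite exprMn pE.
      rewrite le_eqVlt; apply/orP; left; apply/eqP; field; exact: lt0r_neq0.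
    have ex : expR (cmod h * `|ln t|) <= t `^ (- (x / 4)).
      rewrite /powR gt_eqF// ler_expR ler0_norm ?ln_le0//.
      by rewrite mulrN mulNr lerN2 ler_wnM2r ?ln_le0// ltW.
    have e1 : `|ln t| ^+ 2 * expR (cmod h * `|ln t|) <=
        16 / x ^+ 2 * t `^ (- (x / 2)) * t `^ (- (x / 4)).
      by apply: ler_pM; rewrite ?sqr_ge0 ?expR_ge0.
    apply: (@le_trans _ _ (t `^ x * (5 * cmod h ^+ 2 *
        (16 / x ^+ 2 * t `^ (- (x / 2)) * t `^ (- (x / 4)))))).
      apply: ler_wpM2l; first exact: powR_ge0.
      have -> : 5 * (cmod h ^+ 2 * `|ln t| ^+ 2) * expR (cmod h * `|ln t|) =
        5 * cmod h ^+ 2 * (`|ln t| ^+ 2 * expR (cmod h * `|ln t|)) by ring.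
      by apply: ler_wpM2l => //; rewrite mulr_ge0.
    have tE : t `^ x * t `^ (- (x / 2)) * t `^ (- (x / 4)) <= 1.
      rewrite -!powRD ?(gt_eqF t0) ?implybT//.
      rewrite /powR gt_eqF// expR_le1 mulr_ge0_le0 ?ln_le0//; lra.
    have q0 : 0 <= 80 / x ^+ 2 * cmod h ^+ 2 by rewrite mulr_ge0// divr_ge0// sqr_ge0.
    have := ler_wpM2l q0 tE; rewrite mulr1; apply: le_trans.
    rewrite le_eqVlt; apply/orP; left; apply/eqP; field; exact: lt0r_neq0.
  rewrite mulrAC ler_wpM2r// /K lerDl//.
rewrite subr0 mulr1 expr2 mulrA ler_wpM2r ?cmod_ge0// mulrC -ler_pdivlMr//.
exact: ltW.
Qed.

End Mellin.

(** * Smooth functions of a real variable and the weight (1 + t^2)^{-s} *)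

Section SmoothFunctions.
Variable R : realType.
Implicit Types (f g : R -> R[i]) (x t : R).

Fixpoint Ck n f : Prop := if n is m.+1 then
  exists2 f', (forall x, cderiv f x (f' x)) & Ck m f' else True.

Definition csmooth f := forall n, Ck n f.

Definition cd f : R -> R[i] := fun t =>
  derive1 (fun u => Re (f u)) t +i* derive1 (fun u => Im (f u)) t.

Lemma cdE f f' : (forall x, cderiv f x (f' x)) -> cd f = f'.
Proof.
move=> ff'; apply/funext => t; have [h1 h2] := ff' t.
apply: complex_eq => /=; rewrite derive1E.
- by rewrite (@derive_val _ _ _ _ _ _ _ h1).
- by rewrite (@derive_val _ _ _ _ _ _ _ h2).
Qed.

Lemma csmooth_cderiv f x : csmooth f -> cderiv f x (cd f x).
Proof. by move=> /(_ 1%N)[f' ff' _]; rewrite (cdE ff'). Qed.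

Lemma csmooth_cd f : csmooth f -> csmooth (cd f).
Proof. by move=> sf n; have [f' ff' ?] := sf n.+1; rewrite (cdE ff'). Qed.

Lemma csmooth_cont f x : csmooth f -> ccont f x.
Proof. by move=> /csmooth_cderiv h; apply: cderiv_cont; exact: h. Qed.

Lemma Ck_pred n f : Ck n.+1 f -> Ck n f.
Proof.
elim: n f => [//|n IH] f [f' ff' fn]; exists f' => //; exact: IH.
Qed.

Lemma Ck_cst n c : Ck n (fun=> c).
Proof. by elim: n c => [//|n IH] c; exists (fun=> 0) => // x; exact: cderiv_cst. Qed.

Lemma CkD n f g : Ck n f -> Ck n g -> Ck n (fun t => f t + g t).
Proof.
elim: n f g => [//|n IH] f g [f' ff' fn] [g' gg' gn].
exists (fun t => f' t + g' t); last exact: IH.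
by move=> x; apply: cderivD.
Qed.

Lemma CkM n f g : Ck n f -> Ck n g -> Ck n (fun t => f t * g t).
Proof.
elim: n f g => [//|n IH] f g hf hg.
have [f' ff' fn] := hf; have [g' gg' gn] := hg.
exists (fun t => f' t * g t + f t * g' t).
  by move=> x; apply: cderivM.
by apply: CkD; apply: IH => //; exact: Ck_pred.
Qed.

Lemma Ck_comp_affine n f (a b : R) : Ck n f -> Ck n (fun t => f (a * t + b)).
Proof.
elim: n f => [//|n IH] f [f' ff' fn].
exists (fun t => a%:C * f' (a * t + b)).
  move=> x; apply: (@cderiv_comp _ f (fun t => a * t + b)) => //.
  have D := is_deriveD (is_deriveZ a (is_derive_id x 1)) (is_derive_cst b x 1).
  by apply: (is_derive_eq D); rewrite /GRing.scale /= addr0 mulr1.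
by apply: CkM; [exact: Ck_cst|exact: IH].
Qed.

Lemma Ck_id n : Ck n (fun t => t%:C : R[i]).
Proof.
case: n => [//|n]; exists (fun=> 1); last exact: Ck_cst.
by move=> x; apply: cderiv_real; exact: is_derive_id.
Qed.

Lemma csmooth_cst c : csmooth (fun=> c). Proof. by move=> n; exact: Ck_cst. Qed.
Lemma csmoothD f g : csmooth f -> csmooth g -> csmooth (fun t => f t + g t).
Proof. by move=> hf hg n; exact: CkD. Qed.
Lemma csmoothM f g : csmooth f -> csmooth g -> csmooth (fun t => f t * g t).
Proof. by move=> hf hg n; exact: CkM. Qed.
Lemma csmoothZ c f : csmooth f -> csmooth (fun t => c * f t).
Proof. by apply: csmoothM; exact: csmooth_cst. Qed.
Lemma csmooth_id : csmooth (fun t => t%:C : R[i]).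
Proof. by move=> n; exact: Ck_id. Qed.
Lemma csmooth_comp_affine f (a b : R) :
  csmooth f -> csmooth (fun t => f (a * t + b)).
Proof. by move=> hf n; exact: Ck_comp_affine. Qed.

(** For a unit vector v this is |(t v, 1)|^{-2s} = |(v, t)|^{-2s}. With 2s = lambda_1 + rho_1 it is
    the weight in A^(1) and A^(2), and with 2s = a + b the one that the tangent substitution
    creates. *)
Definition usq (s : R[i]) t : R[i] := cpow (1 + t ^+ 2) (- s).

Lemma usq_gt0 t : 0 < 1 + t ^+ 2. Proof. by rewrite ltr_pwDl// sqr_ge0. Qed.

Lemma cderiv_usq s x :
  cderiv (usq s) x (- 2 * s * (x%:C * usq (s + 1) x)).
Proof.
have D : is_derive x 1 (fun t : R => 1 + t ^+ 2) (2 * x).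
  have D := is_deriveD (is_derive_cst (1:R) x 1) (is_deriveM (is_derive_id x 1) (is_derive_id x 1)).
  by apply: (is_derive_eq D); rewrite /GRing.scale /= mulr1; ring.
have := cderiv_comp D (cderiv_cpow (- s) (usq_gt0 x)).
rewrite /usq (opprD s 1) rmorphM rmorph_nat /=.
by congr cderiv; ring.
Qed.

(** The derivative of [usq s] is a multiple of t [usq (s + 1)], so the induction runs over all s at
    once. *)
Lemma csmooth_usq s : csmooth (usq s).
Proof.
move=> n; elim: n s => [//|n IH] s.
exists (fun t => - 2 * s * (t%:C * usq (s + 1) t)); first exact: cderiv_usq.
apply: CkM; first exact: Ck_cst.
by apply: CkM; [exact: Ck_id|exact: IH].
Qed.

Lemma cderive1nS k f : cderive1n k.+1 f = cderive1n k (cd f).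
Proof. by apply/funext => t; rewrite /cderive1n /cd !derive1Sn. Qed.

Lemma cderive1nSr k f : cderive1n k.+1 f = cd (cderive1n k f).
Proof. by apply/funext => t; rewrite /cderive1n /cd !derive1nS. Qed.

Lemma cderive1n0 f : cderive1n 0 f = f.
Proof. by apply/funext => t; rewrite /cderive1n !derive1n0; case: (f t). Qed.

Lemma csmooth_cderive1n k f : csmooth f -> csmooth (cderive1n k f).
Proof.
by elim: k f => [|k IH] f sf; rewrite ?cderive1n0// cderive1nS; apply/IH/csmooth_cd.
Qed.

Lemma cdD f g : csmooth f -> csmooth g ->
  cd (fun t => f t + g t) = (fun t => cd f t + cd g t).
Proof. by move=> sf sg; apply: cdE => x; apply: cderivD; exact: csmooth_cderiv. Qed.

Lemma cdZ c f : csmooth f -> cd (fun t => c * f t) = (fun t => c * cd f t).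
Proof. by move=> sf; apply: cdE => x; apply: cderivZ; exact: csmooth_cderiv. Qed.

Lemma cdM f g : csmooth f -> csmooth g ->
  cd (fun t => f t * g t) = (fun t => cd f t * g t + f t * cd g t).
Proof. by move=> sf sg; apply: cdE => x; apply: cderivM; exact: csmooth_cderiv. Qed.

Lemma cderive1nD k f g : csmooth f -> csmooth g ->
  cderive1n k (fun t => f t + g t) = (fun t => cderive1n k f t + cderive1n k g t).
Proof.
elim: k f g => [|k IH] f g sf sg; first by rewrite !cderive1n0.
by rewrite !cderive1nS cdD// IH//; exact: csmooth_cd.
Qed.

Lemma cderive1nZ k c f : csmooth f ->
  cderive1n k (fun t => c * f t) = (fun t => c * cderive1n k f t).
Proof.
elim: k f => [|k IH] f sf; first by rewrite !cderive1n0.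
by rewrite !cderive1nS cdZ// IH//; exact: csmooth_cd.
Qed.

Lemma cderive1n_scale k (a : R) f : csmooth f ->
  cderive1n k (fun t => f (a * t)) = (fun t => a%:C ^+ k * cderive1n k f (a * t)).
Proof.
elim: k f => [|k IH] f sf.
  by rewrite !cderive1n0; apply/funext => t; rewrite mul1r.
rewrite !cderive1nS (_ : cd _ = (fun t => a%:C * cd f (a * t))); last first.
  apply: cdE => x; apply: (@cderiv_comp _ f (fun t => a * t)); last exact: csmooth_cderiv.
  have D := is_deriveZ a (is_derive_id x 1).
  by apply: (is_derive_eq D); rewrite /GRing.scale /= mulr1.
rewrite cderive1nZ; last first.
  have := csmooth_comp_affine a 0 (csmooth_cd sf).
  by under eq_fun do rewrite addr0.
by rewrite IH; [apply/funext => t; rewrite exprS mulrA|exact: csmooth_cd].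
Qed.

(** Differentiating once produces the factor -2 s, the shift s + 1 and a new psi, and at t = 0 the
    weight is 1; the value is in fact a polynomial in s. *)
Lemma holo_cderive1n_usq k (psi : R -> R[i]) z : csmooth psi ->
  holoat (fun s => cderive1n k (fun t => usq s t * psi t) 0) z.
Proof.
elim: k psi z => [|k IH] psi z sp.
  apply: eq_holo (holo_cst (psi 0) z) => s.
  by rewrite cderive1n0 /usq expr0n /= addr0 cpow1l mul1r.
have stp : csmooth (fun t => t%:C * psi t) by apply: csmoothM => //; exact: csmooth_id.
have E s : cderive1n k.+1 (fun t => usq s t * psi t) 0 =
    cderive1n k (fun t => usq s t * cd psi t) 0 +
    (- 2 * s) * cderive1n k (fun t => usq (s + 1) t * (t%:C * psi t)) 0.
  rewrite cderive1nS cdM//; last exact: csmooth_usq.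
  rewrite (cdE (cderiv_usq s)).
  have -> : (fun t => - 2 * s * (t%:C * usq (s + 1) t) * psi t + usq s t * cd psi t) =
    (fun t => usq s t * cd psi t + (- 2 * s) * (usq (s + 1) t * (t%:C * psi t))).
    by apply/funext => t; ring.
  rewrite cderive1nD; last 2 first.
  - by apply: csmoothM; [exact: csmooth_usq|exact: csmooth_cd].
  - by apply/csmoothZ/csmoothM => //; exact: csmooth_usq.
  by rewrite cderive1nZ//; apply: csmoothM => //; exact: csmooth_usq.
apply: eq_holo (fun s => esym (E s)) _.
apply: holoD; first by apply: IH; exact: csmooth_cd.
apply: holoM; first by apply: holoZ; exact: holo_id.
exact: (holo_shift (f := fun s => cderive1n k (fun t => usq s t * (t%:C * psi t)) 0) (IH _ _ stp)).
Qed.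

End SmoothFunctions.

(** * Integration by parts for truncated Mellin transforms *)

Section MellinResidue.
Variable R : realType.
Implicit Types (f g : R -> R[i]) (x t : R) (a z w s : R[i]).

(** [FTC] asks for two-sided derivatives at the end points. With |t| in place of t, Re w > 1 makes
    the power differentiable at 0 too, with derivative 0. *)
Lemma cderiv_cpow_norm x w : 1 < Re w -> 0 <= x ->
  cderiv (fun t => cpow `|t| w) x (w * cpow `|x| (w - 1)).
Proof.
move=> w1; rewrite le_eqVlt => /predU1P[<-|x0].
  rewrite normr0 cpow0r ?mulr0; last by rewrite ReB /= gt_eqF// subr_gt0.
  have H (u : R -> R) : (forall t, `|u t| <= `|t| `^ Re w) ->
      is_derive (0 : R) (1 : R) u 0.
    move=> hu; have u0 : u 0 = 0.
      have := hu 0; rewrite normr0 powR0 ?normr_le0; first by move/eqP.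
      by rewrite gt_eqF// (lt_trans _ w1).
    have L : h^-1 *: ((u \o shift 0) (h *: 1) - u 0) @[h --> 0^'] --> (0 : R).
      apply/cvgrPdist_lt => e e0.
      have w10 : 0 < Re w - 1 by rewrite subr_gt0.
      have [d d0 hd] := powR_small w10 e0.
      near=> h; rewrite sub0r normrN u0 subr0 /= addr0 /GRing.scale /= mulr1.
      have h0 : h != 0 by near: h; exact: nbhs_dnbhs_neq.
      have nh : 0 < `|h| by rewrite normr_gt0.
      rewrite normrM normfV; apply: (@le_lt_trans _ _ (`|h| `^ (Re w - 1))).
        rewrite mulrC ler_pdivrMr// -[X in _ * X]powRr1 ?normr_ge0// -powRD.
          by rewrite subrK.
        by rewrite normr_eq0 h0 implybT.
      apply: hd; rewrite normr_ge0 /=.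
      near: h; apply/nbhs_ballP; exists d => //= h.
      by rewrite /ball /= sub0r normrN => + _.
    apply: DeriveDef; first by apply/cvg_ex; exists 0.
    exact: cvg_lim L.
  split; apply: H => t; rewrite (le_trans _ (_ : cmod (cpow `|t| w) <= _)) ?ler_Re_cmod ?ler_Im_cmod//;
  by rewrite cmod_cpow.
have H := cderiv_cpow w x0; have xn : `|x| = x by rewrite gtr0_norm.
have N : \forall t \near x, cpow t w = cpow `|t| w.
  by near=> t; rewrite gtr0_norm//; near: t; exact: lt_nbhsr.
rewrite xn; case: H => h1 h2; split.
- by apply: near_eq_is_derive h1; near=> t; rewrite -(near N t).
- by apply: near_eq_is_derive h2; near=> t; rewrite -(near N t).
Unshelve. all: by end_near.
Qed.

(** Meant for 1 < Re a, where the integrand is continuous at 0; other a are reached by integrating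
    by parts. *)
Definition mellin f a : R[i] := cint 0 1 (fun t => cpow `|t| (a - 1) * f t).

Lemma holo_mellin1 f a : csmooth f -> 1 < Re a -> holoat (mellin f) a.
Proof.
move=> sf a1; apply: (holo_shift (f := fun a => cint 0 1 (fun t => cpow `|t| a * f t)) (b := -1)).
apply: holo_mellin; first by move=> x; exact: csmooth_cont.
by rewrite ReB /= subr_gt0.
Qed.

Lemma mellin_parts f a : csmooth f -> 1 < Re a ->
  a * mellin f a = f 1 - mellin (cd f) (a + 1).
Proof.
move=> sf a1.
have a10 : 0 < Re (a - 1) by rewrite ReB /= subr_gt0.
have a0 : 0 < Re a by apply: lt_trans a1.
have := @FTC R (fun t => cpow `|t| a * f t)
  (fun t => a * (cpow `|t| (a - 1) * f t) + cpow `|t| (a + 1 - 1) * cd f t) 0 1 ler01.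
have c1 x : ccont (fun t => cpow `|t| (a - 1) * f t) x.
  by apply: ccontM; [exact: ccont_cpow_norm|exact: csmooth_cont].
have c2 x : ccont (fun t => cpow `|t| (a + 1 - 1) * cd f t) x.
  by apply: ccontM; [apply: ccont_cpow_norm; rewrite addrK|exact/csmooth_cont/csmooth_cd].
have c3 x : ccont (fun t => a * (cpow `|t| (a - 1) * f t)) x.
  by apply: ccontM => //; exact: ccont_cst.
move=> /(_ _ (fun x _ => ccontD (c3 x) (c2 x))) H.
rewrite /mellin; move: H; rewrite normr0 normr1 cpow1l cpow0r ?gt_eqF// mul1r mul0r subr0.
rewrite /cint cintegralD//; try exact: ccont_cintble.
rewrite cintegralZ//; last exact: ccont_cintble.
move=> <-; first by rewrite addrK.
move=> x /andP[x0 _]; rewrite addrK mulrA.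
by apply: cderivM; [exact: cderiv_cpow_norm|exact: csmooth_cderiv].
Qed.

(** The boundary terms at t = 1 of m integrations by parts, multiplied by a (a + 1) ... (a + m - 1);
    a polynomial in a. *)
Fixpoint mboundary f m a : R[i] := if m is k.+1 then
  (a + k%:R) * mboundary f k a + (-1) ^+ k * cderive1n k f 1 else 0.

Lemma mellin_parts_iter f m a : csmooth f -> 1 < Re a ->
  \prod_(i < m) (a + i%:R) * mellin f a =
  mboundary f m a + (-1) ^+ m * mellin (cderive1n m f) (a + m%:R).
Proof.
move=> sf a1; elim: m => [|m IH]; first by rewrite big_ord0 add0r addr0 cderive1n0 expr0.
rewrite big_ord_recr /= mulrAC IH exprS.
have := @mellin_parts (cderive1n m f) (a + m%:R) (csmooth_cderive1n m sf).
rewrite -cderive1nSr -natr1 addrA ReD Re_nat ltr_wpDr// => /(_ isT) h.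
by rewrite mulrDl [X in _ + X]mulrAC -[X in _ + X]mulrA (mulrC _ (a + _)) h; ring.
Qed.

Lemma holo_mboundary f m a : holoat (mboundary f m) a.
Proof.
elim: m => [|m IH]; first exact: holo_cst.
apply: holoD; last exact: holo_cst.
by apply: holoM => //; apply: holoD; [exact: holo_id|exact: holo_cst].
Qed.

(** At a = -m the factor a + m removes all boundary terms but the last two. With g the m-th
    derivative of f, what remains is the integral of t g'', that is g'(1) - g(1) + g(0), and all but
    g(0) cancels. Integrating m + 2 times puts the exponent at 2, inside the region Re > 1. *)
Lemma mellin_pole f m : csmooth f ->
  mboundary f m.+2 (- m%:R) + (-1) ^+ m.+2 * mellin (cderive1n m.+2 f) (- m%:R + m.+2%:R)
  = (-1) ^+ m * cderive1n m f 0.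
Proof.
move=> sf /=.
have -> : - m%:R + m.+2%:R = 2 :> R[i] by rewrite -addn2 natrD; ring.
have sm := csmooth_cderive1n m sf; set g := cderive1n m f in sm *.
have -> : cderive1n m.+2 f = cd (cd g) by rewrite !cderive1nSr.
have -> : cderive1n m.+1 f = cd g by rewrite !cderive1nSr.
have -> : mellin (cd (cd g)) 2 = cd g 1 - (g 1 - g 0).
  rewrite /mellin -(@FTC R g (cd g) 0 1 ler01); last 2 first.
  - by move=> x _; exact: csmooth_cderiv.
  - by move=> x _; exact/csmooth_cont/csmooth_cd.
  have ssm := csmooth_cd sm; have sssm := csmooth_cd ssm.
  have -> : cint 0 1 (fun t => cpow `|t| (2 - 1) * cd (cd g) t) =
     cint 0 1 (fun t => 1 * cd g t + t%:C * cd (cd g) t - cd g t).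
    apply: eq_cint => t /andP[t0 _].
    rewrite (_ : 2 - 1 = 1 :> R[i]); last by ring.
    by rewrite cpowr1// ger0_norm//; ring.
  rewrite /cint cintegralB//; last 2 first.
  - apply: ccont_cintble => x _; apply: ccontD.
      by apply: ccontM; [exact: ccont_cst|exact: csmooth_cont].
    by apply: ccontM; [exact/csmooth_cont/csmooth_id|exact: csmooth_cont].
  - by apply: ccont_cintble => x _; exact: csmooth_cont.
  rewrite -/(cint _ _ _) (@FTC R (fun t => t%:C * cd g t) _ 0 1 ler01).
  - by rewrite mul1r mul0r subr0.
  - move=> x _; apply: cderivM; last exact: csmooth_cderiv.
    by apply: cderiv_real; exact: is_derive_id.
  - move=> x _; apply: ccontD.
      by apply: ccontM; [exact: ccont_cst|exact: csmooth_cont].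
    by apply: ccontM; [exact/csmooth_cont/csmooth_id|exact: csmooth_cont].
rewrite -natr1 !exprS; ring.
Qed.

End MellinResidue.

(** * The residue of the Mellin transform against the zero of 1/Gamma *)

Section MellinValue.
Variable R : realType.
Hypothesis rG : forall z, holoat (@rGamma R) z.
Implicit Types (f g : R -> R[i]) (a s z : R[i]).

Lemma rGamma_recT z : rGamma z = z * rGamma (z + 1).
Proof.
apply: (@entire_identity R (@rGamma R) (fun z => z * rGamma (z + 1)) 0) => // [w|w w0].
  by apply: holoM; [exact: holo_id|exact: (holo_shift (f := @rGamma R) (b := 1))].
exact: rGamma_rec.
Qed.

Lemma rGamma_prod z m : rGamma z = \prod_(k < m) (z + k%:R) * rGamma (z + m%:R).
Proof.
elim: m => [|m IH]; first by rewrite big_ord0 addr0 mul1r.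
by rewrite IH big_ord_recr /= -mulrA rGamma_recT -natr1 addrA.
Qed.

Lemma rGamma1 : rGamma (1 : R[i]) = 1.
Proof. by rewrite rGammaE ?Gamma1 ?invr1//= ltr01. Qed.

(** The product is (-1)^j (2j - 1)!!, its last factor being 1, and (2j)! = (2j - 1)!! 2^j j!. *)
Lemma odd_prod j : \prod_(k < j.+1) (- (2 * j)%:R + (2 * k)%:R + 1) *
  (-1) ^+ j * j`!%:R * 2 ^+ j = (2 * j)`!%:R :> R[i].
Proof.
elim: j => [|j IH]; first by rewrite big_ord_recl big_ord0 /= !mulr0n; ring.
rewrite big_ord_recl /=.
have -> : \prod_(i < j.+1) (- (2 * j.+1)%:R + (2 * bump 0 i)%:R + 1) =
  \prod_(k < j.+1) (- (2 * j)%:R + (2 * k)%:R + 1) :> R[i].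
  apply: eq_bigr => i _; rewrite /bump /= add1n !mulnS !natrD; ring.
rewrite (_ : (2 * j.+1)`! = (2 * j).+2 * ((2 * j).+1 * (2 * j)`!))%N; last first.
  by rewrite mulnS !factS.
rewrite !natrM -IH ?factS ?natrM !exprS ?muln0 ?mulr0n.
rewrite -[(2 * j).+2]addn2 -[(2 * j).+1]addn1 -[j.+1]addn1 !(natrD, natrM, mulnDr); ring.
Qed.

(** Even indices give a + 2k = 2 (a/2 + k), which are the factors that the recursion of 1/Gamma(a/2)
    supplies; odd indices give the second product. *)
Lemma prod_split j a : \prod_(i < (2 * j).+2) (a + i%:R) =
  2 ^+ j.+1 * \prod_(k < j.+1) (a / 2 + k%:R) *
  \prod_(k < j.+1) (a + (2 * k)%:R + 1).
Proof.
elim: j => [|j IH].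
  by rewrite !big_ord_recl !big_ord0 /= /bump /= !mulr0n; field.
rewrite (_ : (2 * j.+1).+2 = (2 * j).+2.+2)%N; last by rewrite mulnS.
rewrite 2!big_ord_recr /= IH.
rewrite [X in _ = _ * X * _]big_ord_recr [X in _ = _ * X]big_ord_recr /= [in RHS]exprS.
rewrite -[(2 * j).+3]addn3 -[(2 * j).+2]addn2 -[j.+1]addn1 !(natrD, natrM, mulnDr).
by field.
Qed.

(* X continues rG(a/2) rG(s - a/2) (M_f(a) + M_g(2s - a)) to the left.  At
   a = - 2j the zero of rG(a/2) kills the M_g term and meets the pole of M_f,
   whose residue is f^(2j)(0) / (2j)!. *)
Lemma mellin_value (X : R[i] -> R[i]) f g s j : csmooth f -> csmooth g ->
  2 < Re s -> (forall a, holoat X a) ->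
  (forall a, 1 < Re a -> 1 < Re (2 * s - a) ->
    X a = rGamma (a / 2) * rGamma ((2 * s - a) / 2) *
          (mellin f a + mellin g (2 * s - a))) ->
  X (- (2 * j)%:R) = (-1) ^+ j * (j`!%:R / (2 * j)`!%:R) *
    rGamma ((2 * s + (2 * j)%:R) / 2) * (cderive1n (2 * j) f 0 / 2).
Proof.
move=> sf sg s2 hX XE.
pose m := (2 * j)%N.
pose Q a : R[i] := \prod_(k < j.+1) (a + (2 * k)%:R + 1).
pose P a : R[i] := \prod_(i < m.+2) (a + i%:R).
pose M a := mboundary f m.+2 a + (-1) ^+ m.+2 * mellin (cderive1n m.+2 f) (a + m.+2%:R).
(* X is multiplied by the odd factors [Q] only, since the even ones come from [rGamma_prod] at a/2.
   Thus W has no poles, and Q(-2j), being nonzero, can be divided out at the end. *)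
pose W a := Q a * X a - (2 ^+ j.+1)^-1 * (rGamma ((2 * s - a) / 2) *
   rGamma (a / 2 + j.+1%:R) * (M a + P a * mellin g (2 * s - a))).
have two0 : (2 ^+ j.+1 : R[i]) != 0 by rewrite expf_neq0// pnatr_eq0.
have PE a : P a = 2 ^+ j.+1 * \prod_(k < j.+1) (a / 2 + k%:R) * Q a by exact: prod_split.
have Rs2 : Re (2 * s) = 2 * Re s by rewrite ReM Re_nat Im_nat mul0r subr0.
have W0 a : 1 < Re a < 2 -> W a = 0.
  move=> /andP[a1 a2]; have b1 : 1 < Re (2 * s - a) by rewrite ReB Rs2; lra.
  rewrite /W XE// /M -mellin_parts_iter// -/(P a) -mulrDr.
  rewrite (rGamma_prod (a / 2) j.+1) PE; field; exact: two0.
(* The lower bound keeps a + m + 2 in the region Re > 1; the upper bound does so for 2s - a, as Re s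
   > 2. *)
have hW a : - m%:R - 1 < Re a -> Re a < 2 -> holoat W a.
  move=> a1 a2.
  have hprod (c : nat -> R[i]) n : holoat (fun a => \prod_(k < n) (a + c k)) a.
    apply: (@holo_prod _ _ _ (fun (k : 'I_n) a => a + c k)) => k.
    by apply: holoD; [exact: holo_id|exact: holo_cst].
  have hb : 1 < Re (2 * s - a) by rewrite ReB Rs2; lra.
  have refl h c d z : holoat h (c * z + d) -> holoat (fun w => h (c * w + d)) z.
    exact: holo_affine.
  apply: holoB.
    apply: holoM => //.
    have := hprod (fun k => (2 * k)%:R + 1) j.+1; apply: eq_holo => w.
    by rewrite /Q; apply: eq_bigr => k _; rewrite addrA.
  apply: holoZ; apply: holoM.
    apply: holoM.
      have := @refl (@rGamma R) (- 2^-1) s a (rG _); apply: eq_holo => w.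
      by congr rGamma; field.
    have := @refl (@rGamma R) 2^-1 j.+1%:R a (rG _); apply: eq_holo => w.
    by congr rGamma; rewrite mulrC.
  apply: holoD.
    apply: holoD; first exact: holo_mboundary.
    apply: holoZ; apply: (holo_shift (f := mellin _)).
    apply: holo_mellin1; first exact: csmooth_cderive1n.
    rewrite ReD Re_nat -addn2 natrD; lra.
  apply: holoM; first exact: hprod.
  have := @refl (mellin g) (-1) (2 * s) a; rewrite mulN1r addrC => h.
  have := h (holo_mellin1 sg hb); apply: eq_holo => w.
  by rewrite mulN1r addrC.
have Rm : Re (- m%:R : R[i]) = - m%:R by rewrite ReN Re_nat.
have : W (- m%:R) = 0.
  apply: (@strip_identity R W (- m%:R - 1) 1 2) => //.
  - by rewrite ltr1n.
  - by rewrite Rm gtrBl.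
  - by rewrite Rm; apply: (@le_lt_trans _ _ 0); rewrite ?oppr_le0.
have P0 : P (- m%:R) = 0.
  have hm : (m < m.+2)%N by rewrite ltnS leqnSn.
  by rewrite /P (bigD1 (Ordinal hm)) //= addNr mul0r.
rewrite /W P0 mul0r addr0 /M mellin_pole//.
(* At a = -2j the argument a/2 + j + 1 is 1, so this reciprocal Gamma factor drops out. *)
have -> : - m%:R / 2 + j.+1%:R = 1 :> R[i].
  by rewrite /m natrM -natr1; field.
rewrite rGamma1 mulr1 opprK -[(-1) ^+ m]signr_odd /m oddM /= expr0 mul1r.
move=> /eqP; rewrite subr_eq0 => /eqP H.
have OP := odd_prod j; rewrite -/(Q _) in OP.
have F0 : (2 * j)`!%:R != 0 :> R[i] by rewrite pnatr_eq0 -lt0n fact_gt0.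
have Q0 : Q (- (2 * j)%:R) != 0.
  by apply/eqP => q0; move: F0; rewrite -OP q0 !mul0r eqxx.
apply: (mulfI Q0); rewrite H -OP exprS.
have J0 : j`!%:R != 0 :> R[i] by rewrite pnatr_eq0 -lt0n fact_gt0.
have S0 : (-1) ^+ j != 0 :> R[i] by rewrite signr_eq0.
have T0 : 2 ^+ j != 0 :> R[i] by rewrite expf_neq0// pnatr_eq0.
move: ((-1) ^+ j) j`!%:R (2 ^+ j) (Q _) (rGamma _) (cderive1n _ _ _) S0 J0 T0 Q0 => x1 x2 x3 x4 x5 x6 S0 J0 T0 Q0.
by field; rewrite J0 Q0 S0 T0.
Qed.

End MellinValue.

(** * Functions on projective space *)

Section ProjectiveCharts.
Variable R : realType.

Lemma mx_continuous (T : topologicalType) m n (f : T -> 'M[R]_(m, n)) (x : T) :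
  (forall i j, {for x, continuous (fun t => f t i j)}) -> {for x, continuous f}.
Proof.
move=> cf A [P hP PA]; apply: filterS (fun t => PA (f t)) _.
apply: filter_forall => i; apply: filter_forall => j.
exact: (cf i j _ (hP i j)).
Qed.

Lemma at_line_scale m (f : P R m -> R[i]) (c : R) (x : 'rV[R]_m) : c != 0 ->
  at_line f (c *: x) = at_line f x.
Proof.
move=> c0; rewrite /at_line (_ : <[c *: x]>%VS = <[x]>%VS)//.
apply/eqP; rewrite eqEsubv -!memvE memvZ ?memv_line//=.
by rewrite -[x in x \in _](scalerK c0) memvZ// memv_line.
Qed.

Lemma at_line_opp m (f : P R m -> R[i]) (x : 'rV[R]_m) : at_line f (- x) = at_line f x.
Proof. by rewrite -scaleN1r at_line_scale// oppr_eq0 oner_eq0. Qed.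

Lemma insert_at m (i : 'I_m) (t : R) (u : 'rV[R]_m.-1) : insert i t u 0 i = t.
Proof. by rewrite mxE unlift_none. Qed.

Lemma insert_lift m (i : 'I_m) (t : R) (u : 'rV[R]_m.-1) l : insert i t u 0 (lift i l) = u 0 l.
Proof. by rewrite mxE liftK. Qed.

Lemma insert_chart m (i : 'I_m) (x : 'rV[R]_m) : x 0 i != 0 ->
  x = x 0 i *: insert i 1 (\row_l (x 0 (lift i l) / x 0 i)).
Proof.
move=> xi; apply/rowP => k; rewrite !mxE; case: unliftP => [l ->|->].
- by rewrite mxE mulrCA divff ?mulr1.
- by rewrite mulr1.
Qed.

Lemma at_line_chart m (f : P R m -> R[i]) (i : 'I_m) (x : 'rV[R]_m) : x 0 i != 0 ->
  at_line f x = at_line f (insert i 1 (\row_l (x 0 (lift i l) / x 0 i))).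
Proof. by move=> xi; rewrite [in LHS](insert_chart xi) at_line_scale. Qed.

Lemma neq0_coord m (x : 'rV[R]_m) : x != 0 -> exists i, x 0 i != 0.
Proof.
move=> x0; apply: contrapT => no; move/eqP: x0; apply; apply/rowP => i.
by rewrite mxE; apply/eqP; apply: contrapT => /negP xi; apply: no; exists i.
Qed.

Lemma smooth_continuous m (h : 'rV[R]_m -> R) : smooth h ->
  forall x, {for x, continuous h}.
Proof. by move=> /(_ [::]) hd x; exact/differentiable_continuous/hd. Qed.
Arguments smooth_continuous {m h} _ _.

(** A coordinate that is nonzero at x stays nonzero nearby, so a single affine chart describes f
    along u close to x. *)
Lemma at_line_ccont m (f : Cinfty R m) (u : R -> 'rV[R]_m) (x : R) :
  (forall i, {for x, continuous (fun t => u t 0 i)}) -> u x != 0 ->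
  ccont (fun t => at_line f (u t)) x.
Proof.
move=> cu /neq0_coord[i ui].
pose v t : 'rV[R]_m.-1 := \row_l (u t 0 (lift i l) / u t 0 i).
have cv : {for x, continuous v}.
  apply: mx_continuous => k l; rewrite (_ : (fun t => v t k l) = (fun t => u t 0 (lift i l) / u t 0 i)).
    by apply: continuousM => //; apply: continuousV.
  by apply/funext => t; rewrite mxE.
have [s1 s2] := Cinfty_smooth f i.
have near_ui : \forall t \near x, u t 0 i != 0.
  exact: (cvgr_neq0 (u x 0 i) (cu i) ui).
have N : \forall t \near x, at_line f (insert i 1 (v t)) = at_line f (u t).
  by apply: filterS near_ui => t uti; rewrite -at_line_chart.
have c1 := @continuous_comp _ _ _ v (fun w => Re (at_line f (insert i 1 w))) x cv (smooth_continuous s1 (v x)).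
have c2 := @continuous_comp _ _ _ v (fun w => Im (at_line f (insert i 1 w))) x cv (smooth_continuous s2 (v x)).
split.
- rewrite /prop_for /continuous_at -(nbhs_singleton N).
  apply: cvg_trans c1; apply: near_eq_cvg.
  by apply: filterS N => t /= ->.
- rewrite /prop_for /continuous_at -(nbhs_singleton N).
  apply: cvg_trans c2; apply: near_eq_cvg.
  by apply: filterS N => t /= ->.
Qed.

Lemma is_derive_line m (h : 'rV[R]_m -> R) (p v : 'rV[R]_m) (t : R) :
  differentiable h (p + t *: v) ->
  is_derive t (1 : R) (fun t => h (p + t *: v)) ('D_v h (p + t *: v)).
Proof.
move=> dh; have := @diff_derivable _ _ _ h (p + t *: v) v dh; rewrite /derivable => ch.
have E : (fun e : R => e^-1 *: (((fun t => h (p + t *: v)) \o shift t) (e *: (1 : R)) - h (p + t *: v))) =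
  (fun e : R => e^-1 *: ((h \o shift (p + t *: v)) (e *: v) - h (p + t *: v))).
  apply/funext => e /=; congr (_ *: (h _ - _)).
  by have -> : e *: (1 : R) = e := mulr1 e; rewrite scalerDl addrCA.
by apply: DeriveDef; rewrite /derivable /derive E.
Qed.

(** Along the line the derivative is the directional derivative in [v], which is smooth again; hence
    an induction over all pairs of smooth functions. *)
Lemma csmooth_line m (hr hi : 'rV[R]_m -> R) (p v : 'rV[R]_m) :
  smooth hr -> smooth hi ->
  csmooth (fun t => hr (p + t *: v) +i* hi (p + t *: v)).
Proof.
move=> sr si n; elim: n hr hi sr si => [//|n IH] hr hi sr si.
exists (fun t => 'D_v hr (p + t *: v) +i* 'D_v hi (p + t *: v)).
  by move=> t; split; apply: is_derive_line; [exact: (sr [::])|exact: (si [::])].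
have sD h : smooth h -> smooth ('D_v h).
  by move=> sh s x; have := sh (rcons s v) x; rewrite foldr_rcons.
by apply: (IH ('D_v hr) ('D_v hi)); exact: sD.
Qed.

Lemma csmooth_chart_line m (f : Cinfty R m) (i : 'I_m) (p v : 'rV[R]_m.-1) :
  csmooth (fun t => at_line f (insert i 1 (p + t *: v))).
Proof.
have [s1 s2] := Cinfty_smooth f i.
have := csmooth_line p v s1 s2.
by congr csmooth; apply/funext => t; case: (at_line _ _).
Qed.

(** Coordinate i is constant along the line, so one chart covers it, and in that chart the line is
    affine. *)
Lemma csmooth_line_at m (f : Cinfty R m) (q w : 'rV[R]_m) (i : 'I_m) :
  q 0 i != 0 -> w 0 i = 0 -> csmooth (fun t => at_line f (q + t *: w)).
Proof.
move=> qi wi.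
pose p : 'rV[R]_m.-1 := \row_l (q 0 (lift i l) / q 0 i).
pose v : 'rV[R]_m.-1 := \row_l (w 0 (lift i l) / q 0 i).
have := csmooth_chart_line f i p v; congr csmooth; apply/funext => t.
have E : (q + t *: w) 0 i = q 0 i by rewrite !mxE wi mulr0 addr0.
rewrite [RHS](@at_line_chart _ f i) ?E//; congr (at_line f (insert i 1 _)).
by apply/rowP => l; rewrite !mxE mulrDl mulrA.
Qed.

Lemma snoc_last m (u : 'rV[R]_m) t : snoc u t 0 ord_max = t.
Proof. exact: insert_at. Qed.

Lemma snoc_lift m (u : 'rV[R]_m) t l : snoc u t 0 (lift ord_max l) = u 0 l.
Proof. exact: (@insert_lift m.+1 ord_max t u l). Qed.

Lemma snoc_eqP m (x y : 'rV[R]_m.+1) : x 0 ord_max = y 0 ord_max ->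
  (forall l : 'I_m, x 0 (lift ord_max l) = y 0 (lift ord_max l)) -> x = y.
Proof.
move=> h1 h2; apply/rowP => k; case: (unliftP ord_max k) => [l ->|->] //.
Qed.

Lemma snocZ m (u : 'rV[R]_m) t (c : R) : snoc (c *: u) (c * t) = c *: snoc u t.
Proof.
apply: snoc_eqP; first by rewrite [RHS]mxE !snoc_last.
by move=> l; rewrite [RHS]mxE !snoc_lift mxE.
Qed.

Lemma snoc_neq0 m (u : 'rV[R]_m) t : (u != 0) || (t != 0) -> snoc u t != 0.
Proof.
move=> ut; apply/eqP => s0; move: ut; rewrite -(snoc_last u t) s0 mxE eqxx orbF => /eqP; apply.
by apply/rowP => l; rewrite -(snoc_lift u t) s0 !mxE.
Qed.

End ProjectiveCharts.

(** * The operator A *)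

Section CircleIntegral.
Variable R : realType.
Implicit Types (a b z : R[i]) (K : R -> R[i]) (t : R).

Lemma sin_cos_neq0 t : (sin t != 0) || (cos t != 0).
Proof.
rewrite -negb_and; apply/negP => /andP[/eqP s0 /eqP c0]; have := cos2Dsin2 t.
by rewrite s0 c0 expr0n addr0 => /eqP; rewrite eq_sym oner_eq0.
Qed.

Definition trigw a b t : R[i] := cpow `|sin t| (a - 1) * cpow `|cos t| (b - 1).

Lemma cont_sub (c t : R) : {for t, continuous (fun x : R => c - x)}.
Proof. by apply: continuousB; [exact: cst_continuous|exact: cvg_id]. Qed.

Lemma ccont_abs_pow (u : R -> R) z t : {for t, continuous u} -> 0 < Re z ->
  ccont (fun x => cpow `|u x| z) t.
Proof.
move=> cu z0; exact: (ccont_comp (f := fun x => cpow `|x| z) cu (ccont_cpow_norm _ z0)).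
Qed.

Lemma Re_sub1_gt0 a : 1 < Re a -> 0 < Re (a - 1).
Proof. by move=> a1; rewrite ReB /= subr_gt0. Qed.

Lemma ccont_trigw a b t : 1 < Re a -> 1 < Re b -> ccont (trigw a b) t.
Proof.
move=> a1 b1; apply: ccontM.
- by apply: ccont_abs_pow; [exact: continuous_sin|exact: Re_sub1_gt0].
- by apply: ccont_abs_pow; [exact: continuous_cos|exact: Re_sub1_gt0].
Qed.

Lemma sin_pi_sub t : sin (pi - t) = sin t.
Proof. by rewrite sinB sinpi cospi mul0r mulN1r opprK add0r. Qed.
Lemma cos_pi_sub t : cos (pi - t) = - cos t.
Proof. by rewrite cosB sinpi cospi mul0r addr0 mulN1r. Qed.
Lemma sin_pihalf_sub t : sin (pi / 2 - t) = cos t.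
Proof. by rewrite sinB sin_pihalf cos_pihalf mul0r subr0 mul1r. Qed.
Lemma cos_pihalf_sub t : cos (pi / 2 - t) = sin t.
Proof. by rewrite cosB sin_pihalf cos_pihalf mul0r add0r mul1r. Qed.

Lemma cint_halfcircle (F : R -> R[i]) : (forall t, ccont F t) ->
  (forall t, F (pi - t) = F t) -> cint 0 pi F = 2 * cint 0 (pi / 2) F.
Proof.
move=> cF FE; have p0 : 0 <= pi / 2 :> R by rewrite divr_ge0// pi_ge0.
rewrite (@cint_split _ 0 pi (pi / 2))//; last by have := pi_ge0 R; lra.
have -> : cint (pi / 2) pi F = cint 0 (pi / 2) F.
  have := @cint_reflect R F 0 (pi / 2) pi p0 cF.
  rewrite subr0 (_ : pi - pi / 2 = pi / 2); last by field.
  by move=> ->; apply: eq_cint => t _.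
ring.
Qed.

(** With t the tangent of the angle, the trigonometric weight becomes t^{a-1} (1 + t^2)^{-(a+b-2)/2}
    and the Jacobian adds (1 + t^2)^{-1}. Stopping at pi/4 keeps t in [0, 1]. *)
Lemma cint_tan a b K : 1 < Re a -> 1 < Re b -> (forall t, ccont K t) ->
  cint 0 (pi / 4) (fun t => trigw a b t * K t) =
  mellin (fun t => usq ((a + b) / 2) t * K (atan t)) a.
Proof.
move=> a1 b1 cK.
have := @cint_subst_incr R (@atan R) (fun t => (1 + t ^+ 2)^-1) (fun t => trigw a b t * K t)
  0 1 ler01.
rewrite atan0 atan1 => ->.
- apply: eq_cint => t /andP[t0 t1].
  have a10 := Re_sub1_gt0 a1.
  move: t0; rewrite le_eqVlt => /predU1P[<-|t0].
    by rewrite /trigw atan0 sin0 normr0 cpow0r ?gt_eqF// !(mulr0, mul0r).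
  rewrite [LHS]mulrA [RHS]mulrA; congr (_ * _).
  set u := 1 + t ^+ 2; have u0 : 0 < u := usq_gt0 t.
  have su0 : 0 < Num.sqrt u by rewrite sqrtr_gt0.
  have c0 : 0 < cos (atan t) by rewrite cos_atan invr_gt0.
  have sE : sin (atan t) = t * cos (atan t).
    by rewrite -{2}(atanK t) /tan divfK// gt_eqF.
  rewrite /trigw sE !gtr0_norm ?mulr_gt0//.
  rewrite cpowMl// -[cpow t _ * _ * _]mulrA -cpowD// [LHS]mulrCA; congr (_ * _).
  rewrite cos_atan cpowVl// cpow_sqrt// /usq -/u.
  have -> : (u^-1)%:C = cpow u (-1) by rewrite cpowN// cpowr1 ?(ltW u0)// fmorphV.
  by rewrite -cpowD//; congr cpow; field.
- by move=> x y _ xy _; exact: lt_atan.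
- exact: continuous_oneDsqrV.
- by move=> x _; apply: ccontM; [exact: ccont_trigw|exact: cK].
Qed.

(** The symmetry t -> pi - t folds the integral to [0, pi/2]; reflecting its second half at pi/4
    exchanges sine and cosine, hence a and b. *)
Lemma cint_trigw a b K : 1 < Re a -> 1 < Re b -> (forall t, ccont K t) ->
  (forall t, K (pi - t) = K t) ->
  cint 0 pi (fun t => trigw a b t * K t) =
  2 * (mellin (fun t => usq ((a + b) / 2) t * K (atan t)) a +
       mellin (fun t => usq ((a + b) / 2) t * K (pi / 2 - atan t)) b).
Proof.
move=> a1 b1 cK KE.
have cF t : ccont (fun t => trigw a b t * K t) t.
  by apply: ccontM; [exact: ccont_trigw|exact: cK].
rewrite cint_halfcircle//; last first.
  by move=> t; rewrite KE /trigw sin_pi_sub cos_pi_sub normrN.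
congr (_ * _); have p0 := pi_ge0 R.
rewrite (@cint_split _ 0 (pi / 2) (pi / 4))//; last lra.
rewrite cint_tan//; congr (_ + _).
have p4 : 0 <= pi / 4 :> R by lra.
have := @cint_reflect R (fun t => trigw a b t * K t) 0 (pi / 4) (pi / 2) p4 cF.
rewrite subr0 (_ : pi / 2 - pi / 4 = pi / 4); last by field.
move=> ->; rewrite (addrC a b) -(@cint_tan b a (fun t => K (pi / 2 - t)))//; last first.
  by move=> t; apply: (ccont_comp (f := K)) => //; exact: cont_sub.
apply: eq_cint => t _; congr (_ * _).
by rewrite /trigw sin_pihalf_sub cos_pihalf_sub mulrC.
Qed.

End CircleIntegral.

Section OperatorA.
Variable R : realType.

Definition circ (t : R) : 'rV[R]_2 := snoc (const_mx (sin t)) (cos t).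

Lemma circ0 t : circ t 0 ord0 = sin t.
Proof.
have -> : ord0 = lift ord_max ord0 :> 'I_2 by apply: val_inj.
by rewrite snoc_lift mxE.
Qed.

Lemma circ1 t : circ t 0 ord_max = cos t.
Proof. exact: snoc_last. Qed.

(** The two points of S^0 yield (sin t, cos t) and (- sin t, cos t), and the latter is
    [circ (- t)]. *)
Lemma circle_integralE (f : 'rV[R]_2 -> R[i]) :
  sphere_integral f = cint 0 pi (fun t => f (circ t) + f (circ (- t))).
Proof.
apply: eq_cintegral => t _; rewrite expr0 mul1r /circ sinN cosN.
by congr (f (snoc _ _) + f (snoc _ _)); apply/rowP => i; rewrite !mxE ?mulr1 ?mulrN1.
Qed.

Variables (n : nat) (phi : Cinfty R n.+1) (v : 'rV[R]_n).

Definition arc t : R[i] := at_line phi (snoc (sin t *: v) (cos t)).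
Definition evenarc t : R[i] := arc t + arc (- t).
(** [vchart] and [hchart] are phi on the projective line through [0 : 1] and [v : 0], in affine
    coordinates centred at these two points. *)
Definition vchart t : R[i] := at_line phi (snoc (t *: v) 1).
Definition hchart t : R[i] := at_line phi (snoc v t).

Hypothesis v0 : v != 0.

Lemma arc_cont t : ccont arc t.
Proof.
apply: at_line_ccont.
- move=> i; case: (unliftP ord_max i) => [l ->|->].
  + rewrite (_ : (fun t => _) = (fun t => sin t * v 0 l)).
      by apply: continuousM; [exact: continuous_sin|exact: cst_continuous].
    by apply/funext => x; rewrite snoc_lift mxE.
  + rewrite (_ : (fun t => _) = @cos R); first exact: continuous_cos.
    by apply/funext => x; rewrite snoc_last.
- by apply: snoc_neq0; rewrite scaler_eq0 negb_or v0 andbT sin_cos_neq0.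
Qed.

Lemma evenarc_cont t : ccont evenarc t.
Proof.
apply: ccontD; first exact: arc_cont.
apply: (ccont_comp (f := arc)); [exact: opp_continuous|exact: arc_cont].
Qed.

Lemma snocN (u : 'rV[R]_n) t : snoc (- u) (- t) = - snoc u t.
Proof. by rewrite -[RHS]scaleN1r -snocZ scaleN1r mulN1r. Qed.

(** Passing to pi - t flips the sign of the cosine; as phi ignores a global sign, this only
    exchanges the two summands. *)
Lemma evenarc_pi t : evenarc (pi - t) = evenarc t.
Proof.
rewrite /evenarc /arc !sinN !cosN sin_pi_sub cos_pi_sub addrC; congr (_ + _).
- by rewrite scaleNr snocN at_line_opp.
- by rewrite -[sin t *: v]opprK snocN at_line_opp -scaleNr.
Qed.

Lemma evenarc_atan t : evenarc (atan t) = vchart t + vchart (- t).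
Proof.
have c0 : cos (atan t) != 0 by rewrite cos_atan invr_neq0// gt_eqF// sqrtr_gt0 usq_gt0.
have sE : sin (atan t) = cos (atan t) * t by rewrite -{3}(atanK t) /tan mulrC divfK.
rewrite /evenarc /arc !sinN !cosN sE /vchart; congr (_ + _).
- by rewrite -[X in snoc _ X]mulr1 -scalerA snocZ at_line_scale.
- by rewrite -[X in snoc _ X]mulr1 -mulrN -scalerA snocZ at_line_scale.
Qed.

Lemma evenarc_acot t : evenarc (pi / 2 - atan t) = hchart t + hchart (- t).
Proof.
have c0 : cos (atan t) != 0 by rewrite cos_atan invr_neq0// gt_eqF// sqrtr_gt0 usq_gt0.
have sE : sin (atan t) = cos (atan t) * t by rewrite -{3}(atanK t) /tan mulrC divfK.
rewrite /evenarc /arc !sinN !cosN sin_pihalf_sub cos_pihalf_sub sE /hchart; congr (_ + _).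
- by rewrite snocZ at_line_scale.
- rewrite -[in RHS](at_line_scale phi _ (_ : - cos (atan t) != 0)) ?oppr_eq0//.
  by rewrite -snocZ mulrNN.
Qed.

Lemma vchart_smooth : csmooth vchart.
Proof.
have := csmooth_line_at phi (i := ord_max) (q := snoc 0 1) (w := snoc v 0).
rewrite !snoc_last => /(_ (oner_neq0 _) erefl); congr csmooth; apply/funext => t.
congr at_line; apply: snoc_eqP; first by rewrite !mxE !unlift_none mulr0 addr0.
by move=> l; rewrite !mxE liftK mxE add0r mxE.
Qed.

Lemma hchart_smooth : csmooth hchart.
Proof.
have [l vl] := neq0_coord v0.
have := csmooth_line_at phi (i := lift ord_max l) (q := snoc v 0) (w := snoc 0 1).
rewrite !snoc_lift mxE => /(_ vl erefl); congr csmooth; apply/funext => t.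
congr at_line; apply: snoc_eqP; first by rewrite !mxE !unlift_none add0r mulr1.
by move=> k; rewrite !mxE liftK mxE mulr0 addr0.
Qed.

End OperatorA.

Section OperatorAMellin.
Variables (R : realType) (n : nat).

Lemma A_integral_arc (lam nu : C2 R) (phi : Cinfty R n.+1) (y : 'rV[R]_n) :
  let a := nu.1 + rho1' R n in let b := lam.1 + rho1 R n - nu.1 - rho1' R n in
  let v := (enorm y)^-1 *: y in
  A_integral lam nu phi y = cint 0 pi (fun t =>
    (rGamma (a / 2) * rGamma (b / 2) / 2) * (trigw a b t * evenarc phi v t)).
Proof.
move=> a b v; rewrite /A_integral circle_integralE; apply: eq_cint => t _.
rewrite !circ0 !circ1 sinN cosN normrN -/a -/b -/v /evenarc /arc sinN cosN /trigw.
ring.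
Qed.

Lemma A_mellin (lam nu : C2 R) (phi : Cinfty R n.+1) (y : 'rV[R]_n) :
  let a := nu.1 + rho1' R n in let b := lam.1 + rho1 R n - nu.1 - rho1' R n in
  let v := (enorm y)^-1 *: y in
  y != 0 -> v != 0 -> 1 < Re a -> 1 < Re b ->
  A_integral lam nu phi y = rGamma (a / 2) * rGamma (b / 2) *
   (mellin (fun t => usq ((a + b) / 2) t * (vchart phi v t + vchart phi v (- t))) a +
    mellin (fun t => usq ((a + b) / 2) t * (hchart phi v t + hchart phi v (- t))) b).
Proof.
move=> a b v y0 v0 a1 b1; rewrite A_integral_arc -/a -/b -/v.
rewrite /cint cintegralZ//; last first.
  by apply: ccont_cintble => x _; apply: ccontM; [exact: ccont_trigw|exact: evenarc_cont].
rewrite -/(cint _ _ _) cint_trigw//; last 2 first.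
- by move=> t; exact: evenarc_cont.
- by move=> t; exact: evenarc_pi.
under eq_fun do rewrite evenarc_atan.
under [X in mellin X b]eq_fun do rewrite evenarc_acot.
by field.
Qed.

End OperatorAMellin.

Section Norms.
Variables (R : realType) (n : nat).
Implicit Types (y : 'rV[R]_n) (t : R).

Lemma enorm_sqr y : enorm y ^+ 2 = \sum_i y 0 i ^+ 2.
Proof. by rewrite sqr_sqrtr// sumr_ge0// => i _; exact: sqr_ge0. Qed.

Lemma enorm_gt0 y : y != 0 -> 0 < enorm y.
Proof.
move=> /neq0_coord[i yi]; rewrite sqrtr_gt0 (bigD1 i)//= ltr_pwDl//.
  by rewrite exprn_even_gt0.
by apply: sumr_ge0 => j _; exact: sqr_ge0.
Qed.

Lemma unit_neq0 y : y != 0 -> (enorm y)^-1 *: y != 0.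
Proof. by move=> y0; rewrite scaler_eq0 negb_or y0 andbT invr_neq0// gt_eqF// enorm_gt0. Qed.

Lemma enorm_snoc y t : enorm (snoc y t) = Num.sqrt (enorm y ^+ 2 + t ^+ 2).
Proof.
rewrite enorm_sqr {1}/enorm big_ord_recr /=; congr (Num.sqrt (_ + _)).
- apply: eq_bigr => i _; congr (_ ^+ 2); rewrite -(snoc_lift y t); congr (snoc _ _ _ _).
  by apply: val_inj; rewrite /= /bump leqNgt ltn_ord.
- by rewrite snoc_last.
Qed.

End Norms.

(** * The degenerations of A to A^(1) and A^(2) *)

Section ClaimsA.
Variables (R : realType) (n : nat) (A : opfamily R n).
Hypothesis rG : forall z, holoat (@rGamma R) z.
Hypothesis hA : is_A A.
Variables (phi : Cinfty R n.+1) (y : 'rV[R]_n).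
Hypothesis y0 : y != 0.
Let v := (enorm y)^-1 *: y.
Let r := enorm y.
Let r0 : 0 < r. Proof. exact: enorm_gt0. Qed.
Let v0 : v != 0. Proof. exact: unit_neq0. Qed.
Let rv : r *: v = y. Proof. by rewrite scalerA divff ?scale1r// gt_eqF. Qed.

Let F (q : C2 R * C2 R) : R[i] := at_line (A q.1 q.2 phi) y.

Lemma A_line (p d : C2 R * C2 R) w0 : holoat (fun w => F (p + w *: d)) w0.
Proof. by apply: differentiable_holo => q; have [h _] := hA phi y0; exact: h. Qed.

Lemma cderive1n_even k (psi : R -> R[i]) : csmooth psi ->
  cderive1n (2 * k) (fun t => psi t + psi (- t)) 0 = 2 * cderive1n (2 * k) psi 0.
Proof.
move=> sp; have -> : (fun t => psi t + psi (- t)) = (fun t => psi t + psi (-1 * t)).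
  by apply/funext => t; rewrite mulN1r.
rewrite cderive1nD//; last first.
  have := csmooth_comp_affine (-1) 0 sp; congr csmooth.
  by apply/funext => t; rewrite addr0.
rewrite cderive1n_scale// mulr0 rmorphN rmorph1 -signr_odd oddM /= expr0 mul1r.
by rewrite mulr_natl mulr2n.
Qed.

Let dcoef s k psi : R[i] := cderive1n k (fun t => usq s t * psi t) 0.

Lemma usq_even k s (psi : R -> R[i]) : csmooth psi ->
  cderive1n (2 * k) (fun t => usq s t * (psi t + psi (- t))) 0 = 2 * dcoef s (2 * k) psi.
Proof.
move=> sp; rewrite /dcoef -cderive1n_even; last by apply: csmoothM => //; exact: csmooth_usq.
congr (cderive1n _ _ 0); apply/funext => t.
by rewrite mulrDr /usq sqrrN.
Qed.

Lemma csmooth_usq_even s (psi : R -> R[i]) : csmooth psi ->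
  csmooth (fun t => usq s t * (psi t + psi (- t))).
Proof.
move=> sp; apply: csmoothM; first exact: csmooth_usq.
apply: csmoothD => //; have := csmooth_comp_affine (-1) 0 sp; congr csmooth.
by apply/funext => t; rewrite addr0 mulN1r.
Qed.

Lemma A_value (lam nu : C2 R) :
  let a := nu.1 + rho1' R n in let b := lam.1 + rho1 R n - nu.1 - rho1' R n in
  1 < Re a -> 1 < Re b ->
  F (lam, nu) = rGamma (a / 2) * rGamma (b / 2) *
   (mellin (fun t => usq ((a + b) / 2) t * (vchart phi v t + vchart phi v (- t))) a +
    mellin (fun t => usq ((a + b) / 2) t * (hchart phi v t + hchart phi v (- t))) b).
Proof.
move=> a b a1 b1; rewrite -A_mellin//.
have [_ h] := hA phi y0; apply: h; rewrite /A_domain /=.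
by split; [exact: lt_trans a1|exact: lt_trans b1].
Qed.

Lemma Re_2mul (z : R[i]) : Re (2 * z) = 2 * Re z.
Proof. by rewrite ReM Re_nat Im_nat mul0r subr0. Qed.

(** With lambda fixed, a = nu_1 + rho_1' runs over a complex line on which 2s = a + b is constant,
    as [mellin_value] requires; its condition 2 < Re s is the bound 4. The doubling of [usq_even]
    cancels its factor 1/2. *)
Lemma A1_right (lam nu : C2 R) j : nu.1 = - rho1' R n - (2 * j)%:R ->
  4 < Re (lam.1 + rho1 R n) ->
  F (lam, nu) = (-1) ^+ j * (j`!%:R / (2 * j)`!%:R) *
    rGamma ((lam.1 + rho1 R n - nu.1 - rho1' R n) / 2) *
    dcoef ((lam.1 + rho1 R n) / 2) (2 * j) (vchart phi v).
Proof.
move=> nuE lam4; set s := (lam.1 + rho1 R n) / 2.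
have s2 : 2 < Re s by rewrite Re_half; lra.
pose X a := F (lam, (a - rho1' R n, nu.2)).
have hX a : holoat X a.
  have := A_line ((lam.1, lam.2), (- rho1' R n, nu.2)) ((0, 0), (1, 0)) a.
  apply: eq_holo => w; rewrite /X pair_lineE !mulr0 !addr0 mulr1 addrC.
  by rewrite -surjective_pairing.
have := mellin_value rG j (csmooth_usq_even s (vchart_smooth phi v))
  (csmooth_usq_even s (hchart_smooth phi v0)) s2 hX.
rewrite usq_even; last exact: vchart_smooth.
have s2E : 2 * s = lam.1 + rho1 R n by rewrite /s mulrC divfK// pnatr_eq0.
have -> : X (- (2 * j)%:R) = F (lam, nu).
  by rewrite /X; congr (F (_, _)); rewrite [RHS]surjective_pairing nuE; congr (_, _); ring.
move=> ->.
- rewrite nuE s2E; congr (_ * rGamma (_ / 2) * _); first ring.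
  by rewrite mulrC mulKf// pnatr_eq0.
- move=> a a1 b1.
  have E1 : (a - rho1' R n, nu.2).1 + rho1' R n = a by rewrite /=; ring.
  have E2 : lam.1 + rho1 R n - (a - rho1' R n, nu.2).1 - rho1' R n = 2 * s - a.
    by rewrite s2E /=; ring.
  rewrite /X A_value ?E1 ?E2; [|exact: a1|exact: b1].
  by rewrite (_ : (a + (2 * s - a)) / 2 = s)//; field.
Qed.

(** Both sides are entire in lambda_1 for fixed nu, which removes the bound of [A1_right]. *)
Lemma A1_all (lam nu : C2 R) j : nu.1 = - rho1' R n - (2 * j)%:R ->
  F (lam, nu) = (-1) ^+ j * (j`!%:R / (2 * j)`!%:R) *
    rGamma ((lam.1 + rho1 R n - nu.1 - rho1' R n) / 2) *
    dcoef ((lam.1 + rho1 R n) / 2) (2 * j) (vchart phi v).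
Proof.
move=> nuE; set k := (-1) ^+ j * _.
suff H l : F ((l, lam.2), nu) = k * rGamma ((l + rho1 R n - nu.1 - rho1' R n) / 2) *
    dcoef ((l + rho1 R n) / 2) (2 * j) (vchart phi v).
  by have := H lam.1; rewrite -surjective_pairing.
move: l; apply: (@entire_identity R _ _ (4 - Re (rho1 R n))) => l.
- have := A_line ((0, lam.2), (nu.1, nu.2)) ((1, 0), (0, 0)) l.
  apply: eq_holo => w; rewrite pair_lineE !mulr0 !addr0 mulr1 add0r.
  by rewrite -surjective_pairing.
- apply: holoM.
    apply: holoZ.
    have := @holo_affine R (@rGamma R) 2^-1 ((rho1 R n - nu.1 - rho1' R n) / 2) l (rG _).
    by apply: eq_holo => w; congr rGamma; field.
  have := @holo_affine R (fun s => dcoef s (2 * j) (vchart phi v)) 2^-1 (rho1 R n / 2) l.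
  move=> /(_ (holo_cderive1n_usq _ _ (vchart_smooth phi v))).
  by apply: eq_holo => w; congr dcoef; field.
- by move=> l4; apply: (@A1_right (l, lam.2)) => //; rewrite ReD -ltrBlDr.
Qed.

(** With y = r v the rescaling t -> r t produces r^{2j}, which the prefactor |y|^{nu_1 + rho_1'} =
    r^{-2j} cancels. *)
Lemma A1_opE (lam nu : C2 R) j : nu.1 = - rho1' R n - (2 * j)%:R ->
  A1_op j lam nu phi y = dcoef ((lam.1 + rho1 R n) / 2) (2 * j) (vchart phi v).
Proof.
move=> nuE; rewrite /A1_op nuE.
have -> : - rho1' R n - (2 * j)%:R + rho1' R n = - (2 * j)%:R :> R[i] by ring.
set s := (lam.1 + rho1 R n) / 2.
pose h u := usq s u * vchart phi v u.
have sh : csmooth h by apply: csmoothM; [exact: csmooth_usq|exact: vchart_smooth].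
have -> : (fun t => cpow (enorm (snoc (t *: y) 1)) (- lam.1 - rho1 R n) *
    at_line phi (snoc (t *: y) 1)) = (fun t => h (r * t)).
  apply/funext => t; rewrite /h; congr (_ * _); last first.
    by rewrite /vchart -scalerA [r *: _]scalerA [r * t]mulrC -scalerA rv.
  rewrite enorm_snoc expr1n addrC; have -> : enorm (t *: y) ^+ 2 = (r * t) ^+ 2.
    rewrite enorm_sqr exprMn enorm_sqr mulr_suml; apply: eq_bigr => i _.
    by rewrite mxE exprMn mulrC.
  rewrite cpow_sqrt ?usq_gt0// /usq; by congr cpow; rewrite /s; field.
rewrite (cderive1n_scale _ r sh) mulr0 cpowN// cpow_nat ?(ltW r0)// rmorphXn /= mulKf//.
by rewrite expf_neq0// -cmod_eq0 cmodC normr_eq0 gt_eqF.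
Qed.

(** The same residue with the charts exchanged: b is the variable and a = 2s - b. *)
Lemma A2_right (lam nu : C2 R) j : lam.1 + rho1 R n - nu.1 - rho1' R n = - (2 * j)%:R ->
  4 < Re (lam.1 + rho1 R n) ->
  F (lam, nu) = (-1) ^+ j * (j`!%:R / (2 * j)`!%:R) *
    rGamma ((nu.1 + rho1' R n) / 2) *
    dcoef ((lam.1 + rho1 R n) / 2) (2 * j) (hchart phi v).
Proof.
move=> bE lam4; set s := (lam.1 + rho1 R n) / 2.
have s2 : 2 < Re s by rewrite Re_half; lra.
have s2E : 2 * s = lam.1 + rho1 R n by rewrite /s mulrC divfK// pnatr_eq0.
pose X b := F (lam, (2 * s - b - rho1' R n, nu.2)).
have hX a : holoat X a.
  have := A_line ((lam.1, lam.2), (2 * s - rho1' R n, nu.2)) ((0, 0), (-1, 0)) a.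
  apply: eq_holo => w; rewrite /X pair_lineE !mulr0 !addr0 mulrN1 addrAC.
  by rewrite -surjective_pairing.
have := mellin_value rG j (csmooth_usq_even s (hchart_smooth phi v0))
  (csmooth_usq_even s (vchart_smooth phi v)) s2 hX.
rewrite usq_even; last exact: hchart_smooth.
have nuE : nu.1 = 2 * s + (2 * j)%:R - rho1' R n by rewrite s2E -[(2 * j)%:R]opprK -bE; ring.
have -> : X (- (2 * j)%:R) = F (lam, nu).
  by rewrite /X; congr (F (_, _)); rewrite [RHS]surjective_pairing nuE; congr (_, _); ring.
move=> ->.
- rewrite nuE; congr (_ * rGamma (_ / 2) * _); first ring.
  by rewrite mulrC mulKf// pnatr_eq0.
- move=> b b1 a1.
  have E1 : (2 * s - b - rho1' R n, nu.2).1 + rho1' R n = 2 * s - b by rewrite /=; ring.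
  have E2 : lam.1 + rho1 R n - (2 * s - b - rho1' R n, nu.2).1 - rho1' R n = b.
    by rewrite /= s2E; ring.
  rewrite /X A_value ?E1 ?E2; [|exact: a1|exact: b1].
  rewrite (_ : ((2 * s - b) + b) / 2 = s); last by field.
  by rewrite [rGamma ((2 * s - b) / 2) * _]mulrC [X in _ * X]addrC.
Qed.

Lemma A2_all (lam nu : C2 R) j : lam.1 + rho1 R n - nu.1 - rho1' R n = - (2 * j)%:R ->
  F (lam, nu) = (-1) ^+ j * (j`!%:R / (2 * j)`!%:R) *
    rGamma ((nu.1 + rho1' R n) / 2) *
    dcoef ((lam.1 + rho1 R n) / 2) (2 * j) (hchart phi v).
Proof.
move=> bE; set k := (-1) ^+ j * _.
(* To keep b = -2j while lambda_1 varies, nu_1 has to move along with it; the continuation takes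
   place on this diagonal line. *)
pose N l : R[i] := l + rho1 R n - rho1' R n + (2 * j)%:R.
have nuE : nu.1 = N lam.1 by rewrite /N -[(2 * j)%:R]opprK -bE; ring.
suff H l : F ((l, lam.2), (N l, nu.2)) = k * rGamma ((N l + rho1' R n) / 2) *
    dcoef ((l + rho1 R n) / 2) (2 * j) (hchart phi v).
  by have := H lam.1; rewrite -nuE -!surjective_pairing.
move: l; apply: (@entire_identity R _ _ (4 - Re (rho1 R n))) => l.
- have := A_line ((0, lam.2), (N 0, nu.2)) ((1, 0), (1, 0)) l.
  apply: eq_holo => w; rewrite pair_lineE !mulr0 !addr0 mulr1 add0r.
  by congr (F (_, (_, _))); rewrite /N; ring.
- apply: holoM.
    apply: holoZ.
    have := @holo_affine R (@rGamma R) 2^-1 ((rho1 R n + (2 * j)%:R) / 2) l (rG _).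
    by apply: eq_holo => w; congr rGamma; rewrite /N; field.
  have := @holo_affine R (fun s => dcoef s (2 * j) (hchart phi v)) 2^-1 (rho1 R n / 2) l.
  move=> /(_ (holo_cderive1n_usq _ _ (hchart_smooth phi v0))).
  by apply: eq_holo => w; congr dcoef; field.
- move=> l4; apply: (@A2_right (l, lam.2) (N l, nu.2)); first by rewrite /N /=; ring.
  by rewrite ReD -ltrBlDr.
Qed.

(** Since |(y, t)| = r |(v, t/r)|, three powers of r arise: r^{2s + 2j} in front, r^{-2s} from the
    weight and r^{-2j} from the derivative. They cancel. *)
Lemma A2_opE (lam nu : C2 R) j : lam.1 + rho1 R n - nu.1 - rho1' R n = - (2 * j)%:R ->
  A2_op j lam nu phi y = dcoef ((lam.1 + rho1 R n) / 2) (2 * j) (hchart phi v).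
Proof.
move=> bE; rewrite /A2_op; set s := (lam.1 + rho1 R n) / 2.
have -> : nu.1 + rho1' R n = 2 * s + (2 * j)%:R.
  by rewrite -[(2 * j)%:R]opprK -bE /s; field.
pose h u := usq s u * hchart phi v u.
have sh : csmooth h by apply: csmoothM; [exact: csmooth_usq|exact: hchart_smooth].
have -> : (fun t => cpow (enorm (snoc y t)) (- lam.1 - rho1 R n) *
    at_line phi (snoc y t)) = (fun t => cpow r (- (2 * s)) * h (r^-1 * t)).
  apply/funext => t; rewrite /h mulrA; congr (_ * _); last first.
    have -> : snoc y t = r *: snoc v (r^-1 * t) by rewrite -snocZ rv mulVKf// gt_eqF.
    by rewrite at_line_scale// gt_eqF.
  rewrite enorm_snoc -/r (_ : r ^+ 2 + t ^+ 2 = r ^+ 2 * (1 + (r^-1 * t) ^+ 2)); last first.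
    by field; rewrite gt_eqF.
  have r2 : 0 < r ^+ 2 by rewrite exprn_gt0.
  rewrite cpow_sqrt ?mulr_gt0 ?usq_gt0// cpowMl ?usq_gt0//; congr (_ * cpow _ _); last first.
    by rewrite /s; field.
  rewrite expr2 cpowMl// -cpowD//; by congr cpow; rewrite /s; field.
rewrite cderive1nZ; last first.
  have := csmooth_comp_affine r^-1 0 sh; congr csmooth.
  by apply/funext => t; rewrite addr0.
rewrite (cderive1n_scale _ r^-1 sh) mulr0 mulrA -cpowD//.
have -> : 2 * s + (2 * j)%:R + - (2 * s) = (2 * j)%:R by ring.
rewrite cpow_nat ?(ltW r0)// rmorphXn /= mulrA -exprMn -rmorphM divff ?gt_eqF//.
by rewrite rmorph1 expr1n mul1r.
Qed.

End ClaimsA.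

(** * Constant functions as test functions *)

Section ConstantFunction.
Variables (R : realType) (m : nat).

Lemma smooth_cst k (c : R) : smooth (fun _ : 'rV[R]_k => c).
Proof.
move=> s; have [d ->] : exists d : R, foldr (fun v g => 'D_v g) (fun _ : 'rV[R]_k => c) s = (fun=> d).
  elim: s => [|v s [d IH]]; first by exists c.
  by exists 0; rewrite /= IH; apply/funext => x; rewrite derive_cst.
by move=> x; exact: differentiable_cst.
Qed.

Lemma at_line_cst (c : R[i]) (x : 'rV[R]_m) : x != 0 ->
  at_line (fun _ : P R m => c) x = c.
Proof.
move=> x0; rewrite /at_line; case: insubP => //.
by rewrite dim_vline x0.
Qed.

Lemma insert1_neq0 (i : 'I_m) (u : 'rV[R]_m.-1) : insert i 1 u != 0.
Proof.
apply/eqP => /(congr1 (fun x : 'rV[R]_m => x 0 i)); rewrite insert_at mxE => /eqP.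
by rewrite oner_eq0.
Qed.

Lemma smoothP_cst (c : R[i]) : smoothP (fun _ : P R m => c).
Proof.
move=> i; split.
- have -> : (fun u => Re (at_line (fun _ : P R m => c) (insert i 1 u))) = (fun=> Re c).
    by apply/funext => u; rewrite at_line_cst// insert1_neq0.
  exact: smooth_cst.
- have -> : (fun u => Im (at_line (fun _ : P R m => c) (insert i 1 u))) = (fun=> Im c).
    by apply/funext => u; rewrite at_line_cst// insert1_neq0.
  exact: smooth_cst.
Qed.

Definition one_fun : Cinfty R m := MkCinfty (smoothP_cst 1).

End ConstantFunction.

(* The holomorphy of 1/Gamma comes for free from the holomorphy of A: on the
   constant function 1, and with second exponent 2, A is Gamma(a/2)^-1 (2/a). *)
Section EntireRGamma.
Variables (R : realType) (A : opfamily R 2).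
Hypothesis hA : is_A A.

Let y : 'rV[R]_2 := const_mx 1.
Let y0 : y != 0.
Proof.
apply/eqP => /(congr1 (fun x : 'rV[R]_2 => x 0 0)); rewrite !mxE => /eqP.
by rewrite oner_eq0.
Qed.

Let E (a : R[i]) : R[i] :=
  at_line (A (a + 2 - rho1 R 2, 0) (a - rho1' R 2, 0) (one_fun R 3)) y.

Let hE a : holoat E a.
Proof.
have := @A_line R 2 A hA (one_fun R 3) y y0
  ((2 - rho1 R 2, 0), (- rho1' R 2, 0)) ((1, 0), (1, 0)) a.
apply: eq_holo => w; rewrite pair_lineE !mulr0 !addr0 !mulr1 /E.
by congr (at_line (A (_, _) (_, _) _) y); ring.
Qed.

(** The exponent b = 2 leaves a single cosine, so sin^a / a is a primitive on [0, pi/2]. *)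
Lemma cint_trigw2 (a : R[i]) : 1 < Re a -> cint 0 pi (trigw a 2) = 2 / a.
Proof.
move=> a1; have a0 : a != 0.
  by apply/eqP => a0; move: a1; rewrite a0 /= ltNge ler01.
have R2 : 1 < Re (2 : R[i]) by rewrite Re_nat ltr1n.
have p2 : 0 <= pi / 2 :> R by rewrite divr_ge0// pi_ge0.
rewrite cint_halfcircle; last 2 first.
- by move=> t; exact: ccont_trigw.
- by move=> t; rewrite /trigw sin_pi_sub cos_pi_sub normrN.
congr (_ * _); rewrite (@FTC R (fun t => a^-1 * cpow `|sin t| a) _ 0 (pi / 2) p2); last 2 first.
- move=> t /andP[t0 t1].
  have s0 : 0 <= sin t by apply: sin_ge0_pi; have := pi_ge0 R; lra.
  have c0 : 0 <= cos t by apply: cos_ge0_pihalf; lra.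
  have := cderivZ a^-1 (cderiv_comp (is_derive_sin t) (cderiv_cpow_norm a1 s0)).
  congr cderiv; rewrite /trigw (_ : 2 - 1 = 1 :> R[i]); last by ring.
  by rewrite cpowr1// (ger0_norm c0); field.
- by move=> t _; exact: ccont_trigw.
rewrite sin0 sin_pihalf normr0 normr1 cpow1l cpow0r ?mulr0 ?subr0 ?mulr1//.
by rewrite gt_eqF// (lt_trans _ a1).
Qed.

Let E_val a : 1 < Re a -> E a = rGamma (a / 2) * (2 / a).
Proof.
move=> a1; have [_ h] := hA (one_fun R 3) y0.
have E1 : (a - rho1' R 2) + rho1' R 2 = a by ring.
have E2 : a + 2 - rho1 R 2 + rho1 R 2 - (a - rho1' R 2) - rho1' R 2 = 2 by ring.
rewrite /E h; last first.
  by rewrite /A_domain /= E1 E2 Re_nat ltr0n; split=> //; exact: lt_trans a1.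
have R2 : 1 < Re (2 : R[i]) by rewrite Re_nat ltr1n.
rewrite A_integral_arc /= E1 E2 divff ?pnatr_eq0// rGamma1 mulr1.
rewrite (@eq_cint _ _ _ _ (fun t => rGamma (a / 2) * trigw a 2 t)); last first.
  move=> t _; rewrite /evenarc /arc.
  have nz x : snoc (sin x *: ((enorm y)^-1 *: y)) (cos x) != 0.
    by apply: snoc_neq0; rewrite scaler_eq0 negb_or unit_neq0// andbT sin_cos_neq0.
  by rewrite /= !at_line_cst//; field.
rewrite /cint cintegralZ//; last by apply: ccont_cintble => x _; exact: ccont_trigw.
by rewrite -/(cint _ _ _) cint_trigw2.
Qed.

(** For Re a > 1, E(a) = (2/a) / Gamma(a/2); this rescaling is the entire function that has to equal
    1/Gamma. *)
Let e (z : R[i]) : R[i] := z * E (2 * z).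

Let he z : holoat e z.
Proof.
apply: holoM; first exact: holo_id.
have := @holo_affine R E 2 0 z (hE _).
by apply: eq_holo => w; rewrite addr0.
Qed.

Let eE z : 1 < Re z -> e z = rGamma z.
Proof.
move=> z1; rewrite /e E_val; last by rewrite Re_2mul; lra.
have z0 : z != 0 by apply/eqP => z0; move: z1; rewrite z0 /= ltNge ler01.
by rewrite [2 * z]mulrC mulfK ?pnatr_eq0//; field.
Qed.

Let e_rec z : e z = z * e (z + 1).
Proof.
apply: (@entire_identity R e (fun z => z * e (z + 1)) 1) => // [w|w w1].
  by apply: holoM; [exact: holo_id|exact: (holo_shift (f := e) (b := 1))].
rewrite (eE w1) eE; last by rewrite ReD /= (lt_trans w1)// ltrDl.
by apply: rGamma_rec; exact: lt_trans w1.
Qed.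

Let e_prod z m : e z = \prod_(k < m) (z + k%:R) * e (z + m%:R).
Proof.
elim: m => [|m IH]; first by rewrite big_ord0 addr0 mul1r.
by rewrite IH big_ord_recr /= -mulrA e_rec -natr1 addrA.
Qed.

Lemma rGamma_holo z : holoat (@rGamma R) z.
Proof.
apply: eq_holo (he z) => w; have [m m0 ->] := rGamma_shift w.
(* One further recursion moves the argument from w + m to Re > 1, where [e] and [rGamma] agree;
   [e_prod] leads back to w. *)
rewrite rGamma_rec// mulrA -eE; last by rewrite ReD /= ltrDr.
by rewrite (e_prod w m.+1) big_ord_recr /= -natr1 addrA.
Qed.

End EntireRGamma.

(** * Integrals against singular kernels *)

Section BoundedOnProjective.
Variables (R : realType) (m : nat).

Lemma continuous_box_bounded k (h : 'rV[R]_k -> R) :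
  (forall x, {for x, continuous h}) ->
  exists M : R, forall x : 'rV[R]_k, (forall i, `|x 0 i| <= 1) -> `|h x| <= M.
Proof.
move=> ch; pose A := [set x : 'rV[R]_k | forall i, `[-1, 1]%classic (x ord0 i)].
have cA : compact A by apply: (@rV_compact R k (fun=> `[-1, 1]%classic)) => i; exact: segment_compact.
have : compact (h @` A).
  by apply: continuous_compact => //; apply: continuous_subspaceT => x; exact: ch.
move=> /compact_bounded[M [_ hM]]; exists (M + 1) => x xi.
apply: (hM (M + 1)); first by rewrite ltrDl.
by exists x => // i /=; rewrite in_itv/= -ler_norml.
Qed.

(** Compactness of projective space in coordinates: dividing by a coordinate of largest modulus
    places the line in the cube of points with coordinates in [-1, 1] of some chart. *)
Lemma at_line_bounded (f : Cinfty R m) :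
  exists M : R, forall x : 'rV[R]_m, x != 0 -> cmod (at_line f x) <= M.
Proof.
have H (i : 'I_m) : exists M : R, forall u : 'rV[R]_m.-1, (forall l, `|u 0 l| <= 1) ->
    cmod (at_line f (insert i 1 u)) <= M.
  have [s1 s2] := Cinfty_smooth f i.
  have [M1 h1] := continuous_box_bounded (smooth_continuous s1).
  have [M2 h2] := continuous_box_bounded (smooth_continuous s2).
  exists (M1 + M2) => u hu; apply: le_trans (ler_cmod_ReIm _) _.
  by apply: lerD; [exact: (h1 u hu)|exact: (h2 u hu)].
have [M hM] := choice H.
exists (\sum_i `|M i|) => x x0.
have [i0 _] := neq0_coord x0.
pose i := [arg max_(i > i0) `|x 0 i|]%O.
have iP l : `|x 0 l| <= `|x 0 i|.
  by rewrite /i; case: arg_maxP => // j _; apply.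
have xi : x 0 i != 0.
  have [j xj] := neq0_coord x0; rewrite -normr_gt0.
  by apply: lt_le_trans (iP j); rewrite normr_gt0.
rewrite (at_line_chart f xi); apply: (@le_trans _ _ (M i)).
  apply: hM => l; rewrite mxE normrM normfV ler_pdivrMr ?normr_gt0// mul1r.
  exact: iP.
apply: le_trans (ler_norm _) _; rewrite (bigD1 i)//= lerDl.
by apply: sumr_ge0 => j _.
Qed.

End BoundedOnProjective.

Section KernelIntegral.
Variable R : realType.
Notation mu := (@lebesgue_measure R).
Variables (k : R -> R) (F : R -> R -> R[i]) (M : R).
Hypothesis k0 : forall u, 0 <= k u.
Hypothesis ki : mu.-integrable `[0%R, pi] (EFin \o k).
Hypothesis cF1 : forall u t, ccont (fun t => F t u) t.
Hypothesis cF2 : forall t u, ccont (F t) u.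
Hypothesis FM : forall t u, cmod (F t u) <= M.

Definition kint t : R[i] := cintegral `[0%R, pi] (fun u => (k u)%:C * F t u).

Lemma kernel_integrable (g : R -> R) : (forall u, {for u, continuous g}) ->
  (forall u, `|g u| <= M) -> mu.-integrable `[0%R, pi] (EFin \o (fun u => k u * g u)).
Proof.
move=> cg gM; have Mk := intbleZ M (measurable_itv _) ki.
apply: (le_integrable _ _ _ Mk) => //.
- have /integrableP[/measurable_EFinP mk _] := ki.
  have /integrableP[/measurable_EFinP mg _] : mu.-integrable `[0%R, pi] (EFin \o g).
    by apply: cont_integrable => x _; exact: cg.
  apply/measurable_EFinP; exact: measurable_funM.
- move=> x _ /=; rewrite lee_fin normrM [leRHS]normrM (ger0_norm (k0 x)) mulrC.
  by rewrite ler_wpM2r// (le_trans (gM x))// ler_norm.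
Qed.

Lemma kint_cintble t : cintble `[0%R, pi] (fun u => (k u)%:C * F t u).
Proof.
split.
- have := @kernel_integrable (fun u => Re (F t u)) (fun u => (cF2 t u).1)
    (fun u => le_trans (ler_Re_cmod _) (FM t u)).
  by apply: eq_intble => // u _; rewrite ReM ReC ImC mul0r subr0.
- have := @kernel_integrable (fun u => Im (F t u)) (fun u => (cF2 t u).2)
    (fun u => le_trans (ler_Im_cmod _) (FM t u)).
  by apply: eq_intble => // u _; rewrite ImM ReC ImC mul0r addr0.
Qed.

Lemma kint_le t : cmod (kint t) <= M * \int[mu]_(u in `[0%R, pi]) k u.
Proof.
rewrite -RintegralZl//; apply: le_cmod_cintegral => //.
- exact: kint_cintble.
- exact: intbleZ.
- by move=> u _; rewrite cmodM cmodC ger0_norm// mulrC ler_wpM2r.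
Qed.

Lemma kernel_cont (g : R -> R -> R) : (forall u t, {for t, continuous (g^~ u)}) ->
  (forall t u, {for u, continuous (g t)}) -> (forall t u, `|g t u| <= M) ->
  forall t, {for t, continuous (fun t => \int[mu]_(u in `[0%R, pi]) (k u * g t u))}.
Proof.
move=> cg1 cg2 gM t.
have Mk := intbleZ M (measurable_itv _) ki.
apply: (@continuity_under_integral R _ _ mu (fun t u => k u * g t u) `[0%R, pi]%classic
  (measurable_itv _) (t - 1) (t + 1) _ _ (fun u => M * k u) Mk).
- by move=> x _; apply: kernel_integrable => //; exact: gM.
- apply: aeW => u _ x _; apply: (@continuousM _ _ (fun=> k u) (g^~ u)).
    exact: cst_continuous.
  exact: cg1.
- move=> x _; apply: aeW => u _; rewrite normrM (ger0_norm (k0 u)) mulrC.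
  by rewrite ler_wpM2r.
- by rewrite inE/= in_itv/=; lra.
Qed.

(** Dominated convergence with majorant M k: the singularities of the kernel lie in u and do not
    move with t. *)
Lemma kint_cont t : ccont kint t.
Proof.
have c1 := @kernel_cont (fun t u => Re (F t u)) (fun u t => (cF1 u t).1)
  (fun t u => (cF2 t u).1) (fun t u => le_trans (ler_Re_cmod _) (FM t u)) t.
have c2 := @kernel_cont (fun t u => Im (F t u)) (fun u t => (cF1 u t).2)
  (fun t u => (cF2 t u).2) (fun t u => le_trans (ler_Im_cmod _) (FM t u)) t.
split.
- rewrite (_ : (fun t => _) = (fun t => \int[mu]_(u in `[0%R, pi]) (k u * Re (F t u))))//.
  apply/funext => x; apply: eq_Rintegral => u _.
  by rewrite ReM ReC ImC mul0r subr0.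
- rewrite (_ : (fun t => _) = (fun t => \int[mu]_(u in `[0%R, pi]) (k u * Im (F t u))))//.
  apply/funext => x; apply: eq_Rintegral => u _.
  by rewrite ImM ReC ImC mul0r addr0.
Qed.

End KernelIntegral.

(** * The mass of the kernel |sin|^{e-1} *)

Section SingularKernel.
Variable R : realType.
Notation mu := (@lebesgue_measure R).
Variable e : R.
Hypothesis e01 : 0 < e < 1.
Implicit Types (d x u : R).

(* |sin x|^(e-1), and an increasing approximation as d decreases to 0 which is
   continuous and has an explicit primitive up to bounded terms. *)
Definition sinker x : R := `|sin x| `^ (e - 1).
Definition sincut d x : R := `|sin x| * (`|sin x| + d) `^ (e - 2).

Let e0 : 0 < e. Proof. by case/andP: e01. Qed.
Let e1 : e < 1. Proof. by case/andP: e01. Qed.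

Lemma powR_sub12 x : 0 < x -> x `^ (e - 1) = x `^ (e - 2) * x.
Proof.
move=> x0; rewrite -[X in _ * X]powRr1 ?ltW// -powRD; last by rewrite (gt_eqF x0) implybT.
by congr (_ `^ _); ring.
Qed.

Lemma sincut_cont d x : 0 < d -> {for x, continuous (sincut d)}.
Proof.
move=> d0; have cs : {for x, continuous (fun x => `|sin x|)}.
  apply: (@continuous_comp _ _ _ (@sin R) (@Num.norm _ R)); first exact: continuous_sin.
  exact: (@norm_continuous R R).
apply: continuousM => //.
apply: (@continuous_comp _ _ _ (fun x => `|sin x| + d) (fun t => t `^ (e - 2))).
  by apply: continuousD => //; exact: cst_continuous.
by apply: cont_powR; rewrite ltr_wpDl.
Qed.

Lemma sincut_ge0 d x : 0 <= sincut d x.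
Proof. by rewrite mulr_ge0 ?powR_ge0. Qed.

Lemma sincut_pi d x : sincut d (x + pi) = sincut d x.
Proof. by rewrite /sincut sinDpi normrN. Qed.

Lemma sincut_opp d x : sincut d (- x) = sincut d x.
Proof. by rewrite /sincut sinN normrN. Qed.

(** As |sin| has period pi, what leaves [0, pi] at one end re-enters at the other. *)
Lemma sincut_shift d al : 0 < d -> 0 <= al <= pi ->
  \int[mu]_(u in `[0, pi]) sincut d (al + u) = \int[mu]_(u in `[0, pi]) sincut d u.
Proof.
move=> d0 /andP[al0 alp]; have p0 := pi_ge0 R.
have cc x : ccont (fun x => (sincut d x)%:C) x by apply: ccont_real; exact: sincut_cont.
apply: (@complexI R); rewrite -!cint_real.
transitivity (cint (0 + al) (pi + al) (fun u => (sincut d u)%:C)).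
  rewrite (@cint_shift R (fun u => (sincut d u)%:C) 0 pi al p0 cc).
  by apply: eq_cint => t _; rewrite addrC.
rewrite (@cint_split _ (0 + al) (pi + al) pi)//; last lra.
have -> : cint pi (pi + al) (fun u => (sincut d u)%:C) = cint 0 al (fun u => (sincut d u)%:C).
  have := @cint_shift R (fun u => (sincut d u)%:C) 0 al pi al0 cc.
  rewrite add0r [al + pi]addrC => ->.
  by apply: eq_cint => t _; rewrite sincut_pi.
by rewrite add0r addrC -cint_split// al0.
Qed.

Lemma sincut_shiftN d al : 0 < d -> 0 <= al <= pi ->
  \int[mu]_(u in `[0, pi]) sincut d (al - u) = \int[mu]_(u in `[0, pi]) sincut d u.
Proof.
move=> d0 /andP[al0 alp].
have hal : 0 <= pi - al <= pi by rewrite subr_ge0 alp gerBl al0.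
rewrite -(sincut_shift d0 hal).
apply: eq_Rintegral => u _; rewrite -sincut_opp -sincut_pi; congr sincut; ring.
Qed.

Lemma sincut_half d : 0 < d ->
  \int[mu]_(u in `[0, pi]) sincut d u = 2 * \int[mu]_(u in `[0, (pi / 2)]) sincut d u.
Proof.
move=> d0; apply: (@complexI R); rewrite rmorphM rmorph_nat /= -!cint_real.
apply: cint_halfcircle => t; first by apply: ccont_real; exact: sincut_cont.
by rewrite /sincut sin_pi_sub.
Qed.

Lemma is_derive_sinpow d p x : 0 < d -> 0 <= sin x ->
  is_derive x 1 (fun x => (sin x + d) `^ p) (cos x * (p * (sin x + d) `^ (p - 1))).
Proof.
move=> d0 s0; have h : 0 < sin x + d by rewrite ltr_wpDl.
have D1 := is_deriveD (is_derive_sin x) (is_derive_cst d x 1).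
have := @is_derive1_comp _ (fun t => t `^ p) (fun x => sin x + d) x _ _ (is_derive1_powR p h) D1.
by move=> D; apply: (is_derive_eq D); rewrite addr0 mulrC.
Qed.

(** A factor cos makes primitives explicit. Below: cos <= 1, and sin (sin + d)^{e-2} = (sin +
    d)^{e-1} - d (sin + d)^{e-2}. Above: 1 <= cos + sin, where the part with sin is at most (sin +
    d)^e <= 2 and integrates to at most pi. *)
Lemma sincut_bounds d : 0 < d -> d <= 1 ->
  (1 - d `^ e) / e - d `^ e / (1 - e) <= \int[mu]_(u in `[0, (pi / 2)]) sincut d u
  <= (1 + d) / e + pi.
Proof.
move=> d0 d1; have p2 : 0 <= pi / 2 :> R by rewrite divr_ge0// pi_ge0.
have e_neq0 : e != 0 by rewrite gt_eqF.
have e1_neq0 : e - 1 != 0 by rewrite subr_eq0 lt_eqF.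
have sP x : 0 <= x <= pi / 2 -> 0 <= sin x.
  by move=> /andP[x0 x1]; apply: sin_ge0_pi; have := pi_ge0 R; lra.
have cP x : 0 <= x <= pi / 2 -> 0 <= cos x.
  by move=> /andP[x0 x1]; apply: cos_ge0_pihalf; lra.
have cpow p x : 0 <= x <= pi / 2 -> {for x, continuous (fun x => (sin x + d) `^ p)}.
  move=> /sP s0; apply/differentiable_continuous/derivable1_diffP.
  exact: (@ex_derive _ _ _ _ _ _ _ (is_derive_sinpow p d0 s0)).
have ccos x : {for x, continuous (@cos R)} by exact: continuous_cos.
have cut_int : mu.-integrable `[0, (pi / 2)] (EFin \o sincut d).
  by apply: cont_integrable => x _; exact: sincut_cont.
apply/andP; split.
- pose P x := e^-1 * (sin x + d) `^ e + (- (d / (e - 1))) * (sin x + d) `^ (e - 1).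
  pose p x := cos x * ((sin x + d) `^ (e - 1) - d * (sin x + d) `^ (e - 2)).
  have pc x : 0 <= x <= pi / 2 -> {for x, continuous p}.
    move=> hx; apply: continuousM => //; apply: continuousB; first exact: cpow.
    by apply: continuousM; [exact: cst_continuous|exact: cpow].
  have : \int[mu]_(u in `[0, (pi / 2)]) p u = P (pi / 2) - P 0.
    apply: Rint_FTC => // x /sP s0.
    have D := is_deriveD (is_deriveZ e^-1 (is_derive_sinpow e d0 s0))
      (is_deriveZ (- (d / (e - 1))) (is_derive_sinpow (e - 1) d0 s0)).
    apply: (is_derive_eq D); rewrite /GRing.scale /= /p.
    have -> : e - 1 - 1 = e - 2 by ring.
    by field; rewrite e_neq0 e1_neq0.
  have : \int[mu]_(u in `[0, (pi / 2)]) p u <= \int[mu]_(u in `[0, (pi / 2)]) sincut d u.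
    apply: le_Rintegral => //; first exact: cont_integrable.
    move=> x /=; rewrite in_itv/= => hx; have s0 := sP x hx; have c0 := cP x hx.
    have sd : 0 < sin x + d by rewrite ltr_wpDl.
    have -> : p x = cos x * sincut d x.
      rewrite /p /sincut ger0_norm//; congr (_ * _).
      by rewrite powR_sub12//; ring.
    by rewrite ler_piMl ?sincut_ge0// cos_le1.
  move=> + E; rewrite E /P sin_pihalf sin0 add0r => h; apply: le_trans h.
  have ded : d * d `^ (e - 1) = d `^ e by rewrite mulr_powRB1// ltW.
  have h1 : 1 <= (1 + d) `^ e.
    by rewrite -[leLHS](@powRr0 _ (1 + d)) ler_powR// ?lerDl ltW.
  have h2 : 0 <= d / (1 - e) * (1 + d) `^ (e - 1).
    by rewrite mulr_ge0 ?powR_ge0// divr_ge0 ?ltW// subr_gt0.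
  have -> : e^-1 * (1 + d) `^ e + - (d / (e - 1)) * (1 + d) `^ (e - 1) -
      (e^-1 * d `^ e + - (d / (e - 1)) * d `^ (e - 1)) =
      ((1 + d) `^ e - d `^ e) / e + d / (1 - e) * (1 + d) `^ (e - 1) -
      d * d `^ (e - 1) / (1 - e).
    by field; rewrite e_neq0 e1_neq0 subr_eq0 gt_eqF.
  rewrite ded; have : (1 - d `^ e) / e <= ((1 + d) `^ e - d `^ e) / e.
    by rewrite ler_pM2r ?invr_gt0// lerD2r.
  lra.
- pose P x := e^-1 * (sin x + d) `^ e + 2 * x.
  pose p x := cos x * (sin x + d) `^ (e - 1) + 2.
  have pc x : 0 <= x <= pi / 2 -> {for x, continuous p}.
    move=> hx; apply: continuousD; last exact: cst_continuous.
    by apply: continuousM => //; exact: cpow.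
  have E : \int[mu]_(u in `[0, (pi / 2)]) p u = P (pi / 2) - P 0.
    apply: Rint_FTC => // x /sP s0.
    have D := is_deriveD (is_deriveZ e^-1 (is_derive_sinpow e d0 s0))
      (is_deriveZ 2 (is_derive_id x 1)).
    apply: (is_derive_eq D); rewrite /GRing.scale /= /p.
    by field.
  apply: (@le_trans _ _ (\int[mu]_(u in `[0, (pi / 2)]) p u)).
    apply: le_Rintegral => //; first exact: cont_integrable.
    move=> x /=; rewrite in_itv/= => hx; have s0 := sP x hx; have c0 := cP x hx.
    have sd : 0 < sin x + d by rewrite ltr_wpDl.
    set q := (sin x + d) `^ (e - 1); have q0 : 0 <= q by exact: powR_ge0.
    have h1 : sincut d x <= q.
      rewrite /sincut ger0_norm// /q powR_sub12// mulrC.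
      by rewrite ler_wpM2l ?powR_ge0// lerDl ltW.
    have h2 : sin x * q <= 2.
      apply: (@le_trans _ _ ((sin x + d) * q)); first by rewrite ler_wpM2r// lerDl ltW.
      rewrite mulr_powRB1 ?(ltW sd)//; apply: (@le_trans _ _ (2 `^ e)).
        by rewrite ge0_ler_powR ?nnegrE ?(ltW e0) ?(ltW sd)//; have := sin_le1 x; lra.
      by apply: ler1_powR; rewrite ?ler1n ?(ltW e1).
    have h3 : 1 <= cos x + sin x.
      have := cos2Dsin2 x; have := cos_le1 x; have := sin_le1 x; nra.
    by rewrite /p -/q; apply: le_trans h1 _; nra.
  rewrite E /P sin_pihalf sin0 add0r mulr0 addr0.
  have h1 : (1 + d) `^ e <= 1 + d by apply: ler1_powR; rewrite ?lerDl ltW.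
  have h2 : 0 <= e^-1 * d `^ e by rewrite mulr_ge0 ?powR_ge0// invr_ge0 ltW.
  have h3 : e^-1 * (1 + d) `^ e <= e^-1 * (1 + d) by rewrite ler_wpM2l// invr_ge0 ltW.
  lra.
Qed.

Lemma sincut_mono d d' x : 0 < d -> d <= d' -> sincut d' x <= sincut d x.
Proof.
move=> d0 dd; rewrite /sincut; have [->|s0] := eqVneq (sin x) 0.
  by rewrite normr0 !mul0r.
have d'0 : 0 < d' by exact: lt_le_trans dd.
have h1 : 0 < `|sin x| + d by rewrite ltr_wpDl.
have h2 : 0 < `|sin x| + d' by rewrite ltr_wpDl.
rewrite ler_wpM2l// (_ : e - 2 = - (2 - e)); last by ring.
rewrite !powRN lef_pV2 ?posrE ?powR_gt0//.
have e2 : 0 <= 2 - e by have := e1; lra.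
by apply: ge0_ler_powR; rewrite ?nnegrE ?lerD2l// ltW.
Qed.

Let dn (n : nat) : R := n.+1%:R^-1.
Let dn_gt0 n : 0 < dn n. Proof. by rewrite invr_gt0. Qed.
Let dn_le1 n : dn n <= 1. Proof. by rewrite invf_le1// ler1n. Qed.

Lemma sincut_cvg x : sincut (dn n) x @[n --> \oo] --> sinker x.
Proof.
(* At a zero of sin both sides are 0, since 0 to a nonzero power is 0 by convention; the kernel has
   no infinite value. *)
rewrite /sinker /sincut; have [->|s0] := eqVneq (sin x) 0.
  rewrite normr0 powR0; last by rewrite subr_eq0 lt_eqF.
  by rewrite (_ : (fun n => _) = (fun=> 0)); [exact: cvg_cst|apply/funext => n; rewrite mul0r].
have ns : 0 < `|sin x| by rewrite normr_gt0.
have -> : `|sin x| `^ (e - 1) = `|sin x| * (`|sin x| + 0) `^ (e - 2).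
  by rewrite addr0 powR_sub12// mulrC.
apply: cvgM; first exact: cvg_cst.
have c : {for `|sin x| + 0, continuous (fun t : R => t `^ (e - 2))}.
  by apply: cont_powR; rewrite addr0.
apply: (@cvg_comp _ _ _ (fun n => `|sin x| + dn n) (fun t : R => t `^ (e - 2))) c.
apply: cvgD; [exact: cvg_cst|exact: cvg_harmonic].
Qed.

(** Monotone convergence as d decreases to 0; [g] covers al + u and al - u at once. The point is
    that the mass is 2/e up to an error bounded independently of e. *)
Lemma sinker_integral (g : R -> R) : (forall u, {for u, continuous g}) ->
  (forall d, 0 < d ->
    \int[mu]_(u in `[0, pi]) sincut d (g u) = \int[mu]_(u in `[0, pi]) sincut d u) ->
  mu.-integrable `[0%R, pi] (EFin \o (sinker \o g)) /\
  2 / e <= \int[mu]_(u in `[0, pi]) sinker (g u) <= 2 / e + (2 * pi + 1).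
Proof.
move=> cg gE.
have cut_int n : mu.-integrable `[0%R, pi] (EFin \o (fun u => sincut (dn n) (g u))).
  apply: cont_integrable => x _.
  by apply: (@continuous_comp _ _ _ g (sincut (dn n))); [exact: cg|exact: sincut_cont].
have := @cvg_monotone_convergence _ _ R mu `[0%R, pi]%classic (measurable_itv _)
  (fun n u => (sincut (dn n) (g u))%:E) _ _ _.
have mcut n : measurable_fun (`[0%R, pi]%classic : set (measurableTypeR R))
    (fun u => (sincut (dn n) (g u))%:E).
  by have /integrableP[] := cut_int n.
move=> /(_ mcut) H.
have {}H : (\int[mu]_(u in `[0%R, pi]) (sincut (dn n) (g u))%:E)%E @[n --> \oo] -->
    (\int[mu]_(u in `[0%R, pi]) (sinker (g u))%:E)%E.
  have -> : (\int[mu]_(u in `[0%R, pi]) (sinker (g u))%:E)%E =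
     (\int[mu]_(u in `[0%R, pi]) limn (fun n => (sincut (dn n) (g u))%:E))%E.
    apply: eq_integral => u _; apply/esym/cvg_lim => //.
    by apply: cvg_EFin; [exact: nearW|exact: sincut_cvg].
  apply: H.
  - by move=> n x _; rewrite lee_fin sincut_ge0.
  - move=> x _ n m nm; rewrite lee_fin; apply: sincut_mono => //.
    by rewrite lef_pV2 ?posrE// ler_nat.
pose I n := \int[mu]_(u in `[0, pi]) sincut (dn n) (g u).
have IE n : I n = 2 * \int[mu]_(u in `[0, (pi / 2)]) sincut (dn n) u.
  by rewrite /I gE// sincut_half.
have IH n : (\int[mu]_(u in `[0%R, pi]) (sincut (dn n) (g u))%:E)%E = (I n)%:E.
  by rewrite /I /Rintegral fineK//; apply: (integrable_fin_num _ (cut_int n)).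
have Imono n m : (n <= m)%N -> I n <= I m.
  move=> nm; apply: le_Rintegral => // x _; apply: sincut_mono => //.
  by rewrite lef_pV2 ?posrE// ler_nat.
(* By monotonicity n may be replaced by an m with 2 [dn m] / e <= 1; this is the 1 in 2 pi + 1. *)
have Iub n : I n <= 2 / e + (2 * pi + 1).
  have [m nm hm] : exists2 m, (n <= m)%N & 2 * dn m / e <= 1.
    have : \forall m \near \oo, 2 * dn m / e <= 1.
      near=> m; rewrite ler_pdivrMr// mul1r mulrC -ler_pdivlMr//; apply: ltW.
      by near: m; apply: near_inv; rewrite divr_gt0.
    move=> [N _ hN]; exists (maxn n N); first exact: leq_maxl.
    by apply: hN => /=; exact: leq_maxr.
  apply: le_trans (Imono _ _ nm) _; rewrite IE.
  have /andP[_] := sincut_bounds (dn_gt0 m) (dn_le1 m).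
  move=> h; have : 2 * \int[mu]_(u in `[0, (pi / 2)]) sincut (dn m) u <= 2 * ((1 + dn m) / e + pi).
    by rewrite ler_pM2l.
  have -> : 2 * ((1 + dn m) / e + pi) = 2 / e + 2 * dn m / e + 2 * pi.
    by field; rewrite gt_eqF.
  lra.
have Hub : (\int[mu]_(u in `[0%R, pi]) (sinker (g u))%:E <= (2 / e + (2 * pi + 1))%:E)%E.
  have /(@cvg_lim _) <- // := H; apply: lime_le; first by apply/cvg_ex; eexists; exact: H.
  by apply: nearW => n; rewrite IH lee_fin.
have Hge0 : (0 <= \int[mu]_(u in `[0%R, pi]) (sinker (g u))%:E)%E.
  by apply: integral_ge0 => u _; rewrite lee_fin powR_ge0.
have Hfin : (\int[mu]_(u in `[0%R, pi]) (sinker (g u))%:E)%E \is a fin_num.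
  by rewrite ge0_fin_numE//; apply: le_lt_trans Hub _; exact: ltry.
have mker : measurable_fun (`[0%R, pi]%classic : set (measurableTypeR R))
    (EFin \o (sinker \o g)).
  apply: (emeasurable_fun_cvg _ _ mcut) => u _.
  by apply: cvg_EFin; [exact: nearW|exact: sincut_cvg].
have Hcvg : I n @[n --> \oo] --> \int[mu]_(u in `[0, pi]) sinker (g u).
  rewrite (_ : I = fine \o (fun n => \int[mu]_(u in `[0%R, pi]) (sincut (dn n) (g u))%:E)%E)//.
  by apply: fine_cvg; rewrite /Rintegral fineK.
split.
  apply/integrableP; split => //.
  under eq_integral do rewrite /= ger0_norm ?powR_ge0//.
  by apply: le_lt_trans Hub _; exact: ltry.
apply/andP; split; last by rewrite -lee_fin /Rintegral fineK.
have lbn n : 2 * ((1 - (dn n) `^ e) / e - (dn n) `^ e / (1 - e)) <= I n.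
  rewrite IE ler_pM2l//.
  by have /andP[] := sincut_bounds (dn_gt0 n) (dn_le1 n).
have pc : (dn n) `^ e @[n --> \oo] --> (0 : R).
  apply/cvgrPdist_lt => r r0; have [q q0 hq] := powR_small e0 r0.
  near=> n; rewrite sub0r normrN ger0_norm ?powR_ge0// hq// ltW ?dn_gt0//=.
  by near: n; exact: near_inv.
have lc : 2 * ((1 - (dn n) `^ e) / e - (dn n) `^ e / (1 - e)) @[n --> \oo] -->
    2 * ((1 - 0) / e - 0 / (1 - e)).
  apply: cvgM; first exact: cvg_cst.
  apply: cvgB; last by apply: cvgM => //; exact: cvg_cst.
  by apply: cvgM; [apply: cvgB => //; exact: cvg_cst|exact: cvg_cst].
have := ler_cvg_to lc Hcvg _; rewrite mul0r !subr0 mul1r; apply.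
exact: nearW.
Unshelve. all: by end_near.
Qed.

Lemma sinker_integral_add al : 0 <= al <= pi ->
  mu.-integrable `[0%R, pi] (EFin \o (fun u => sinker (al + u))) /\
  2 / e <= \int[mu]_(u in `[0, pi]) sinker (al + u) <= 2 / e + (2 * pi + 1).
Proof.
move=> hal; apply: (@sinker_integral (fun u => al + u)).
  by move=> u; apply: continuousD; [exact: cst_continuous|exact: cvg_id].
by move=> d d0; exact: sincut_shift.
Qed.

Lemma sinker_integral_sub al : 0 <= al <= pi ->
  mu.-integrable `[0%R, pi] (EFin \o (fun u => sinker (al - u))) /\
  2 / e <= \int[mu]_(u in `[0, pi]) sinker (al - u) <= 2 / e + (2 * pi + 1).
Proof.
move=> hal; apply: (@sinker_integral (fun u => al - u)); first exact: cont_sub.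
by move=> d d0; exact: sincut_shiftN.
Qed.

End SingularKernel.

(** * Complex sequences and dominated convergence *)

Section ComplexSequences.
Variable R : realType.
Notation mu := (@lebesgue_measure R).
Implicit Types (s r : nat -> R[i]) (l m : R[i]).

Definition cvgc s l := (Re (s n) @[n --> \oo] --> Re l) /\ (Im (s n) @[n --> \oo] --> Im l).

Lemma cvgcP s l : cvgc s l <->
  forall e : R, 0 < e -> \forall n \near \oo, cmod (s n - l) < e.
Proof.
split=> [[h1 h2] e e0|h].
  have e2 : 0 < e / 2 by rewrite divr_gt0.
  move/cvgrPdist_lt : h1 => /(_ _ e2) h1; move/cvgrPdist_lt : h2 => /(_ _ e2) h2.
  near=> n; apply: le_lt_trans (ler_cmod_ReIm _) _; rewrite ReB ImB.
  rewrite distrC [X in _ + X]distrC [ltRHS]splitr.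
  by apply: ltrD; near: n.
split; apply/cvgrPdist_lt => e /h; apply: filterS => n; apply: le_lt_trans; rewrite distrC.
- by rewrite -ReB ler_Re_cmod.
- by rewrite -ImB ler_Im_cmod.
Unshelve. all: by end_near.
Qed.

Lemma cvgc_unique s l m : cvgc s l -> cvgc s m -> l = m.
Proof.
by move=> [h1 h2] [h3 h4]; apply: complex_eq; [apply: cvg_unique h1 h3|apply: cvg_unique h2 h4].
Qed.

Lemma cvgc_cst l : cvgc (fun=> l) l.
Proof. by split; exact: cvg_cst. Qed.

Lemma cvgcD s r l m : cvgc s l -> cvgc r m -> cvgc (fun n => s n + r n) (l + m).
Proof.
move=> [h1 h2] [h3 h4]; split.
- under eq_fun do rewrite ReD; rewrite ReD; exact: cvgD.
- under eq_fun do rewrite ImD; rewrite ImD; exact: cvgD.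
Qed.

Lemma cvgcM s r l m : cvgc s l -> cvgc r m -> cvgc (fun n => s n * r n) (l * m).
Proof.
move=> [h1 h2] [h3 h4]; split.
- by under eq_fun do rewrite ReM; rewrite ReM; apply: cvgB; exact: cvgM.
- by under eq_fun do rewrite ImM; rewrite ImM; apply: cvgD; exact: cvgM.
Qed.

Lemma holo_cvgc f z s : holoat f z -> cvgc s z -> cvgc (fun n => f (s n)) (f z).
Proof.
move=> /holo_cont hf /cvgcP hs; apply/cvgcP => e /hf[r r0 hr].
by apply: filterS (hs r r0) => n; exact: hr.
Qed.

(** Convergence is asked in the open interval only: in the application |sin t|^e does not tend to 1
    at t = 0 and t = pi. *)
Lemma Rint_dominated (h : nat -> R -> R) (l : R -> R) (a b M : R) :
  (forall n x, a <= x <= b -> {for x, continuous (h n)}) ->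
  (forall x, a <= x <= b -> {for x, continuous l}) ->
  (forall n x, a <= x <= b -> `|h n x| <= M) ->
  (forall x, a < x < b -> h n x @[n --> \oo] --> l x) ->
  \int[mu]_(x in `[a, b]) h n x @[n --> \oo] --> \int[mu]_(x in `[a, b]) l x.
Proof.
move=> ch cl hM hl.
have hi n := cont_integrable (ch n); have li := cont_integrable cl.
have Mi : mu.-integrable `[a, b] (EFin \o (fun=> M)).
  by apply: cont_integrable => x _; exact: cst_continuous.
have H := @dominated_convergence _ (measurableTypeR R) R mu `[a, b]%classic (measurable_itv _)
  (fun n x => (h n x)%:E) (fun x => (l x)%:E) (fun x => M%:E).
have [||||] := H _ _ _ Mi.
- by move=> n; have /integrableP[] := hi n.
- by have /integrableP[] := li.
- exists ([set a] `|` [set b]); split.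
  + by apply: measurableU; exact: measurable_set1.
  + apply: countable_lebesgue_measure0; apply: finite_set_countable.
    by rewrite finite_setU; split; exact: finite_set1.
  + move=> x /= hx; apply: contrapT => /not_orP[xa xb]; apply: hx.
    rewrite in_itv/= => /andP[ax xb']; apply: cvg_EFin; first exact: nearW.
    by apply: hl; rewrite !lt_neqAle ax xb' !andbT eq_sym; apply/andP; split; apply/eqP.
- by apply: aeW => x n; rewrite /= in_itv/= lee_fin => hx; exact: hM.
move=> _ _ Hc; apply: fine_cvg; rewrite /Rintegral fineK//.
by apply: (integrable_fin_num _ li).
Qed.

Lemma cint_dominated (h : nat -> R -> R[i]) (l : R -> R[i]) (a b M : R) :
  (forall n x, a <= x <= b -> ccont (h n) x) ->
  (forall x, a <= x <= b -> ccont l x) ->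
  (forall n x, a <= x <= b -> cmod (h n x) <= M) ->
  (forall x, a < x < b -> cvgc (h^~ x) (l x)) ->
  cvgc (fun n => cint a b (h n)) (cint a b l).
Proof.
move=> ch cl hM hl; split.
- apply: (@Rint_dominated (fun n x => Re (h n x)) (fun x => Re (l x)) a b M).
  + by move=> n x hx; have [] := ch n x hx.
  + by move=> x hx; have [] := cl x hx.
  + by move=> n x hx; apply: le_trans (ler_Re_cmod _) (hM n x hx).
  + by move=> x hx; have [] := hl x hx.
- apply: (@Rint_dominated (fun n x => Im (h n x)) (fun x => Im (l x)) a b M).
  + by move=> n x hx; have [] := ch n x hx.
  + by move=> x hx; have [] := cl x hx.
  + by move=> n x hx; apply: le_trans (ler_Im_cmod _) (hM n x hx).
  + by move=> x hx; have [] := hl x hx.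
Qed.

(** Starting at 1/2 keeps the sequence inside the open interval (0, 1) of admissible e. *)
Definition eps (n : nat) : R := n.+2%:R^-1.

Lemma eps01 n : 0 < eps n < 1.
Proof. by rewrite invr_gt0 invf_lt1 ?ltr1n ?ltr0n. Qed.

Lemma near_eps (e : R) : 0 < e -> \forall n \near \oo, eps n < e.
Proof.
move=> /near_inv; apply: filterS => n; apply: le_lt_trans.
by rewrite lef_pV2 ?posrE// ler_nat.
Qed.

End ComplexSequences.

Section Concentration.
Variable R : realType.
Notation mu := (@lebesgue_measure R).
Variables (g : R -> R) (K : R).
Hypothesis cg : forall u, {for u, continuous g}.
Hypothesis gK : forall e : R, 0 < e < 1 ->
  mu.-integrable `[0%R, pi] (EFin \o (fun u => sinker e (g u))) /\
  2 / e <= \int[mu]_(u in `[0, pi]) sinker e (g u) <= 2 / e + K.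

Let K0 : 0 <= K.
Proof.
have h2 : 0 < (2^-1 : R) < 1 by rewrite invr_gt0 invf_lt1 ?ltr1n ?ltr0n.
by have [_ /andP[a b]] := gK h2; have := le_trans a b; rewrite lerDl.
Qed.

Let cs u : {for u, continuous (fun u => `|sin (g u)|)}.
Proof.
apply: (@continuous_comp _ _ _ (fun u => sin (g u)) (@Num.norm _ R)).
  by apply: continuous_comp; [exact: cg|exact: continuous_sin].
exact: (@norm_continuous R R).
Qed.

(** The auxiliary w is continuous and positive, hence bounded below on [0, pi]; where q exceeds t it
    equals |sin g|, so there q <= M is at most a multiple of |sin g|. *)
Lemma away_from_zeros (q : R -> R) (M t : R) : (forall u, {for u, continuous q}) ->
  (forall u, q u <= M) -> (forall u, sin (g u) = 0 -> q u = 0) -> 0 < t -> 0 <= M ->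
  exists2 C, 0 <= C & forall u, 0 <= u <= pi -> q u <= t + C * `|sin (g u)|.
Proof.
move=> cq qM q0 t0 M0.
pose w u := `|sin (g u)| + Num.max (t - q u) 0.
have w_gt0 u : 0 < w u.
  rewrite /w; have [s0|s0] := eqVneq (sin (g u)) 0.
    by rewrite q0// subr0 s0 normr0 add0r lt_max t0.
  by rewrite ltr_pwDl ?normr_gt0// le_max lexx orbT.
have cw u : {for u, continuous w}.
  apply: continuousD; first exact: cs.
  apply: (@continuous_max _ _ (fun u => t - q u) (fun=> 0)).
    by apply: continuousB; [exact: cst_continuous|exact: cq].
  exact: cst_continuous.
have [c _ cP] := @EVT_min R w 0 pi (pi_ge0 R)
  (continuous_subspaceT cw).
exists (M / w c); first by rewrite divr_ge0// ltW.
move=> u hu; have hw : w c <= w u by apply: cP; rewrite in_itv.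
have [qt|tq] := leP (q u) t.
  by apply: le_trans qt _; rewrite lerDl mulr_ge0// divr_ge0// ltW.
have wu : w u = `|sin (g u)|.
  by rewrite /w max_r ?addr0// subr_le0 ltW.
apply: le_trans (qM u) _; rewrite -wu.
have : M <= M / w c * w u by rewrite mulrAC ler_pdivlMr// ler_wpM2l.
lra.
Qed.

Lemma sinker_mul_sin (e x : R) : 0 < e < 1 -> sinker e x * `|sin x| <= 1.
Proof.
move=> /andP[e0 e1]; rewrite /sinker mulrC mulr_powRB1//.
apply: (@le_trans _ _ (1 `^ e)); last by rewrite powR1.
by rewrite ge0_ler_powR ?nnegrE ?(ltW e0)// sin_max.
Qed.

Lemma sinker_ge0 (e x : R) : 0 <= sinker e x.
Proof. exact: powR_ge0. Qed.

(* As e -> 0, e |sin x|^(e-1) tends to twice the Dirac masses at the zeros of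
   sin. *)
Lemma concentration (G : R -> R[i]) (z : R[i]) (M : R) : (forall u, ccont G u) ->
  (forall u, cmod (G u) <= M) -> (forall u, sin (g u) = 0 -> G u = z) ->
  cvgc (fun n => (eps R n)%:C * cintegral `[0%R, pi] (fun u => (sinker (eps R n) (g u))%:C * G u))
    (2 * z).
Proof.
move=> cG GM Gz; apply/cvgcP => r r0.
have M0 : 0 <= M by exact: le_trans (cmod_ge0 _) (GM 0).
have M1 : 0 <= M + cmod z by rewrite addr_ge0// cmod_ge0.
have t0 : 0 < r / 8 by rewrite divr_gt0.
(* G differs from z by at most r/8 plus a multiple of |sin g|, and |sin g| cancels the singularity
   of the kernel. *)
have [C C0 hC] := @away_from_zeros (fun u => cmod (G u - z)) (M + cmod z) (r / 8)
  (fun u => ccont_cmod (ccontB (cG u) (ccont_cst z u)))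
  (fun u => le_trans (ler_cmodB _ _) (lerD (GM u) (lexx _)))
  (fun u h => etrans (congr1 (fun w => cmod (w - z)) (Gz u h))
     (etrans (congr1 (@cmod R) (subrr z)) (@cmod0 R))) t0 M1.
(* The total error will be at most r/4 + e C'; the defining equation is kept apart so that [C']
   stays opaque. *)
have [C' C'E] : exists C', C' = r / 8 * K + C * pi + K * cmod z by eexists.
have C'0 : 0 <= C'.
  by rewrite C'E !addr_ge0// mulr_ge0 ?cmod_ge0 ?pi_ge0// ltW.
have q0 : 0 < r / (2 * (C' + 1)) by rewrite divr_gt0// mulr_gt0// ltr_wpDl.
near=> n; have eu := eps01 R n; set e := eps R n in eu *.
have e0 : 0 < e by case/andP: eu.
have eC : e * (C' + 1) < r / 2.
  have : e < r / (2 * (C' + 1)).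
    by rewrite /e; near: n; exact: near_eps.
  by rewrite invfM mulrA ltr_pdivlMr// ltr_wpDl.
have [ki /andP[S1 S2]] := gK eu.
set k := fun u => sinker e (g u); rewrite -/k in ki S1 S2.
have k0 u : 0 <= k u by exact: sinker_ge0.
set S := \int[mu]_(u in `[0, pi]) k u in S1 S2 *.
have cD u : ccont (fun u => G u - z) u by apply: ccontB => //; exact: ccont_cst.
have DM u : cmod (G u - z) <= M + cmod z.
  by apply: le_trans (ler_cmodB _ _) _; rewrite lerD2r.
have iD : cintble `[0%R, pi] (fun u => (k u)%:C * (G u - z)).
  by apply: (@kint_cintble R k (fun _ u => G u - z) (M + cmod z) k0 ki _ _ 0).
have iz : cintble `[0%R, pi] (fun u => (k u)%:C * z).
  by apply: (@kint_cintble R k (fun _ u => z) (cmod z) k0 ki _ _ 0) => // _ u; exact: ccont_cst.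
have -> : cintegral `[0%R, pi] (fun u => (sinker e (g u))%:C * G u) =
    cintegral `[0%R, pi] (fun u => (k u)%:C * (G u - z)) + S%:C * z.
  transitivity (cintegral `[0%R, pi] (fun u => (k u)%:C * (G u - z) + (k u)%:C * z)).
    by apply: eq_cintegral => u _; rewrite -mulrDr subrK.
  rewrite cintegralD//; congr (_ + _).
  under [LHS]eq_cintegral do rewrite mulrC.
  rewrite cintegralZ//; first by rewrite mulrC; congr (_ * _); exact: cint_real.
  split; first exact: ki.
  apply: (@eq_intble R _ (fun=> 0)) => //.
  by apply: cont_integrable => x _; exact: cst_continuous.
set I := cintegral _ _.
have Ile : cmod I <= r / 8 * S + C * pi.
  have ui : mu.-integrable `[0%R, pi] (EFin \o (fun u => r / 8 * k u)) by exact: intbleZ.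
  have ci : mu.-integrable `[0%R, pi] (EFin \o (fun u : R => C)).
    by apply: cont_integrable => x _; exact: cst_continuous.
  apply: (@le_trans _ _ (\int[mu]_(u in `[0, pi]) (r / 8 * k u + C))).
    apply: le_cmod_cintegral => //; first exact: intbleD.
    move=> u /=; rewrite in_itv/= => hu; rewrite cmodM cmodC ger0_norm//.
    apply: (@le_trans _ _ (k u * (r / 8 + C * `|sin (g u)|))).
      by rewrite ler_wpM2l// hC.
    rewrite mulrDr mulrC lerD2l mulrCA -[leRHS]mulr1 ler_wpM2l//.
    exact: sinker_mul_sin.
  rewrite RintegralD// RintegralZl// lerD2l Rintegral_cst//= lebesgue_measure_itv /= lte_fin.
  by rewrite pi_gt0 /= subr0.
have -> : e%:C * (I + S%:C * z) - 2 * z = e%:C * I + (e * S - 2)%:C * z.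
  by rewrite rmorphB rmorphM rmorph_nat; ring.
apply: le_lt_trans (ler_cmodD _ _) _; rewrite !cmodM !cmodC (gtr0_norm e0).
have eS : 0 <= e * S - 2 <= e * K.
  have h1 : e * (2 / e) = 2 by rewrite mulrCA divff ?mulr1 ?gt_eqF.
  have h2 : e * (2 / e) <= e * S by rewrite ler_pM2l.
  have h3 : e * S <= e * (2 / e + K) by rewrite ler_pM2l.
  by rewrite subr_ge0 lerBlDl -{1}h1 h2 -[X in _ <= X + _]h1 -mulrDr h3.
case/andP: eS => eS0 eS1; rewrite (ger0_norm eS0).
have h1 : e * cmod I <= e * (r / 8 * S + C * pi) by rewrite ler_pM2l.
have h2 : (e * S - 2) * cmod z <= e * K * cmod z by rewrite ler_wpM2r// cmod_ge0.
have h3 : r / 8 * (e * S) <= r / 8 * (2 + e * K) by rewrite ler_pM2l//; lra.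
rewrite C'E in eC; nra.
Unshelve. all: by end_near.
Qed.

End Concentration.

(** * The operators B and C for n = 2 *)

Section TwoSphere.
Variable R : realType.
Implicit Types (t u : R).

Lemma circ_neq0 u : circ u != 0.
Proof.
apply: snoc_neq0; have := sin_cos_neq0 u; have [->|s0] := eqVneq (sin u) 0.
  by move=> /= ->; rewrite orbT.
move=> _; apply/orP; left; apply/eqP => /(congr1 (fun x : 'rV[R]_1 => x 0 0)) /eqP.
by rewrite !mxE (negbTE s0).
Qed.

Definition sph t u : 'rV[R]_3 := snoc (sin t *: circ u) (cos t).

Lemma sph_neq0 t u : sph t u != 0.
Proof. by apply: snoc_neq0; rewrite scaler_eq0 negb_or circ_neq0 andbT sin_cos_neq0. Qed.

Lemma sph0 t u : sph t u 0 (@Ordinal 3 0 isT) = sin t * sin u.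
Proof.
rewrite (_ : Ordinal _ = lift ord_max (ord0 : 'I_2)); last exact: val_inj.
by rewrite snoc_lift mxE circ0.
Qed.

Lemma sph1 t u : sph t u 0 (@Ordinal 3 1 isT) = sin t * cos u.
Proof.
rewrite (_ : Ordinal _ = lift ord_max (ord_max : 'I_2)); last exact: val_inj.
by rewrite snoc_lift mxE circ1.
Qed.

Lemma sph2 t u : sph t u 0 (@Ordinal 3 2 isT) = cos t.
Proof.
rewrite (_ : Ordinal _ = ord_max :> 'I_3); last exact: val_inj.
exact: snoc_last.
Qed.

Lemma sphere_integral2E (f : 'rV[R]_3 -> R[i]) :
  @sphere_integral R 2 f = cint 0 pi (fun t => (sin t)%:C *
    cint 0 pi (fun u => f (sph t u) + f (sph t (- u)))).
Proof.
have -> : @sphere_integral R 2 f = cint 0 pi (fun t => (sin t ^+ 1)%:C *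
    @sphere_integral R 1 (fun eta => f (snoc (sin t *: eta) (cos t)))) by [].
by apply: eq_cint => t _; rewrite circle_integralE.
Qed.

Variable phi : Cinfty R 3.
Definition Phi t u : R[i] := at_line phi (sph t u).

Lemma Phi_cont1 u t : ccont (Phi^~ u) t.
Proof. exact: (@arc_cont R 2 phi (circ u) (circ_neq0 u) t). Qed.

Lemma Phi_cont2 t u : ccont (Phi t) u.
Proof.
apply: (@at_line_ccont R 3 phi (sph t)); last exact: sph_neq0.
move=> i; case: (unliftP ord_max i) => [l ->|->].
- rewrite (_ : (fun t => _) = (fun u => sin t * circ u 0 l)).
    apply: continuousM; first exact: cst_continuous.
    case: (unliftP ord_max l) => [k ->|->].
    + rewrite (_ : (fun t => _) = @sin R); first exact: continuous_sin.
      by apply/funext => x; rewrite snoc_lift mxE.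
    + rewrite (_ : (fun t => _) = @cos R); first exact: continuous_cos.
      by apply/funext => x; rewrite snoc_last.
  by apply/funext => x; rewrite snoc_lift mxE.
- rewrite (_ : (fun _ => _) = (fun=> cos t)); first exact: cst_continuous.
  by apply/funext => x; rewrite snoc_last.
Qed.

Lemma Phi_bounded : exists M : R, forall t u, cmod (Phi t u) <= M.
Proof.
have [M hM] := at_line_bounded phi; exists M => t u; apply: hM; exact: sph_neq0.
Qed.

End TwoSphere.

Section ClaimBC.
Variables (R : realType) (B C : opfamily R 2).
Hypothesis hB : is_B B.
Hypothesis hC : is_C C.
Variables (phi : Cinfty R 3) (y : 'rV[R]_2).
Hypothesis y0 : y != 0.

Let rho1E : rho1 R 2 = 3 / 2. Proof. by []. Qed.
Let rho1'E : rho1' R 2 = 1. Proof. by rewrite /rho1' divff// pnatr_eq0. Qed.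

Lemma rGamma_half : rGamma (2^-1 : R[i]) = ((Num.sqrt (pi : R))%:C)^-1.
Proof. by rewrite rGammaE ?Gamma_half// -[2^-1]mul1r Re_half /= divr_gt0. Qed.

Lemma sqrt_pi_neq0 : (Num.sqrt (pi : R))%:C != 0 :> R[i].
Proof. by rewrite -cmod_eq0 cmodC normr_eq0 gt_eqF// sqrtr_gt0 pi_gt0. Qed.

Let pair_integral t := cint 0 pi (fun u => Phi phi t u + Phi phi t (- u)).

Let Psi_cont t u : ccont (fun u => Phi phi t u + Phi phi t (- u)) u.
Proof.
apply: ccontD; first exact: Phi_cont2.
apply: (ccont_comp (f := Phi phi t)); [exact: opp_continuous|exact: Phi_cont2].
Qed.

Lemma pair_integral_cont t : ccont pair_integral t.
Proof.
have [M hM] := Phi_bounded phi.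
have := @kint_cont R (fun=> 1) (fun t u => Phi phi t u + Phi phi t (- u)) (M + M).
move=> /(_ _ _ _ _ _ t).
have H : kint (fun=> 1) (fun t u => Phi phi t u + Phi phi t (- u)) = pair_integral.
  by apply/funext => x; apply: eq_cintegral => u _; rewrite mul1r.
rewrite H; apply.
- by move=> _; exact: ler01.
- by apply: cont_integrable => x _; exact: cst_continuous.
- by move=> u x; apply: ccontD; exact: Phi_cont1.
- by move=> x u; exact: Psi_cont.
- by move=> x u; apply: le_trans (ler_cmodD _ _) _; apply: lerD.
Qed.

(** A kernel in the last coordinate alone comes out of the integral over parallels. This common form
    serves B and, at nu_1 = -1, C. *)
Lemma sphere_pairing (K b : R[i]) : 1 < Re b ->
  @sphere_integral R 2 (fun w => K * cpow `|w 0 (@Ordinal 3 2 isT)| (b - 1) * at_line phi w) =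
  K * cint 0 pi (fun t => (sin t)%:C * cpow `|cos t| (b - 1) * pair_integral t).
Proof.
move=> b1; rewrite sphere_integral2E /cint -cintegralZ//; last first.
  apply: ccont_cintble => t _; apply: ccontM; last exact: pair_integral_cont.
  apply: ccontM; first by apply: ccont_real; exact: continuous_sin.
  by apply: ccont_abs_pow; [exact: continuous_cos|exact: Re_sub1_gt0].
apply: eq_cintegral => t _.
rewrite (@eq_cintegral R _ _ (fun u => K * cpow `|cos t| (b - 1) * (Phi phi t u + Phi phi t (- u)))).
  rewrite cintegralZ//; first by rewrite /pair_integral /cint; ring.
  by apply: ccont_cintble => u _; exact: Psi_cont.
by move=> u _; rewrite !sph2 /Phi; ring.
Qed.

(** At nu_1 = -1 the first kernel of C has exponent 0 and normalization 1/Gamma(1/2). The exponents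
    of the last coordinate agree because rho_1 = 3/2 makes lambda_1 + rho_1 - 2 equal to lambda_1 -
    rho_1 + 1. *)
Lemma claim_BC_right (lam nu : C2 R) : nu.1 + rho1' R 2 = 0 -> 4 < Re lam.1 ->
  at_line (B lam nu phi) y = (Num.sqrt (pi : R))%:C * at_line (C lam nu phi) y.
Proof.
rewrite rho1'E => nu0 l4; have nu1 : nu.1 = -1 by apply/eqP; rewrite -addr_eq0 nu0.
have [_ ->] := hB phi y0; last first.
  by rewrite /B_domain /= rho1E ReD ReB Re_half Re_nat /=; lra.
have [_ ->] := hC phi y0; last first.
  rewrite /C_domain /= rho1E rho1'E nu1 opprK subrr add0r /=; split; first exact: ltr01.
  by rewrite !ReD !ReN Re_half Re_nat /=; lra.
have b1 : 1 < Re (lam.1 - rho1 R 2 + 1) by rewrite rho1E ReD ReB Re_half Re_nat /=; lra.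
rewrite /B_integral /C_integral rho1'E nu1 opprK subrr.
have -> : lam.1 + rho1 R 2 + -1 - 1 = lam.1 - rho1 R 2 + 1 by rewrite rho1E; field.
set b := lam.1 - rho1 R 2 + 1 in b1 *.
rewrite (_ : lam.1 - rho1 R 2 = b - 1); last by rewrite /b addrK.
have E1 := sphere_pairing 1 b1.
have E2 := sphere_pairing ((Num.sqrt (pi : R))%:C^-1 * rGamma (b / 2) / 2) b1.
have -> : (fun w : 'rV[R]_3 => cpow `|w 0 ord_max| (b - 1) * at_line phi w) =
    (fun w => 1 * cpow `|w 0 (@Ordinal 3 2 isT)| (b - 1) * at_line phi w).
  apply/funext => w; rewrite mul1r; congr (cpow `|w 0 _| _ * _); exact: val_inj.
rewrite E1 mul1r.
rewrite (_ : (fun w => _) = (fun w : 'rV[R]_3 => (Num.sqrt (pi : R))%:C^-1 * rGamma (b / 2) / 2 *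
    cpow `|w 0 (@Ordinal 3 2 isT)| (b - 1) * at_line phi w)); last first.
  by apply/funext => w; rewrite cpowr0 add0r !mul1r rGamma_half; ring.
by rewrite E2; field; exact: sqrt_pi_neq0.
Qed.

Lemma C_line (p d : C2 R * C2 R) w0 :
  holoat (fun w => at_line (C (p + w *: d).1 (p + w *: d).2 phi) y) w0.
Proof.
by apply: (@differentiable_holo R (fun q => at_line (C q.1 q.2 phi) y)) => q; have [h _] := hC phi y0; exact: h.
Qed.

Lemma claim_BC (lam nu : C2 R) : nu.1 + rho1' R 2 = 0 ->
  at_line (B lam nu phi) y = (Num.sqrt (pi : R))%:C * at_line (C lam nu phi) y.
Proof.
move=> nu0.
suff H l : at_line (B (l, lam.2) nu phi) y =
    (Num.sqrt (pi : R))%:C * at_line (C (l, lam.2) nu phi) y.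
  by have := H lam.1; rewrite -surjective_pairing.
have lineE w : ((0, lam.2), (nu.1, nu.2)) + w *: ((1, 0), (0, 0)) = ((w, lam.2), nu).
  by rewrite pair_lineE !mulr0 !addr0 mulr1 add0r -surjective_pairing.
move: l; apply: (@entire_identity R _ _ 4) => l.
- have := @differentiable_holo R (fun q => at_line (B q.1 q.2 phi) y)
    ((0, lam.2), (nu.1, nu.2)) ((1, 0), (0, 0)) l (fun q => (hB phi y0).1 q).
  by apply: eq_holo => w; rewrite lineE.
- apply: holoZ; have := C_line ((0, lam.2), (nu.1, nu.2)) ((1, 0), (0, 0)) l.
  by apply: eq_holo => w; rewrite lineE.
- by move=> l4; apply: claim_BC_right.
Qed.

End ClaimBC.

(** * Polar form of y with a signed radius *)

Section PolarForm.
Variable R : realType.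

(** The sign of c keeps al in [0, pi], the range of [sincut_shift]. As [circ al] is (sin al, cos
    al), c is negative exactly when the first coordinate of y is. *)
Lemma polar2 (y : 'rV[R]_2) : exists al c : R,
  [/\ 0 <= al <= pi, `|c| = enorm y & y = c *: circ al].
Proof.
have [->|y0] := eqVneq y 0.
  exists 0, 0; split; rewrite ?lexx ?pi_ge0 ?scale0r//.
  by rewrite normr0 /enorm big1 ?sqrtr0// => i _; rewrite mxE expr0n.
have r0 := enorm_gt0 y0; set r := enorm y in r0 *.
pose p := y 0 ord0 / r; pose q := y 0 ord_max / r.
have pq : p ^+ 2 + q ^+ 2 = 1.
  have : r ^+ 2 = y 0 ord0 ^+ 2 + y 0 ord_max ^+ 2.
    rewrite /r enorm_sqr big_ord_recl big_ord1.
    by congr (_ + y 0 _ ^+ 2); exact: val_inj.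
  by rewrite /p /q !expr_div_n -mulrDl => <-; rewrite divff// expf_neq0// gt_eqF.
have rowE (al c : R) : y 0 ord0 = c * sin al -> y 0 ord_max = c * cos al -> y = c *: circ al.
  move=> h0 h1; apply/rowP => i; rewrite mxE.
  have [->|->] : i = ord0 \/ i = ord_max.
    by case: i => [[|[|//]] hi]; [left|right]; exact: val_inj.
  - by rewrite circ0.
  - by rewrite circ1.
have yp : y 0 ord0 = r * p by rewrite /p mulrC divfK// gt_eqF.
have yq : y 0 ord_max = r * q by rewrite /q mulrC divfK// gt_eqF.
have q1 : -1 <= q <= 1 by have := sqr_ge0 p; nra.
have sq (x : R) : x ^+ 2 = q ^+ 2 -> -1 <= x <= 1 -> sin (acos x) = `|p|.
  move=> xq hx; rewrite sin_acos// xq (_ : 1 - q ^+ 2 = p ^+ 2) ?sqrtr_sqr//.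
  by rewrite -pq addrK.
have [p0|p0] := leP 0 p.
- exists (acos q), r; split; first by rewrite acos_ge0//= acos_lepi.
    by rewrite gtr0_norm.
  by apply: rowE; rewrite ?sq ?acosK// ger0_norm.
- have q1' : -1 <= - q <= 1 by lra.
  exists (acos (- q)), (- r); split; first by rewrite acos_ge0//= acos_lepi.
    by rewrite normrN gtr0_norm.
  by apply: rowE; rewrite ?sq ?sqrrN ?acosK// ?mulrNN// ltr0_norm// mulrNN.
Qed.

Lemma sin_sub_eq0 (a b : R) : sin (a - b) = 0 ->
  circ b = circ a \/ circ b = - circ a.
Proof.
move=> s0; have c1 : cos (a - b) ^+ 2 = 1.
  by have := cos2Dsin2 (a - b); rewrite s0 expr0n addr0.
have bE : b = a - (a - b) by ring.
have sE : sin b = sin a * cos (a - b).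
  by rewrite {1}bE sinB s0 mulr0 subr0.
have cE : cos b = cos a * cos (a - b).
  by rewrite {1}bE cosB s0 mulr0 addr0.
have : (cos (a - b) == 1) || (cos (a - b) == -1) by rewrite -sqrf_eq1 c1.
rewrite /circ => /orP[|] /eqP h; rewrite sE cE h ?mulr1 ?mulrN1; [by left|right].
by rewrite -snocN; congr snoc; apply/rowP => i; rewrite !mxE.
Qed.

Lemma evenarcN n (phi : Cinfty R n.+1) (v : 'rV[R]_n) t : evenarc phi (- v) t = evenarc phi v t.
Proof. by rewrite /evenarc /arc !sinN !cosN !scalerN !scaleNr opprK addrC. Qed.

End PolarForm.

(** * C = sqrt(pi) A at nu_1 = 0 as a limit of singular integrals *)

Section ClaimAC.
Variables (R : realType) (A C : opfamily R 2).
Hypothesis hA : is_A A.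
Hypothesis hC : is_C C.
Variables (phi : Cinfty R 3) (y : 'rV[R]_2).
Hypothesis y0 : y != 0.
Variables (al c : R).
Hypothesis hal : 0 <= al <= pi.
Hypothesis hc : `|c| = enorm y.
Hypothesis yE : y = c *: circ al.
Notation mu := (@lebesgue_measure R).

Let rG := rGamma_holo hA.
Let c0 : c != 0. Proof. by rewrite -normr_gt0 hc enorm_gt0. Qed.

Let rho1E : rho1 R 2 = 3 / 2. Proof. by []. Qed.
Let rho1'E : rho1' R 2 = 1. Proof. by rewrite /rho1' divff// pnatr_eq0. Qed.

Let F := Phi phi.
Let z t := evenarc phi (circ al) t.

Lemma evenarc_unit t : evenarc phi ((enorm y)^-1 *: y) t = z t.
Proof.
rewrite -hc yE scalerA /z.
have [cp|cn] := ltP 0 c.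
  by rewrite gtr0_norm// mulVf// scale1r.
have cn' : c < 0 by rewrite lt_neqAle c0.
by rewrite ltr0_norm// invrN mulNr mulVf// scaleN1r evenarcN.
Qed.

(** [k1] and [k2] are the kernel on the half-circles u and -u into which [circle_integralE] splits
    each parallel. *)
Let k1 (e u : R) := sinker e (al - u).
Let k2 (e u : R) := sinker e (al + u).
Let T e t := kint (k1 e) F t + kint (k2 e) (fun t u => F t (- u)) t.

Let k1i e : 0 < e < 1 -> mu.-integrable `[0%R, pi] (EFin \o k1 e).
Proof. by move=> e01; have [h _] := sinker_integral_sub e01 hal; exact: h. Qed.
Let k2i e : 0 < e < 1 -> mu.-integrable `[0%R, pi] (EFin \o k2 e).
Proof. by move=> e01; have [h _] := sinker_integral_add e01 hal; exact: h. Qed.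
Let k10 e u : 0 <= k1 e u. Proof. exact: sinker_ge0. Qed.
Let k20 e u : 0 <= k2 e u. Proof. exact: sinker_ge0. Qed.

Let F1 u t : ccont (fun t => F t u) t. Proof. exact: Phi_cont1. Qed.
Let F2 t u : ccont (F t) u. Proof. exact: Phi_cont2. Qed.
Let F1' u t : ccont (fun t => F t (- u)) t. Proof. exact: Phi_cont1. Qed.
Let F2' t u : ccont (fun u => F t (- u)) u.
Proof. by apply: (ccont_comp (f := F t)); [exact: opp_continuous|exact: F2]. Qed.

Let T_cont e t : 0 < e < 1 -> ccont (T e) t.
Proof.
move=> e01; have [M hM] := Phi_bounded phi; apply: ccontD.
- exact: (kint_cont (k10 e) (k1i e01) F1 F2 hM).
- exact: (kint_cont (k20 e) (k2i e01) F1' F2' (fun t u => hM t (- u))).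
Qed.

Let sin_norm (t : R) : 0 <= t <= pi -> `|sin t| = sin t.
Proof. by move=> ht; rewrite ger0_norm// sin_ge0_pi. Qed.

(** In these coordinates w_2 y_1 - w_1 y_2 = c sin t sin(al - u), so the kernel separates; the sin t
    of the surface measure raises |sin t|^{e-1} to |sin t|^e. *)
Lemma C_integral_polar (lam nu : C2 R) (e : R) : 0 < e < 1 -> nu.1 = - e%:C ->
  let b := lam.1 + rho1 R 2 + nu.1 - rho1' R 2 in
  C_integral lam nu phi y = cint 0 pi (fun t =>
    (rGamma (e%:C / 2) * rGamma (b / 2) / 2) *
    (cpow `|cos t| (b - 1) * (`|sin t| `^ e)%:C * T e t)).
Proof.
move=> e01 nuE b; have [M hM] := Phi_bounded phi.
have e0 : 0 < e by case/andP: e01.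
rewrite /C_integral sphere_integral2E; apply: eq_cint => t ht.
have kerE (u : R) : `|(sin t * cos u * y 0 (@Ordinal 2 0 isT) - sin t * sin u * y 0 (@Ordinal 2 1 isT))
    / enorm y| = `|sin t| * `|sin (al - u)|.
  rewrite (_ : Ordinal _ = ord0); last exact: val_inj.
  rewrite (_ : @Ordinal 2 1 _ = ord_max); last exact: val_inj.
  have -> : y 0 ord0 = c * sin al by rewrite yE mxE circ0.
  have -> : y 0 ord_max = c * cos al by rewrite yE mxE circ1.
  rewrite -hc normrM normfV normr_id.
  rewrite (_ : _ - _ = c * (sin t * sin (al - u))); last by rewrite sinB; ring.
  by rewrite !normrM mulrAC divff ?mul1r// normr_eq0.
set kap := rGamma (e%:C / 2) * _ / 2.
set w := cpow `|cos t| (b - 1).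
rewrite (_ : cint 0 pi _ = kap * w * (`|sin t| `^ (e - 1))%:C * T e t); last first.
  rewrite /T /kint -cintegralD//; last 2 first.
  - exact: (kint_cintble (k10 e) (k1i e01) F2 hM t).
  - exact: (kint_cintble (k20 e) (k2i e01) F2' (fun t u => hM t (- u)) t).
  rewrite -cintegralZ//; last first.
    apply: cintbleD => //.
    - exact: (kint_cintble (k10 e) (k1i e01) F2 hM t).
    - exact: (kint_cintble (k20 e) (k2i e01) F2' (fun t u => hM t (- u)) t).
  apply: eq_cintegral => u _; rewrite !sph0 !sph1 !sph2 !kerE opprK -/b -/w nuE opprK rho1'E.
  have -> : e%:C - 1 = (e - 1)%:C by rewrite rmorphB rmorph1.
  rewrite (_ : (e - 1)%:C + 1 = e%:C); last by rewrite rmorphB rmorph1 subrK.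
  by rewrite -/kap !cpow_real !powRM// /k1 /k2 /sinker /F /Phi !rmorphM; ring.
have -> : `|sin t| `^ e = sin t * `|sin t| `^ (e - 1).
  by rewrite -{2}(sin_norm ht) mulr_powRB1.
by rewrite rmorphM; ring.
Qed.

(** The factor e, taken from 1/Gamma(e/2) = (e/2)/Gamma(e/2 + 1), keeps [h] bounded as e tends to
    0. *)
Let h (b : R[i]) (e t : R) : R[i] := cpow `|cos t| (b - 1) * (`|sin t| `^ e)%:C *
  (e%:C * (T e t + T e (pi - t))).

Let weight_cont (b : R[i]) (e t : R) : 1 < Re b -> 0 < e ->
  ccont (fun t => cpow `|cos t| (b - 1) * (`|sin t| `^ e)%:C) t.
Proof.
move=> b1 e0; apply: ccontM.
  by apply: ccont_abs_pow; [exact: continuous_cos|exact: Re_sub1_gt0].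
have := @ccont_abs_pow R (@sin R) e%:C t (@continuous_sin R t) e0.
by congr ccont; apply/funext => x; rewrite cpow_real.
Qed.

Let h_cont (b : R[i]) (e t : R) : 1 < Re b -> 0 < e < 1 -> ccont (h b e) t.
Proof.
move=> b1 e01; have e0 : 0 < e by case/andP: e01.
apply: ccontM; first exact: weight_cont.
apply: ccontM; first exact: ccont_cst.
apply: ccontD; first exact: T_cont.
by apply: (ccont_comp (f := T e)); [exact: cont_sub|exact: T_cont].
Qed.

(* Averaging over t and pi - t replaces phi by its symmetrization, which takes
   the same value at the two zeros u = al, al + pi of the kernel. *)
Lemma C_integral_sym (lam nu : C2 R) (e : R) : 0 < e < 1 -> nu.1 = - e%:C ->
  let b := lam.1 + rho1 R 2 + nu.1 - rho1' R 2 in 1 < Re b ->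
  C_integral lam nu phi y =
    rGamma (e%:C / 2 + 1) * (rGamma (b / 2) / 8 * cint 0 pi (h b e)).
Proof.
move=> e01 nuE b b1; rewrite (C_integral_polar lam e01 nuE) -/b.
have e0 : 0 < e by case/andP: e01.
pose q t := cpow `|cos t| (b - 1) * (`|sin t| `^ e)%:C * T e t.
have cq t : ccont q t by apply: ccontM; [exact: weight_cont|exact: T_cont].
have cq' t : ccont (fun t => q (pi - t)) t.
  by apply: (ccont_comp (f := q)); [exact: cont_sub|exact: cq].
have iq : cintble `[0%R, pi] q by apply: ccont_cintble.
have iq' : cintble `[0%R, pi] (fun t => q (pi - t)) by apply: ccont_cintble.
have -> : cint 0 pi (h b e) = e%:C * (cint 0 pi q + cint 0 pi q).
  rewrite {2}(_ : cint 0 pi q = cint 0 pi (fun t => q (pi - t))); last first.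
    by rewrite -cint_reflect ?pi_ge0// subrr subr0.
  rewrite /cint -cintegralD; [|exact: measurable_itv|exact: iq|exact: iq'].
  rewrite -cintegralZ; [|exact: measurable_itv|exact: cintbleD].
  by apply: eq_cintegral => t _; rewrite /q /h cos_pi_sub sin_pi_sub normrN; ring.
rewrite /cint cintegralZ; [|exact: measurable_itv|exact: iq].
rewrite -/(cint 0 pi q) (rGamma_recT rG (e%:C / 2)).
by field.
Qed.

Let K : R := 2 * pi + 1.

(** e times the mass 2/e + K is at most 2 + K, uniformly in e; the outer 2 counts the kernels. *)
Let T_bound (M e t : R) : (forall t u, cmod (F t u) <= M) -> 0 < e < 1 ->
  cmod (e%:C * T e t) <= 2 * (M * (2 + K)).
Proof.
move=> hM e01; have /andP[e0 e1] := e01.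
have M0 : 0 <= M by exact: le_trans (cmod_ge0 _) (hM 0 0).
have K0 : 0 <= K by rewrite /K addr_ge0// mulr_ge0// pi_ge0.
have H (S : R) : S <= 2 / e + K -> e * (M * S) <= M * (2 + K).
  move=> hS; rewrite mulrCA ler_wpM2l//.
  apply: (@le_trans _ _ (e * (2 / e + K))); first by rewrite ler_pM2l.
  rewrite mulrDr mulrCA divff ?gt_eqF// mulr1 lerD2l ler_piMl//; exact: ltW.
have [_ /andP[_ S1]] := sinker_integral_sub e01 hal.
have [_ /andP[_ S2]] := sinker_integral_add e01 hal.
rewrite cmodM cmodC gtr0_norm//.
have h1 := kint_le (k10 e) (k1i e01) F2 hM t.
have h2 := kint_le (k20 e) (k2i e01) F2' (fun t u => hM t (- u)) t.
apply: (@le_trans _ _ (e * (M * \int[mu]_(u in `[0, pi]) k1 e u +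
    M * \int[mu]_(u in `[0, pi]) k2 e u))).
  rewrite (ler_pM2l e0); apply: le_trans (ler_cmodD _ _) _.
  by apply: lerD; [exact: h1|exact: h2].
rewrite mulrDr [leRHS]mulr_natl mulr2n; apply: lerD; [exact: (H _ S1)|exact: (H _ S2)].
Qed.

Let h_bound (M : R) (b : R[i]) (e t : R) : (forall t u, cmod (F t u) <= M) -> 1 < Re b -> 0 < e < 1 ->
  cmod (h b e t) <= 4 * (M * (2 + K)).
Proof.
move=> hM b1 e01; have /andP[e0 e1] := e01.
have B1 (x r : R) : 0 <= x <= 1 -> 0 <= r -> x `^ r <= 1.
  move=> /andP[x0 x1] r0; have <- : 1 `^ r = 1 :> R by rewrite powR1.
  by rewrite ge0_ler_powR ?nnegrE.
rewrite /h cmodM cmodM cmod_cpow cmodC [`| _ `^ _|]ger0_norm ?powR_ge0//.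
have w1 : `|cos t| `^ Re (b - 1) * `|sin t| `^ e <= 1.
  rewrite -[leRHS]mulr1 ler_pM ?powR_ge0// B1 ?normr_ge0 ?cos_max ?sin_max ?(ltW e0)//.
  by rewrite ltW// Re_sub1_gt0.
have hT := T_bound t hM e01; have hT' := T_bound (pi - t) hM e01.
rewrite mulrDr; set X := cmod _.
have XB : X <= 2 * (M * (2 + K)) + 2 * (M * (2 + K)).
  by apply: le_trans (ler_cmodD _ _) _; exact: lerD.
apply: (@le_trans _ _ X).
  by rewrite ler_piMl// /X cmod_ge0.
by apply: le_trans XB _; lra.
Qed.

(** Here [circ u] is [circ al] up to sign. The points for t and pi - t represent the two summands of
    [evenarc], and the sign only exchanges them. *)
Let pair_zero (t u : R) : sin (al - u) = 0 -> F t u + F (pi - t) u = z t.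
Proof.
move=> s0; rewrite /z /evenarc /arc /F /Phi /sph sin_pi_sub cos_pi_sub sinN cosN.
have E (v : 'rV[R]_2) : at_line phi (snoc (sin t *: v) (- cos t)) =
    at_line phi (snoc (- sin t *: v) (cos t)).
  by rewrite -at_line_opp -snocN opprK scaleNr.
rewrite E; have [->|->] := sin_sub_eq0 s0; first by [].
by rewrite !scalerN !scaleNr opprK addrC.
Qed.

Let h_cvg (b : R[i]) (t : R) : 0 < t < pi ->
  cvgc (fun n => h b (eps R n) t) (cpow `|cos t| (b - 1) * (4 * z t)).
Proof.
move=> /andP[t0 tp]; have s0 : 0 < sin t by rewrite sin_gt0_pi// t0.
have [M hM] := Phi_bounded phi.
have -> : cpow `|cos t| (b - 1) * (4 * z t) =
    cpow `|cos t| (b - 1) * 1 * (2 * z t + 2 * z t) by ring.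
apply: cvgcM; first (apply: cvgcM; first exact: cvgc_cst).
  (* Written as an exponential in e, |sin t|^e is holomorphic in e and tends to 1, as sin t > 0. *)
  have -> : (fun n => (`|sin t| `^ eps R n)%:C) = (fun n => expC ((ln `|sin t|)%:C * (eps R n)%:C)).
    by apply/funext => n; rewrite -cpow_real cpowE ?normr_gt0 ?gt_eqF// mulrC.
  rewrite -[1 in X in cvgc _ X](expC0 R) -[0 in X in cvgc _ X](mulr0 (ln `|sin t|)%:C).
  apply: (@holo_cvgc R (fun w => expC ((ln `|sin t|)%:C * w))).
    apply: (holo_comp (g := @expC R)); first exact: holo_exp.
    by apply: holoZ; exact: holo_id.
  by apply/cvgcP => e /near_eps; apply: filterS => n; rewrite subr0 cmodC gtr0_norm// invr_gt0.
pose G u := F t u + F (pi - t) u.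
have cG u : ccont G u by apply: ccontD; exact: F2.
have cG' u : ccont (fun u => G (- u)) u.
  by apply: (ccont_comp (f := G)); [exact: opp_continuous|exact: cG].
have GM u : cmod (G u) <= M + M by apply: le_trans (ler_cmodD _ _) _; exact: lerD.
have c1 := @concentration R (fun u => al - u) K (@cont_sub R al)
  (fun e e01 => sinker_integral_sub e01 hal) G (z t) (M + M) cG GM (@pair_zero t).
have ca u : {for u, continuous (fun u : R => al + u)}.
  by apply: continuousD; [exact: cst_continuous|exact: cvg_id].
have pz u : sin (al + u) = 0 -> G (- u) = z t.
  by move=> hu; apply: pair_zero; rewrite opprK.
have c2 := @concentration R (fun u => al + u) K ca
  (fun e e01 => sinker_integral_add e01 hal) (fun u => G (- u)) (z t) (M + M) cG'
  (fun u => GM (- u)) pz.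
have := cvgcD c1 c2; congr cvgc; apply/funext => n; rewrite -mulrDr; congr (_ * _).
have e01 := eps01 R n.
rewrite /T addrACA /kint; congr (_ + _).
- rewrite -cintegralD//; last 2 first.
  + exact: (kint_cintble (k10 _) (k1i e01) F2 hM t).
  + exact: (kint_cintble (k10 _) (k1i e01) F2 hM (pi - t)).
  by apply: eq_cintegral => u _; rewrite -mulrDr.
- rewrite -cintegralD//; last 2 first.
  + exact: (kint_cintble (k20 _) (k2i e01) F2' (fun t u => hM t (- u)) t).
  + exact: (kint_cintble (k20 _) (k2i e01) F2' (fun t u => hM t (- u)) (pi - t)).
  by apply: eq_cintegral => u _; rewrite -mulrDr.
Qed.

Let z_cont t : ccont z t. Proof. by apply: evenarc_cont; exact: circ_neq0. Qed.

(** The point nu_1 = 0 is inside [A_domain] but on the boundary of [C_domain]: A is read off from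
    its integral at a = 1, and C is a limit. *)
Lemma claim_AC_right (lam nu : C2 R) : nu.1 = 0 -> 4 < Re lam.1 ->
  at_line (A lam nu phi) y = ((Num.sqrt (pi : R))^-1)%:C * at_line (C lam nu phi) y.
Proof.
move=> nuE l4; pose b := lam.1 + rho1 R 2 - rho1' R 2.
have b1 : 1 < Re b by rewrite /b rho1E rho1'E ReB ReD Re_half Re_nat /=; lra.
have b0 : 0 < Re b by exact: lt_trans b1.
have cw t : ccont (fun t => cpow `|cos t| (b - 1)) t.
  by apply: ccont_abs_pow; [exact: continuous_cos|exact: Re_sub1_gt0].
have iwz : cintble `[0%R, pi] (fun t => cpow `|cos t| (b - 1) * z t).
  by apply: ccont_cintble => t _; exact: ccontM.
pose I := cint 0 pi (fun t => cpow `|cos t| (b - 1) * z t).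
have AE : at_line (A lam nu phi) y = (Num.sqrt (pi : R))%:C^-1 * rGamma (b / 2) / 2 * I.
  have [_ ->] := hA phi y0; last first.
    by rewrite /A_domain /= nuE subr0 add0r -/b rho1'E.
  rewrite A_integral_arc nuE subr0 add0r -/b /I /cint.
  rewrite -cintegralZ; [|exact: measurable_itv|exact: iwz].
  apply: eq_cintegral => t _; rewrite evenarc_unit /trigw rho1'E subrr cpowr0 !mul1r.
  by rewrite rGamma_half.
have [M hM] := Phi_bounded phi.
(* Along (lambda_1 + e, -e) the exponent b is constant, so the weight in cos t does not change with
   e. *)
pose Cn w := at_line (C (lam.1 + w, lam.2) (- w, nu.2) phi) y.
have holoC w : holoat Cn w.
  have := @C_line R C hC phi y y0 ((lam.1, lam.2), (0, nu.2)) ((1, 0), (-1, 0)) w.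
  by apply: eq_holo => {}w; rewrite pair_lineE !mulr0 !addr0 mulr1 mulrN1 add0r.
have CnE n : Cn (eps R n)%:C = rGamma ((eps R n)%:C / 2 + 1) *
    (rGamma (b / 2) / 8 * cint 0 pi (h b (eps R n))).
  have e01 := eps01 R n; have /andP[e0 e1] := e01.
  have bE : (lam.1 + (eps R n)%:C, lam.2).1 + rho1 R 2 + (- (eps R n)%:C, nu.2).1 - rho1' R 2 = b.
    by rewrite /b /=; ring.
  rewrite /Cn; have [_ ->] := hC phi y0; last first.
    suff : 0 < Re (- - (eps R n)%:C - rho1' R 2 + 1) /\ 0 < Re b by rewrite -{1}bE.
    by rewrite rho1'E opprK subrK; split; [exact: e0|exact: b0].
  have := @C_integral_sym (lam.1 + (eps R n)%:C, lam.2) (- (eps R n)%:C, nu.2) _ e01 erefl.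
  by rewrite bE; apply.
have ceps : cvgc (fun n => (eps R n)%:C) 0.
  by apply/cvgcP => e /near_eps; apply: filterS => n; rewrite subr0 cmodC gtr0_norm// invr_gt0.
have c1 := holo_cvgc (holoC 0) ceps.
have c2 : cvgc (fun n => rGamma ((eps R n)%:C / 2 + 1)) 1.
  have L0 : rGamma (2^-1 * 0 + 1) = 1 :> R[i] by rewrite mulr0 add0r rGamma1.
  have -> : (fun n => rGamma ((eps R n)%:C / 2 + 1)) =
      (fun n => rGamma (2^-1 * (eps R n)%:C + 1)).
    by apply/funext => n; congr (rGamma (_ + _)); exact: mulrC.
  suff : cvgc (fun n => rGamma (2^-1 * (eps R n)%:C + 1)) (rGamma (2^-1 * 0 + 1)) by rewrite L0.
  exact: (@holo_cvgc R (fun w => rGamma (2^-1 * w + 1)) 0 _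
    (@holo_affine R (@rGamma R) 2^-1 1 0 (rG _)) ceps).
have c3 : cvgc (fun n => cint 0 pi (h b (eps R n)))
    (cint 0 pi (fun t => cpow `|cos t| (b - 1) * (4 * z t))).
  apply: (@cint_dominated R _ _ 0 pi (4 * (M * (2 + K)))).
  - by move=> n t _; apply: h_cont => //; exact: eps01.
  - move=> t _; apply: ccontM; first exact: cw.
    by apply: ccontM; [exact: ccont_cst|exact: z_cont].
  - by move=> n t _; apply: h_bound => //; exact: eps01.
  - by move=> t; exact: h_cvg.
have I4 : cint 0 pi (fun t => cpow `|cos t| (b - 1) * (4 * z t)) = 4 * I.
  rewrite /I /cint -cintegralZ; [|exact: measurable_itv|exact: iwz].
  by apply: eq_cintegral => t _; ring.
have c4 := cvgcM c2 (cvgcM (cvgc_cst (rGamma (b / 2) / 8)) c3).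
have CE : Cn 0 = rGamma (b / 2) / 8 * (4 * I).
  apply: (cvgc_unique c1); move: c4; rewrite mul1r I4; congr cvgc.
  by apply/funext => n; rewrite CnE.
have -> : at_line (C lam nu phi) y = Cn 0.
  by rewrite /Cn addr0 oppr0 -nuE -!surjective_pairing.
by rewrite CE AE fmorphV; field; exact: sqrt_pi_neq0.
Qed.

End ClaimAC.

Lemma claim_AC (R : realType) (A C : opfamily R 2) (hA : is_A A) (hC : is_C C)
    (phi : Cinfty R 3) (y : 'rV[R]_2) (y0 : y != 0) (lam nu : C2 R) : nu.1 = 0 ->
  at_line (A lam nu phi) y = ((Num.sqrt (pi : R))^-1)%:C * at_line (C lam nu phi) y.
Proof.
move=> nu0; have [al [c [hal hc yE]]] := polar2 y.
suff H l : at_line (A (l, lam.2) nu phi) y =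
    ((Num.sqrt (pi : R))^-1)%:C * at_line (C (l, lam.2) nu phi) y.
  by have := H lam.1; rewrite -surjective_pairing.
have lineE w : ((0, lam.2), (nu.1, nu.2)) + w *: ((1, 0), (0, 0)) = ((w, lam.2), nu).
  by rewrite pair_lineE !mulr0 !addr0 mulr1 add0r -surjective_pairing.
move: l; apply: (@entire_identity R _ _ 4) => l.
- have := @A_line R 2 A hA phi y y0 ((0, lam.2), (nu.1, nu.2)) ((1, 0), (0, 0)) l.
  by apply: eq_holo => w; rewrite lineE.
- apply: holoZ; have := C_line hC phi y0 ((0, lam.2), (nu.1, nu.2)) ((1, 0), (0, 0)) l.
  by apply: eq_holo => w; rewrite lineE.
- by move=> l4; apply: (claim_AC_right hA hC phi y0 hal hc yE).
Qed.

Theorem theoremC (R : realType)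
    (A : forall n : nat, opfamily R n) (B : forall n : nat, opfamily R n)
    (C : opfamily R 2)
    (hA : forall n : nat, (2 <= n)%N -> is_A (A n))
    (hB : forall n : nat, (2 <= n)%N -> is_B (B n))
    (hC : is_C C) :
  forall (n : nat), (2 <= n)%N -> forall lam nu : C2 R,
    (forall j : nat, nu.1 = - rho1' R n - (2 * j)%N%:R ->
       forall (phi : Cinfty R n.+1) (y : 'rV[R]_n), y != 0 ->
       at_line (A n lam nu phi) y =
         (-1) ^+ j * (j`!%:R / (2 * j)%N`!%:R)
         * rGamma ((lam.1 + rho1 R n - nu.1 - rho1' R n) / 2)
         * A1_op j lam nu phi y) /\
    (forall N : nat, lam.1 + rho1 R n - nu.1 - rho1' R n = - (2 * N)%N%:R ->
       forall (phi : Cinfty R n.+1) (y : 'rV[R]_n), y != 0 ->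
       at_line (A n lam nu phi) y =
         (-1) ^+ N * (N`!%:R / (2 * N)%N`!%:R)
         * rGamma ((nu.1 + rho1' R n) / 2)
         * A2_op N lam nu phi y) /\
    (n = 2%N ->
       (nu.1 + rho1' R 2 = - 2 * rho2 R ->
          forall (phi : Cinfty R 3) (y : 'rV[R]_2), y != 0 ->
          at_line (A 2%N lam nu phi) y =
            ((Num.sqrt (pi : R))^-1)%:C * at_line (C lam nu phi) y) /\
       (nu.1 + rho1' R 2 = 0 ->
          forall (phi : Cinfty R 3) (y : 'rV[R]_2), y != 0 ->
          at_line (B 2%N lam nu phi) y =
            (Num.sqrt (pi : R))%:C * at_line (C lam nu phi) y)).
Proof.
have hA2 : is_A (A 2%N) by exact: hA.
(* Holomorphy of 1/Gamma is extracted from the family for n = 2 and then serves every n. *)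
have rG := rGamma_holo hA2.
move=> n n2 lam nu; split; [|split].
- move=> j nuE phi y y0.
  by rewrite (@A1_opE R n phi y y0 lam nu j nuE) (@A1_all R n (A n) rG (hA n n2) phi y y0 lam nu j nuE).
- move=> N bE phi y y0.
  by rewrite (@A2_opE R n phi y y0 lam nu N bE) (@A2_all R n (A n) rG (hA n n2) phi y y0 lam nu N bE).
- move=> _; split=> nuE phi y y0.
  + apply: (claim_AC hA2 hC) => //; move: nuE.
    have -> : - 2 * rho2 R = 1 by rewrite /rho2; field.
    rewrite /rho1' divff ?pnatr_eq0// => /eqP; rewrite -subr_eq0 addrK => /eqP.
    exact.
  + by apply: (claim_BC _ hC) => //; exact: hB.
Qed.
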